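(* For $R,S,T,W\in\mathcal{HS}$, $$\langle Q_R(S),Q_T(W)\rangle_{L^2(\mathbb{R}^{4d})}=\langle S,W\rangle_{\mathcal{HS}}\cdot\overline{\langle R,T\rangle_{\mathcal{HS}}}.$$
   Context: For $z=(z_1,z_2)\in\mathbb{R}^d\times\mathbb{R}^d$, $(\pi(z)f)(t)=e^{2\pi i z_2\cdot t}f(t-z_1)$ on $L^2(\mathbb{R}^d)$. $\mathcal{HS}$ is the Hilbert space of Hilbert–Schmidt operators on $L^2(\mathbb{R}^d)$ with $\langle S,T\rangle_{\mathcal{HS}}=\mathrm{tr}(ST^* )$; all inner products are linear in the first argument. For $w,z\in\mathbb{R}^{2d}$, $\gamma_{w,z}(S):=\pi(z)S\pi(w)^*$, and the polarised Cohen's class is the function on $\mathbb{R}^{4d}$ given by $Q_ST(w,z):=\langle T,\gamma_{w,z}(S)\rangle_{\mathcal{HS}}$ (window $S$ as subscript). *)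

(* Defs.v *)
From HB Require Import structures.
From mathcomp Require Import all_boot all_order all_algebra.
From mathcomp Require Import complex.
From mathcomp Require Import all_classical all_reals all_analysis.

Set Implicit Arguments.
Unset Strict Implicit.
Unset Printing Implicit Defensive.

Import Order.TTheory GRing.Theory Num.Theory.
Import numFieldNormedType.Exports.

Local Open Scope classical_set_scope.
Local Open Scope ring_scope.
Local Open Scope complex_scope.

(* R^d, with the product of the Borel sigma-algebras of R *)
Notation vec R d := (d.-tuple (measurableTypeR R)).

(* The library proves this lemma but keeps it local; the canonical instance
   attached to [\x] only covers sub-probabilities. *)
Section product_sigma_finite.
Local Open Scope ereal_scope.
Context d1 d2 (T1 : measurableType d1) (T2 : measurableType d2) (R : realType).

Lemma product_measure_sigma_finite (m1 : {sigma_finite_measure set T1 -> \bar R})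
    (m2 : {sigma_finite_measure set T2 -> \bar R}) :
  sigma_finite setT (m1 \x m2).
Proof.
have /sigma_finiteP[F [TF ndF Foo]] := sigma_finiteT m1.
have /sigma_finiteP[G [TG ndG Goo]] := sigma_finiteT m2.
exists (fun n => F n `*` G n).
  rewrite -setXTT TF TG predeqE => -[x y]; split.
    move=> [/= [n _ Fnx] [k _ Gky]]; exists (maxn n k) => //; split.
    - by move: x Fnx; exact/subsetPset/ndF/leq_maxl.
    - by move: y Gky; exact/subsetPset/ndG/leq_maxr.
  by move=> [n _ []/= ? ?]; split; exists n.
move=> k; have [? ?] := Foo k; have [? ?] := Goo k.
split; first exact: measurableX.
by rewrite product_measure1E// lte_mul_pinfty// ge0_fin_numE.
Qed.

End product_sigma_finite.


Section bundle.
Context d (T : measurableType d) (R : realType).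
Variables (m : {measure set T -> \bar R}) (sfm : sigma_finite setT m).

Definition sfbundle of sigma_finite setT m : set T -> \bar R := m.

HB.instance Definition _ := Measure.copy (sfbundle sfm) m.
HB.instance Definition _ := Measure_isSigmaFinite.Build d T R (sfbundle sfm) sfm.

Lemma sigma_finite_bundle :
  exists m' : {sigma_finite_measure set T -> \bar R}, m' = m :> (set T -> \bar R).
Proof. by exists (sfbundle sfm). Qed.

End bundle.

Lemma pushforward_sigma_finite d1 d2 (T1 : measurableType d1)
    (T2 : measurableType d2) (R : realType)
    (m : {measure set T1 -> \bar R}) (f : T1 -> T2) (g : T2 -> T1) :
  measurable_fun setT f -> measurable_fun setT g -> cancel f g ->
  sigma_finite setT m ->
  exists m' : {sigma_finite_measure set T2 -> \bar R},
    m' = pushforward m f :> (set T2 -> \bar R).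
Proof.
move=> mf mg fK [F TF Foo].
pose q : {measure set T2 -> \bar R} := measure_function_pushforward__canonical__measure_function_Measure m mf.
have /sigma_finite_bundle[m' m'E] : sigma_finite setT q.
  exists (fun k => g @^-1` F k).
    by rewrite -preimage_bigcup -TF preimage_setT.
  move=> k; have [mFk Fkoo] := Foo k; split.
    by rewrite -[X in measurable X]setTI; exact: mg.
  rewrite [X in (X < _)%E](_ : _ = m (F k))//=.
  rewrite /pushforward -comp_preimage; congr (m _).
  by apply/seteqP; split => x /=; rewrite fK.
by exists m'; rewrite m'E.
Qed.

Section lebesgue_vec.
Context {R : realType}.

Fixpoint lebesgue_vec (n : nat) : set (vec R n) -> \bar R :=
  match n return set (vec R n) -> \bar R with
  | 0%N => \d_[tuple of [::]]
  | n'.+1 => pushforward (lebesgue_measure \x @lebesgue_vec n')%E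
      (fun p : measurableTypeR R * vec R n' => [tuple of p.1 :: p.2])
  end.
Arguments lebesgue_vec : clear implicits.

Lemma lebesgue_vec_bundle (n : nat) :
  exists m : {sigma_finite_measure set (vec R n) -> \bar R},
    lebesgue_vec n = m :> (set _ -> _).
Proof.
elim: n => [|n [m mE]].
  have [|m mE] := @sigma_finite_bundle _ (vec R 0) R (\d_[tuple of [::]] : measure _ _).
    apply: fin_num_fun_sigma_finite; first by rewrite measure0.
    by move=> U mU; rewrite fin_num_measure.
  by exists m.
pose P := (measurableTypeR R * vec R n)%type.
pose c (p : P) : vec R n.+1 := [tuple of p.1 :: p.2].
have mc : measurable_fun setT c by exact: measurable_cons.
pose u (t : vec R n.+1) : P := (tnth t ord0, [tuple of behead t]).
have mu : measurable_fun setT u.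
  apply: measurable_fun_pair; first exact: measurable_tnth.
  exact: measurable_behead.
have [|m' m'E] := pushforward_sigma_finite mc mu _ (product_measure_sigma_finite (lebesgue_measure : sigma_finite_measure _ _) m).
  by move=> [x t]; rewrite /u/c; congr pair => //=; apply: val_inj.
by exists m'; rewrite m'E /= mE.
Qed.

Let lebesgue_vec0 n : lebesgue_vec n set0 = 0%E.
Proof. by have [m ->] := lebesgue_vec_bundle n; rewrite measure0. Qed.

Let lebesgue_vec_ge0 n A : (0 <= lebesgue_vec n A)%E.
Proof. by have [m ->] := lebesgue_vec_bundle n. Qed.

Let lebesgue_vec_semi_sigma_additive n : semi_sigma_additive (lebesgue_vec n).
Proof.
by have [m ->] := lebesgue_vec_bundle n; exact: measure_semi_sigma_additive.
Qed.

HB.instance Definition _ n := isMeasure.Build _ _ _ (lebesgue_vec n)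
  (@lebesgue_vec0 n) (@lebesgue_vec_ge0 n) (@lebesgue_vec_semi_sigma_additive n).

Let lebesgue_vec_sigma_finite n : sigma_finite setT (lebesgue_vec n).
Proof. by have [m ->] := lebesgue_vec_bundle n; exact: sigma_finiteT. Qed.

HB.instance Definition _ n := Measure_isSigmaFinite.Build _ _ _ (lebesgue_vec n)
  (@lebesgue_vec_sigma_finite n).

End lebesgue_vec.
Arguments lebesgue_vec : clear implicits.

Section lebesgue_phase.
Context (R : realType) (d : nat).

(* Lebesgue measure on R^2d, seen as R^d * R^d *)
Definition lebesgue_phase : set (vec R d * vec R d) -> \bar R :=
  (lebesgue_vec R d \x lebesgue_vec R d)%E.

HB.instance Definition _ := Measure.on lebesgue_phase.

Let lebesgue_phase_sigma_finite : sigma_finite setT lebesgue_phase.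
Proof. exact: product_measure_sigma_finite. Qed.

HB.instance Definition _ := Measure_isSigmaFinite.Build _ _ _ lebesgue_phase
  lebesgue_phase_sigma_finite.

(* Lebesgue measure on R^4d, seen as (R^d * R^d) * (R^d * R^d) *)
Definition lebesgue_phase2 :
    set ((vec R d * vec R d) * (vec R d * vec R d)) -> \bar R :=
  (lebesgue_phase \x lebesgue_phase)%E.

HB.instance Definition _ := Measure.on lebesgue_phase2.

Let lebesgue_phase2_sigma_finite : sigma_finite setT lebesgue_phase2.
Proof. exact: product_measure_sigma_finite. Qed.

HB.instance Definition _ := Measure_isSigmaFinite.Build _ _ _ lebesgue_phase2
  lebesgue_phase2_sigma_finite.

End lebesgue_phase.
Arguments lebesgue_phase : clear implicits.
Arguments lebesgue_phase2 : clear implicits.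

Section complex_L2.
Context d (T : measurableType d) (R : realType).
Variable mu : {measure set T -> \bar R}.
Implicit Types f g : T -> R[i].

(* The elements of L^2 are represented by functions; equality in L^2 is
   equality almost everywhere. *)
Definition L2norm f : \bar R := Lnorm mu 2%:E (fun x => (Normc.normc (f x))%:E).

Definition L2 : set (T -> R[i]) :=
  [set f | [/\ measurable_fun setT (fun x => complex.Re (f x)),
               measurable_fun setT (fun x => complex.Im (f x)) &
               (L2norm f < +oo)%E]].

Definition Cintegral f : R[i] :=
  (\int[mu]_x complex.Re (f x)) +i* (\int[mu]_x complex.Im (f x)).

Definition L2dot f g : R[i] := Cintegral (fun x => f x * conjc (g x)).

End complex_L2.

Section operators.
Context (R : realType) (d : nat).
Local Notation mu := (lebesgue_vec R d).
Local Notation func := (vec R d -> R[i]).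
Local Notation op := (func -> func).

(* Operators on L^2(R^d) are maps on representatives; only their values on
   [L2] functions, up to a.e. equality, are meaningful. *)
Record bounded_operator (A : op) : Prop := BoundedOperator {
  bop_L2 : forall f, L2 mu f -> L2 mu (A f);
  bop_ae : forall f g, L2 mu f -> L2 mu g -> f = g %[ae mu] ->
    A f = A g %[ae mu];
  bop_linear : forall (a : R[i]) f g, L2 mu f -> L2 mu g ->
    A (fun t => a * f t + g t) = (fun t => a * A f t + A g t) %[ae mu];
  bop_bounded : exists M : R, forall f, L2 mu f ->
    (L2norm mu (A f) <= M%:E * L2norm mu f)%E }.

(* Indexed by nat: L^2(R^d) is separable and, for 0 < d, of infinite
   dimension. *)
Record orthonormal_basis (e : nat -> func) : Prop := OrthonormalBasis {
  onb_L2 : forall n, L2 mu (e n);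
  onb_orthonormal : forall m n, L2dot mu (e m) (e n) = (m == n)%:R;
  onb_total : forall f, L2 mu f -> (forall n, L2dot mu f (e n) = 0) ->
    f = (fun=> 0) %[ae mu] }.

(* The sum of squares does not depend on the orthonormal basis. *)
Definition hilbert_schmidt (A : op) : Prop :=
  bounded_operator A /\
  exists2 e, orthonormal_basis e &
    (\sum_(0 <= n <oo) L2norm mu (A (e n)) ^+ 2 < +oo)%E.

(* Every bounded operator has an adjoint, unique up to a.e. equality; the
   default value of [xget] is irrelevant. *)
Definition adjoint (A : op) : op :=
  xget (fun f : func => f) [set B | bounded_operator B /\
    forall f g, L2 mu f -> L2 mu g -> L2dot mu (A f) g = L2dot mu f (B g)].

(* For a trace class operator the series converges, in every orthonormal
   basis, to the same complex number. *)
Definition op_trace (A : op) : R[i] :=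
  xget 0 [set t : R[i] | forall e, orthonormal_basis e ->
    series (fun n => L2dot mu (A (e n)) (e n) : (R[i] : numFieldType)) @ \oo
      --> (t : (R[i] : numFieldType))].

Definition HSdot (S T : op) : R[i] := op_trace (S \o adjoint T).

Definition translation (x : vec R d) (f : func) : func :=
  fun t => f [tuple tnth t i - tnth x i | i < d].

Definition dotv (x y : vec R d) : R := \sum_(i < d) tnth x i * tnth y i.

Definition expi (r : R) : R[i] := cos r +i* sin r.

Definition tfshift (z : vec R d * vec R d) : op :=
  fun f t => expi (2 * pi * dotv z.2 t) * translation z.1 f t.

Definition gammashift (w z : vec R d * vec R d) (S : op) : op :=
  tfshift z \o S \o adjoint (tfshift w).

Definition polarised_cohen (S T : op)
    (wz : (vec R d * vec R d) * (vec R d * vec R d)) : R[i] :=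
  HSdot T (gammashift wz.1 wz.2 S).

End operators.

(* Main.v *)
(* A Hilbert-Schmidt operator S has a kernel k_S in L^2(R^2d), and
   <S, T>_HS = <k_S, k_T>: for S = T this is Parseval's identity in each section
   of the kernel, and the general case follows by polarisation.  The kernel of
   pi(z) R pi(w)^* is e^{2 pi i (z2.s - w2.t)} k_R(s - z1, t - w1), so for fixed
   (z1, w1) the function Q_R(S) is the Fourier transform, in the variables
   (z2, w2), of the L^1 function k_S(s, t) conj(k_R(s - z1, t - w1)).  Plancherel's
   formula, Tonelli's theorem and translation invariance then give
   ||Q_R(S)|| = ||S|| ||R||, and polarising in S and in R yields the identity.

   Plancherel's formula is only needed for a in L^1(R), as an identity in
   [0, +oo].  By Fubini, the integral of |a^|^2 against the (suitably normalised)
   Fejer weight (sin x / x)^2 at scale delta is the integral of the squared moving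
   averages of a over windows of radius delta.  As delta -> 0 the weights are at most
   1 and tend to 1, while the moving averages do not increase the L^2 norm and tend
   to a almost everywhere, so Fatou's lemma gives both inequalities. *)

From HB Require Import structures.
Require Import Defs.
From mathcomp Require Import all_boot all_order all_algebra.
From mathcomp Require Import complex ring lra.
From mathcomp Require Import all_classical all_reals all_analysis.
From mathcomp Require Import measurable_realfun.

Set Implicit Arguments.
Unset Strict Implicit.
Unset Printing Implicit Defensive.

Import Order.TTheory GRing.Theory Num.Theory.
Import numFieldNormedType.Exports.

Local Open Scope classical_set_scope.
Local Open Scope ring_scope.
Local Open Scope complex_scope.

(** * Complex-valued measurable and integrable functions *)

(** Operators act on representatives and respect linearity and equality only almost everywhere,
    while [adjoint] and [op_trace] are choices made by [xget]. Kernels turn all of this into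
    explicit analysis: the adjoint becomes an integral operator and the trace series can be summed
    in every orthonormal basis. From then on only L^2 functions on R^2d occur, and Q_R(S) is given
    at every point, not merely almost everywhere, by an inner product of k_S with a shifted k_R.

    Polarisation is used three times: for the trace, for the pair S, W and for the pair R, T. Each
    time it reduces a sesquilinear identity to its diagonal, where only integrals or sums of
    nonnegative terms remain and Tonelli's theorem applies.

    The Fejer weight is chosen because its cosine transform is a triangle, and the same triangle
    gives the length of the overlap of two windows. The weighted power spectrum and the squared
    moving averages are therefore one and the same quadratic form in a, which is the exact identity
    behind both inequalities. *)

Section complex_numbers.
Variable R : realType.
Implicit Types (z a b : R[i]) (r : R).

(** The squared modulus as an element of the real field: the norm of [R[i]] takes values in [R[i]],
    and [Normc.normc] brings in a square root. *)
Definition nsq z : R := complex.Re z ^+ 2 + complex.Im z ^+ 2.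

Lemma nsq_ge0 z : 0 <= nsq z.
Proof. by rewrite addr_ge0 ?sqr_ge0. Qed.

Lemma nsq0 : nsq 0 = 0.
Proof. by rewrite /nsq /= expr0n addr0. Qed.

Lemma nsqM a b : nsq (a * b) = nsq a * nsq b.
Proof. by case: a b => [a1 a2] [b1 b2]; rewrite /nsq /=; ring. Qed.

Lemma nsq_conj z : nsq (conjc z) = nsq z.
Proof. by case: z => z1 z2; rewrite /nsq /= sqrrN. Qed.

Lemma nsqN z : nsq (- z) = nsq z.
Proof. by case: z => z1 z2; rewrite /nsq /= !sqrrN. Qed.

Lemma mul_conjc z : z * conjc z = (nsq z)%:C.
Proof.
by case: z => z1 z2; apply/eqP; rewrite eq_complex /nsq /=; apply/andP; split;
  apply/eqP; ring.
Qed.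

Lemma nsqD_le a b : nsq (a + b) <= 2 * nsq a + 2 * nsq b.
Proof.
case: a b => [a1 a2] [b1 b2]; rewrite /nsq /=.
by have := sqr_ge0 (a1 - b1); have := sqr_ge0 (a2 - b2); lra.
Qed.

Lemma nsqB_le a b : nsq (a - b) <= 2 * nsq a + 2 * nsq b.
Proof. by rewrite -(nsqN b) nsqD_le. Qed.

Lemma nsq_eq0 z : nsq z = 0 -> z = 0.
Proof.
case: z => z1 z2 /eqP; rewrite /nsq /= paddr_eq0 ?sqr_ge0// !sqrf_eq0.
by move=> /andP[/eqP-> /eqP->].
Qed.

Lemma normc_nsq z : Normc.normc z ^+ 2 = nsq z.
Proof. by case: z => z1 z2; rewrite /= sqr_sqrtr// addr_ge0 ?sqr_ge0. Qed.

(** Each product of two real coordinates is at most half the sum of their squares. A crude constant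
    suffices, as the bound only serves to prove integrability. *)
Lemma Re_Im_mul_le a b :
  `|complex.Re (a * b)| <= nsq a + nsq b /\ `|complex.Im (a * b)| <= nsq a + nsq b.
Proof.
case: a b => [a1 a2] [b1 b2]; rewrite /nsq /=; (split; rewrite ler_norml; apply/andP; split).
- by have := sqr_ge0 (a1 + b1); have := sqr_ge0 (a2 - b2); have := sqr_ge0 a1;
    have := sqr_ge0 b1; have := sqr_ge0 a2; have := sqr_ge0 b2; lra.
- by have := sqr_ge0 (a1 - b1); have := sqr_ge0 (a2 + b2); have := sqr_ge0 a1;
    have := sqr_ge0 b1; have := sqr_ge0 a2; have := sqr_ge0 b2; lra.
- by have := sqr_ge0 (a1 + b2); have := sqr_ge0 (a2 + b1); have := sqr_ge0 a1;
    have := sqr_ge0 b1; have := sqr_ge0 a2; have := sqr_ge0 b2; lra.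
- by have := sqr_ge0 (a1 - b2); have := sqr_ge0 (a2 - b1); have := sqr_ge0 a1;
    have := sqr_ge0 b1; have := sqr_ge0 a2; have := sqr_ge0 b2; lra.
Qed.

Lemma nsq_expi r : nsq (expi r) = 1.
Proof. by rewrite /nsq /= cos2Dsin2. Qed.

Lemma expiD r s : expi (r + s) = expi r * expi s.
Proof.
apply/eqP; rewrite eq_complex /= sinD cosD.
by apply/andP; split; apply/eqP; ring.
Qed.

Lemma expi0 : expi (0 : R) = 1.
Proof. by rewrite /expi sin0 cos0. Qed.

Lemma conj_expi r : conjc (expi r) = expi (- r).
Proof. by rewrite /expi /= cosN sinN. Qed.

Lemma conjcM a b : conjc (a * b) = conjc a * conjc b.
Proof. exact: rmorphM. Qed.

Lemma conjcD a b : conjc (a + b) = conjc a + conjc b.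
Proof. exact: rmorphD. Qed.

End complex_numbers.

Section complex_measurable.
Context d (T : measurableType d) (R : realType).
Implicit Types f g : T -> R[i].

Definition cmeas f := measurable_fun setT (fun x => complex.Re (f x)) /\
  measurable_fun setT (fun x => complex.Im (f x)).

Lemma cmeasD f g : cmeas f -> cmeas g -> cmeas (fun x => f x + g x).
Proof.
move=> [f1 f2] [g1 g2]; split.
- under eq_fun do rewrite raddfD/=; exact: measurable_funD.
- under eq_fun do rewrite raddfD/=; exact: measurable_funD.
Qed.

Lemma cmeasN f : cmeas f -> cmeas (fun x => - f x).
Proof.
move=> [f1 f2]; split.
- under eq_fun do rewrite raddfN/=; exact: measurableT_comp.
- under eq_fun do rewrite raddfN/=; exact: measurableT_comp.
Qed.

Lemma ReM (a b : R[i]) : complex.Re (a * b) =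
  complex.Re a * complex.Re b - complex.Im a * complex.Im b.
Proof. by case: a b => [? ?] [? ?]. Qed.

Lemma ImM (a b : R[i]) : complex.Im (a * b) =
  complex.Re a * complex.Im b + complex.Im a * complex.Re b.
Proof. by case: a b => [? ?] [? ?]. Qed.

Lemma cmeasM f g : cmeas f -> cmeas g -> cmeas (fun x => f x * g x).
Proof.
move=> [f1 f2] [g1 g2]; split.
- under eq_fun do rewrite ReM.
  by apply: measurable_funB; apply: measurable_funM.
- under eq_fun do rewrite ImM.
  by apply: measurable_funD; apply: measurable_funM.
Qed.

Lemma Re_conj (a : R[i]) : complex.Re (conjc a) = complex.Re a.
Proof. by case: a. Qed.

Lemma Im_conj (a : R[i]) : complex.Im (conjc a) = - complex.Im a.
Proof. by case: a. Qed.

Lemma cmeas_conj f : cmeas f -> cmeas (fun x => conjc (f x)).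
Proof.
move=> [f1 f2]; split.
- by under eq_fun do rewrite Re_conj.
- by under eq_fun do rewrite Im_conj; exact: measurableT_comp.
Qed.

Lemma cmeas_cst (a : R[i]) : cmeas (fun=> a).
Proof. by split; exact: measurable_cst. Qed.

Lemma cmeas_expi (p : T -> R) : measurable_fun setT p ->
  cmeas (fun x => expi (p x)).
Proof.
move=> mp; split => /=.
- by have /measurableT_comp := continuous_measurable_fun (@continuous_cos R); exact.
- by have /measurableT_comp := continuous_measurable_fun (@continuous_sin R); exact.
Qed.

Lemma measurable_nsq f : cmeas f -> measurable_fun setT (fun x => nsq (f x)).
Proof. by move=> [f1 f2]; apply: measurable_funD; exact: measurable_funX. Qed.

Lemma measurable_nsqE f : cmeas f ->
  measurable_fun setT (fun x => (nsq (f x))%:E).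
Proof. by move=> mf; apply/measurable_EFinP; exact: measurable_nsq. Qed.

End complex_measurable.

Lemma cmeas_comp d d' (T : measurableType d) (T' : measurableType d')
    (R : realType) (f : T -> R[i]) (p : T' -> T) :
  measurable_fun setT p -> cmeas f -> cmeas (f \o p).
Proof.
by move=> mp [f1 f2]; split;
  [exact: (measurableT_comp f1 mp)|exact: (measurableT_comp f2 mp)].
Qed.

Section complex_integral.
Context d (T : measurableType d) (R : realType).
Variable mu : {measure set T -> \bar R}.
Implicit Types f g : T -> R[i].

(** A norm equivalent to the modulus, suited to integrating real and imaginary parts separately. *)
Definition cabs (z : R[i]) : R := `|complex.Re z| + `|complex.Im z|.

Lemma cabs_ge0 z : 0 <= cabs z.
Proof. by rewrite addr_ge0. Qed.

Lemma cabsM_le (a b : R[i]) : cabs (a * b) <= cabs a * cabs b.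
Proof.
rewrite /cabs ReM ImM; apply: (@le_trans _ _
  (`|complex.Re a| * `|complex.Re b| + `|complex.Im a| * `|complex.Im b| +
  (`|complex.Re a| * `|complex.Im b| + `|complex.Im a| * `|complex.Re b|))).
  by rewrite lerD// -!normrM ?ler_normB// ler_normD.
by rewrite le_eqVlt; apply/orP; left; apply/eqP; ring.
Qed.

Lemma cabs_expi r : cabs (expi r) <= 2.
Proof.
have c1 : `|cos r| <= 1 by rewrite ler_norml cos_geN1 cos_le1.
have s1 : `|sin r| <= 1 by rewrite ler_norml sin_geN1 sin_le1.
by rewrite /cabs /=; lra.
Qed.

Lemma measurable_cabs f : cmeas f -> measurable_fun setT (fun x => cabs (f x)).
Proof.
by move=> [f1 f2]; apply: measurable_funD; apply: measurableT_comp.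
Qed.

Lemma measurable_cabsE f : cmeas f ->
  measurable_fun setT (fun x => (cabs (f x))%:E).
Proof. by move=> mf; apply/measurable_EFinP; exact: measurable_cabs. Qed.

Definition Cintble f :=
  mu.-integrable setT (fun x => (complex.Re (f x))%:E) /\
  mu.-integrable setT (fun x => (complex.Im (f x))%:E).

Lemma Cintble_cmeas f : Cintble f -> cmeas f.
Proof.
by move=> [/measurable_int/measurable_EFinP ? /measurable_int/measurable_EFinP].
Qed.

Lemma CintbleP f : Cintble f <->
  cmeas f /\ (\int[mu]_x (cabs (f x))%:E < +oo)%E.
Proof.
split=> [/[dup] /Cintble_cmeas mf [f1 f2]|[mf foo]].
  split=> //; under eq_integral do rewrite EFinD.
  have [mf1 mf2] := mf.
  rewrite ge0_integralD//=.
  - by apply: lte_add_pinfty; [case/integrableP: f1|case/integrableP: f2].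
  - by apply/measurable_EFinP; apply: measurableT_comp.
  - by apply/measurable_EFinP; apply: measurableT_comp.
have [mf1 mf2] := mf.
split; apply/integrableP; split; try exact/measurable_EFinP.
  apply: le_lt_trans foo; apply: ge0_le_integral => //.
  - by apply: measurableT_comp => //; apply/measurable_EFinP.
  - exact: measurable_cabsE.
  - by move=> x _ /=; rewrite lee_fin /cabs lerDl.
apply: le_lt_trans foo; apply: ge0_le_integral => //.
- by apply: measurableT_comp => //; apply/measurable_EFinP.
- exact: measurable_cabsE.
- by move=> x _ /=; rewrite lee_fin /cabs lerDr.
Qed.

Lemma Cintble_le f (g : T -> R) : cmeas f ->
  mu.-integrable setT (EFin \o g) -> (forall x, cabs (f x) <= g x) -> Cintble f.
Proof.
move=> mf /integrableP[mg goo] fg; apply/CintbleP; split=> //.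
apply: le_lt_trans goo; apply: ge0_le_integral => //.
- by move=> x _; rewrite lee_fin cabs_ge0.
- exact: measurable_cabsE.
- exact: measurableT_comp.
- by move=> x _; rewrite lee_fin (le_trans (fg x))// ler_norm.
Qed.

Lemma integrable_scale (k : R) (f : T -> R) : mu.-integrable setT (EFin \o f) ->
  mu.-integrable setT (EFin \o (fun x => k * f x)).
Proof.
move=> fi; rewrite (_ : _ \o _ = fun x => (k%:E * (EFin \o f) x)%E).
  exact: integrableZl.
by apply/funext => x /=; rewrite EFinM.
Qed.

Lemma CintbleZ (a : R[i]) f : Cintble f -> Cintble (fun x => a * f x).
Proof.
move=> [f1 f2]; split.
  under eq_fun do rewrite ReM EFinB.
  by apply: integrableB => //; exact: integrable_scale.
under eq_fun do rewrite ImM EFinD.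
by apply: integrableD => //; exact: integrable_scale.
Qed.

Lemma Cintble_conj f : Cintble f -> Cintble (fun x => conjc (f x)).
Proof.
move=> [f1 f2]; split; first by under eq_fun do rewrite Re_conj.
under eq_fun do rewrite Im_conj EFinN.
exact: integrableN.
Qed.

Lemma CintegralD f g : Cintble f -> Cintble g ->
  Cintegral mu (fun x => f x + g x) = Cintegral mu f + Cintegral mu g.
Proof.
move=> [f1 f2] [g1 g2]; apply/eqP; rewrite eq_complex /=.
by apply/andP; split; apply/eqP; rewrite -RintegralD//; apply: eq_Rintegral => x _;
  rewrite raddfD.
Qed.

Lemma CintegralZ a f : Cintble f ->
  Cintegral mu (fun x => a * f x) = a * Cintegral mu f.
Proof.
move=> [f1 f2]; apply/eqP; rewrite eq_complex ReM ImM /=.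
apply/andP; split; apply/eqP.
  rewrite -!RintegralZl// -RintegralB//.
  - by apply: eq_Rintegral => x _; rewrite ReM.
  - exact: integrable_scale.
  - exact: integrable_scale.
rewrite -!RintegralZl// -RintegralD//.
- by apply: eq_Rintegral => x _; rewrite ImM.
- exact: integrable_scale.
- exact: integrable_scale.
Qed.

Lemma RintegralN (f : T -> R) : mu.-integrable setT (EFin \o f) ->
  \int[mu]_x (- f x) = - \int[mu]_x f x.
Proof.
move=> fi; rewrite -mulN1r -RintegralZl//.
by apply: eq_Rintegral => x _; rewrite mulN1r.
Qed.

Lemma Cintegral_conj f : Cintble f ->
  Cintegral mu (fun x => conjc (f x)) = conjc (Cintegral mu f).
Proof.
move=> [f1 f2]; apply/eqP; rewrite eq_complex /=.
apply/andP; split; apply/eqP; first by apply: eq_Rintegral => x _; rewrite Re_conj.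
by rewrite -RintegralN//; apply: eq_Rintegral => x _; rewrite Im_conj.
Qed.

Lemma eq_Cintegral f g : f =1 g -> Cintegral mu f = Cintegral mu g.
Proof. by move=> /funext->. Qed.

Lemma ae_eq_Cintegral f g : cmeas f -> cmeas g -> f = g %[ae mu] ->
  Cintegral mu f = Cintegral mu g.
Proof.
move=> [f1 f2] [g1 g2] fg; apply/eqP; rewrite eq_complex /=.
apply/andP; split; apply/eqP; congr fine; apply: ae_eq_integral => //;
  try exact/measurable_EFinP; by apply: filterS fg => x /= h _; rewrite h.
Qed.

Definition N2 f : \bar R := (\int[mu]_x (nsq (f x))%:E)%E.

Lemma N2_ge0 f : (0 <= N2 f)%E.
Proof. by apply: integral_ge0 => x _; rewrite lee_fin nsq_ge0. Qed.

(** Valid also when both sides are infinite, so that membership in L^2 and the Hilbert-Schmidt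
    condition can be read off [N2]. *)
Lemma L2norm_sqr f : (L2norm mu f ^+ 2 = N2 f)%E.
Proof.
have sqrE (x : \bar R) : (0 <= x -> x ^+ 2 = x `^ 2)%E.
  case: x => //= [r r0|_]; first by rewrite -EFinM powR_mulrn.
  by rewrite mulyy pnatr_eq0.
rewrite /L2norm sqrE ?Lnorm_ge0// poweR_Lnorm//.
apply: eq_integral => x _; rewrite -sqrE// -normc_nsq /= -EFinM.
by rewrite -expr2 real_normK ?num_real.
Qed.

End complex_integral.

(** * The space L^2, completeness and Parseval's identity *)

Section L2_theory.
Context d (T : measurableType d) (R : realType).
Variable mu : {measure set T -> \bar R}.
Implicit Types (f g h : T -> R[i]) (a : R[i]).
Local Notation L2 := (L2 mu).
Local Notation dot := (L2dot mu).

Lemma L2P f : L2 f <-> cmeas f /\ (N2 mu f < +oo)%E.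
Proof.
have L2E : (L2norm mu f < +oo <-> N2 mu f < +oo)%E.
  rewrite -L2norm_sqr expe2.
  have : (0 <= L2norm mu f)%E by exact: Lnorm_ge0.
  by case: (L2norm mu f) => //= r _; rewrite -EFinM !ltry.
by split=> [[? ? /L2E]|[[? ?] /L2E]].
Qed.

Lemma L2_cmeas f : L2 f -> cmeas f.
Proof. by move=> /L2P[]. Qed.

Lemma N2D_le f g : cmeas f -> cmeas g ->
  (N2 mu (fun x => f x + g x)%R <= 2%:E * N2 mu f + 2%:E * N2 mu g)%E.
Proof.
move=> mf mg; have mf2 := measurable_nsqE mf; have mg2 := measurable_nsqE mg.
have n0 (h : T -> R[i]) x : (0 <= (nsq (h x))%:E)%E by rewrite lee_fin nsq_ge0.
rewrite /N2 -!ge0_integralZl// -ge0_integralD//.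
- apply: ge0_le_integral => //; first by move=> x _; rewrite lee_fin nsq_ge0.
  + exact/measurable_nsqE/cmeasD.
  + by apply: emeasurable_funD; apply: measurable_funeM.
  + by move=> x _; rewrite -!EFinM -EFinD lee_fin nsqD_le.
- by move=> x _; rewrite mule_ge0.
- exact: measurable_funeM.
- by move=> x _; rewrite mule_ge0.
- exact: measurable_funeM.
Qed.

Lemma N2Z a f : cmeas f -> N2 mu (fun x => a * f x) = ((nsq a)%:E * N2 mu f)%E.
Proof.
move=> mf; rewrite /N2 -ge0_integralZl ?lee_fin ?nsq_ge0//.
- by apply: eq_integral => x _; rewrite nsqM EFinM.
- exact: measurable_nsqE.
- by move=> x _; rewrite lee_fin nsq_ge0.
Qed.

Lemma L2_lin a f g : L2 f -> L2 g -> L2 (fun x => a * f x + g x).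
Proof.
move=> /L2P[mf foo] /L2P[mg goo]; apply/L2P.
have maf := cmeasM (cmeas_cst T a) mf.
split; first exact: cmeasD.
apply: le_lt_trans (N2D_le maf mg) _; rewrite N2Z//.
have [r fr] : exists r, N2 mu f = r%:E.
  by exists (fine (N2 mu f)); rewrite fineK// ge0_fin_numE ?N2_ge0.
have [s gs] : exists r, N2 mu g = r%:E.
  by exists (fine (N2 mu g)); rewrite fineK// ge0_fin_numE ?N2_ge0.
by rewrite fr gs -!EFinM -EFinD ltry.
Qed.

Lemma L2Z a f : L2 f -> L2 (fun x => a * f x).
Proof.
move=> /L2P[mf foo]; apply/L2P; split; first exact: cmeasM (cmeas_cst T a) mf.
by rewrite N2Z// lte_mul_pinfty ?lee_fin ?nsq_ge0.
Qed.

Lemma L2D f g : L2 f -> L2 g -> L2 (fun x => f x + g x).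
Proof.
by move=> Lf Lg; under eq_fun do rewrite -[f _]mul1r; exact: L2_lin.
Qed.

Lemma L2B f g : L2 f -> L2 g -> L2 (fun x => f x - g x).
Proof.
by move=> Lf Lg; under eq_fun do rewrite addrC -mulN1r; exact: L2_lin.
Qed.

Lemma L20 : L2 (fun=> 0).
Proof.
apply/L2P; split; first exact: cmeas_cst.
by rewrite /N2; under eq_integral do rewrite nsq0; rewrite integral0.
Qed.

Lemma L2_sum (u : nat -> T -> R[i]) m n : (forall k, L2 (u k)) ->
  L2 (fun x => \sum_(m <= k < n) u k x).
Proof.
move=> Lu; elim: n => [|n IH].
  by under eq_fun do rewrite big_geq//; exact: L20.
have [mn|mn] := leqP m n; last by under eq_fun do rewrite big_geq//; exact: L20.
by under eq_fun do rewrite big_nat_recr//=; exact: L2D.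
Qed.

(** [fine] sends an infinite value to 0, so this is the squared norm only on L^2. *)
Definition n2 f : R := fine (N2 mu f).

Lemma n2_ge0 f : 0 <= n2 f.
Proof. by rewrite fine_ge0// N2_ge0. Qed.

Lemma n2E f : L2 f -> (n2 f)%:E = N2 mu f.
Proof. by move=> /L2P[_ foo]; rewrite fineK// ge0_fin_numE ?N2_ge0. Qed.

Lemma n2Z a f : L2 f -> n2 (fun x => a * f x) = nsq a * n2 f.
Proof.
move=> Lf; apply: EFin_inj; rewrite n2E; last exact: L2Z.
by rewrite N2Z ?EFinM ?n2E//; exact: L2_cmeas.
Qed.

Lemma n2_eq0 f : L2 f -> n2 f = 0 -> f = (fun=> 0) %[ae mu].
Proof.
move=> Lf f0; have mf := L2_cmeas Lf.
have : (\int[mu]_x `|(nsq (f x))%:E| = 0)%E.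
  under eq_integral do rewrite gee0_abs ?lee_fin ?nsq_ge0//.
  by rewrite -[LHS]/(N2 mu f) -n2E// f0.
move=> /(ae_eq_integral_abs mu measurableT (measurable_nsqE mf)).
by apply: filterS => x /= /(_ I)[] /nsq_eq0 -> _.
Qed.

Lemma L2_Cintble f g : L2 f -> L2 g -> Cintble mu (fun x => f x * conjc (g x)).
Proof.
move=> /L2P[mf foo] /L2P[mg goo].
apply: (@Cintble_le _ _ _ _ _ (fun x => 2 * (nsq (f x) + nsq (g x)))).
- exact/cmeasM/cmeas_conj.
- apply: integrable_scale; apply/integrableP; split.
    apply/measurable_EFinP; apply: measurable_funD; exact: measurable_nsq.
  rewrite (eq_integral (fun x => (nsq (f x))%:E + (nsq (g x))%:E)%E); last first.
    by move=> x _; rewrite gee0_abs// lee_fin addr_ge0 ?nsq_ge0.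
  rewrite ge0_integralD//; try exact: measurable_nsqE.
  + exact: lte_add_pinfty.
  + by move=> x _; rewrite lee_fin nsq_ge0.
  + by move=> x _; rewrite lee_fin nsq_ge0.
- move=> x; have [] := Re_Im_mul_le (f x) (conjc (g x)).
  by rewrite nsq_conj /cabs; lra.
Qed.

Lemma dot_linl a f g h : L2 f -> L2 g -> L2 h ->
  dot (fun x => a * f x + g x) h = a * dot f h + dot g h.
Proof.
move=> Lf Lg Lh; rewrite /L2dot -CintegralZ; last exact: L2_Cintble.
rewrite -CintegralD; [|by apply: CintbleZ; exact: L2_Cintble|exact: L2_Cintble].
by apply: eq_Cintegral => x; rewrite mulrDl mulrA.
Qed.

Lemma dot_conj f g : L2 f -> L2 g -> dot g f = conjc (dot f g).
Proof.
move=> Lf Lg; rewrite /L2dot -Cintegral_conj; last exact: L2_Cintble.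
by apply: eq_Cintegral => x; rewrite conjcM conjcK mulrC.
Qed.

Lemma dot_linr a f g h : L2 f -> L2 g -> L2 h ->
  dot h (fun x => a * f x + g x) = conjc a * dot h f + dot h g.
Proof.
move=> Lf Lg Lh; rewrite dot_conj//; last exact: L2_lin.
by rewrite dot_linl// conjcD conjcM -!dot_conj.
Qed.

Lemma dot_n2 f : L2 f -> dot f f = (n2 f)%:C.
Proof.
move=> Lf; apply/eqP; rewrite eq_complex /= /n2 /N2; apply/andP; split; apply/eqP.
  by congr fine; apply: eq_integral => x _; rewrite mul_conjc.
rewrite /Rintegral integral0_eq// => x _.
by rewrite mul_conjc.
Qed.

Lemma ae_eq_dotl f g h : L2 f -> L2 g -> L2 h -> f = g %[ae mu] ->
  dot f h = dot g h.
Proof.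
move=> Lf Lg Lh fg; apply: ae_eq_Cintegral.
- by apply: cmeasM; [exact: L2_cmeas|exact/cmeas_conj/L2_cmeas].
- by apply: cmeasM; [exact: L2_cmeas|exact/cmeas_conj/L2_cmeas].
- by apply: filterS fg => x /= fgx /fgx ->.
Qed.

Lemma ae_eq_dotr f g h : L2 f -> L2 g -> L2 h -> f = g %[ae mu] ->
  dot h f = dot h g.
Proof.
by move=> Lf Lg Lh fg; rewrite dot_conj// (ae_eq_dotl Lf Lg Lh fg) -dot_conj.
Qed.

Lemma dot0l g : dot (fun=> 0) g = 0.
Proof.
by rewrite /L2dot /Cintegral; apply/eqP; rewrite eq_complex /=; apply/andP; split;
  apply/eqP; rewrite /Rintegral integral0_eq// => x _; rewrite mul0r.
Qed.

Lemma dotBl f g h : L2 f -> L2 g -> L2 h ->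
  dot (fun x => f x - g x) h = dot f h - dot g h.
Proof.
move=> Lf Lg Lh; under [in LHS]eq_fun do rewrite addrC -mulN1r.
by rewrite dot_linl// mulN1r addrC.
Qed.

Lemma dotZl a f h : L2 f -> L2 h -> dot (fun x => a * f x) h = a * dot f h.
Proof.
move=> Lf Lh; under [in LHS]eq_fun do rewrite -[_ * _]addr0.
by rewrite (dot_linl _ Lf L20 Lh) dot0l addr0.
Qed.

Lemma dotZr a f h : L2 f -> L2 h -> dot h (fun x => a * f x) = conjc a * dot h f.
Proof.
move=> Lf Lh; rewrite dot_conj//; last exact: L2Z.
by rewrite dotZl// conjcM -dot_conj.
Qed.

Lemma dot_suml (u : nat -> T -> R[i]) h m n : (forall k, L2 (u k)) -> L2 h ->
  dot (fun x => \sum_(m <= k < n) u k x) h = \sum_(m <= k < n) dot (u k) h.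
Proof.
move=> Lu Lh; elim: n => [|n IH].
  by under eq_fun do rewrite big_geq//; rewrite big_geq// dot0l.
have [mn|mn] := leqP m n; last first.
  by under eq_fun do rewrite big_geq//; rewrite big_geq// dot0l.
under eq_fun do rewrite big_nat_recr//= addrC -[u n _]mul1r.
rewrite dot_linl//; last exact: L2_sum.
by rewrite mul1r IH big_nat_recr//= addrC.
Qed.

Lemma n2_lin a f g : L2 f -> L2 g -> n2 (fun x => a * f x + g x) =
  nsq a * n2 f + n2 g + 2 * complex.Re (a * dot f g).
Proof.
move=> Lf Lg; apply: complexI; rewrite -dot_n2; last exact: L2_lin.
rewrite dot_linl ?dot_linr//; [|exact: L2_lin..].
rewrite !dot_n2// (dot_conj Lf Lg).
case: (dot f g) => x y; case: (a) => a1 a2.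
apply/eqP; rewrite eq_complex /nsq /=; apply/andP; split; apply/eqP; ring.
Qed.

(** If g has norm 0, it vanishes almost everywhere. Otherwise f minus its projection on g has a
    nonnegative squared norm, which is expanded. *)
Lemma cauchy_schwarz f g : L2 f -> L2 g -> nsq (dot f g) <= n2 f * n2 g.
Proof.
move=> Lf Lg; have := n2_ge0 g; rewrite le_eqVlt => /predU1P[g0|g0].
  rewrite (ae_eq_dotr Lg L20 Lf (n2_eq0 Lg (esym g0))) dot_conj//; last exact: L20.
  by rewrite dot0l conjc0 nsq0 mulr_ge0 ?n2_ge0.
have := n2_ge0 (fun x => - (dot f g / (n2 g)%:C) * g x + f x).
rewrite n2_lin// nsqN nsqM (dot_conj Lf Lg).
have -> : nsq (n2 g)%:C^-1 = (n2 g)^-1 ^+ 2.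
  by rewrite -(fmorphV (real_complex R)) /nsq /= expr0n addr0.
have -> (z : R[i]) (n : R) : complex.Re (- (z / n%:C) * conjc z) = - (nsq z / n).
  rewrite mulNr mulrAC mul_conjc -(fmorphV (real_complex R)).
  by rewrite -(rmorphM (real_complex R)).
have -> : nsq (dot f g) * (n2 g)^-1 ^+ 2 * n2 g = nsq (dot f g) / n2 g.
  by rewrite expr2 -!mulrA mulVf ?mulr1// gt_eqF.
move=> h; rewrite -ler_pdivrMr//; lra.
Qed.

End L2_theory.

(** * Polarisation of sesquilinear forms *)

Section polarization.
Context (T : Type) (R : realType) (P : set (T -> R[i])).
Implicit Types F G : (T -> R[i]) -> (T -> R[i]) -> R[i].

Definition sesquilinear F := forall (a : R[i]) f g h, P f -> P g -> P h ->
  F (fun x => a * f x + g x) h = a * F f h + F g h /\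
  F h (fun x => a * f x + g x) = conjc a * F h f + F h g.

Hypothesis P_lin : forall (a : R[i]) f g, P f -> P g -> P (fun x => a * f x + g x).

(** The two diagonal differences equal F f g + F g f and i (F f g - F g f), which together determine
    F f g. The coefficient 1 in [s] makes both combinations instances of [P_lin]. *)
Lemma polarization F f g : sesquilinear F -> P f -> P g ->
  let s := fun x => 1 * f x + g x in let t := fun x => 'i * f x + g x in
  F f g = ((F s s - F f f - F g g) - 'i * (F t t - F f f - F g g)) / 2.
Proof.
move=> sF Pf Pg s t.
have Fl a h : P h -> F (fun x => a * f x + g x) h = a * F f h + F g h.
  by move=> Ph; have [->] := sF a f g h Pf Pg Ph.
have Fr a h : P h -> F h (fun x => a * f x + g x) = conjc a * F h f + F h g.
  by move=> Ph; have [_ ->] := sF a f g h Pf Pg Ph.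
rewrite /s /t !Fl ?Fr//; [|exact: P_lin..].
have -> : conjc (1 : R[i]) = 1 by rewrite conjc1.
have -> : conjc ('i : R[i]) = - 'i by apply/eqP; rewrite eq_complex /= oppr0 !eqxx.
have i2 : 'i * 'i = -1 :> R[i] by rewrite -expr2 sqr_i.
have n2 : (2 : R[i]) != 0 by rewrite pnatr_eq0.
apply: (mulIf n2); rewrite mulfVK//.
set A := F f f; set B := F f g; set C := F g f; set D := F g g.
transitivity (B + C - ('i * 'i) * ('i * 'i) * 0 + (B - C)); first by ring.
have -> : 'i * ('i * (- 'i * A + B) + (- 'i * C + D) - A - D) =
  - ('i * 'i) * 'i * A + 'i * 'i * B - 'i * 'i * C - 'i * A by ring.
rewrite i2; ring.
Qed.

Lemma sesquilinear_eq F G : sesquilinear F -> sesquilinear G ->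
  (forall f, P f -> F f f = G f f) -> forall f g, P f -> P g -> F f g = G f g.
Proof.
move=> sF sG FG f g Pf Pg.
by rewrite (polarization sF)// (polarization sG)// !FG//; exact: P_lin.
Qed.

End polarization.

Lemma sesquilinear_dot d (T : measurableType d) (R : realType)
  (mu : {measure set T -> \bar R}) : sesquilinear (L2 mu) (L2dot mu).
Proof. by move=> a f g h Lf Lg Lh; rewrite dot_linl// dot_linr. Qed.

(** Almost everywhere the limit is a lower limit, whose integral is controlled by Fatou's lemma.
    This form, with a uniform bound on the integrals, serves completeness and both halves of
    Plancherel's formula. *)
Lemma fatou_le d (T : measurableType d) (R : realType)
    (mu : {measure set T -> \bar R}) (g_ : nat -> T -> R) (g : T -> R)
    (c : \bar R) :
  (forall k, measurable_fun setT (g_ k)) -> measurable_fun setT g ->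
  (forall k x, 0 <= g_ k x) ->
  {ae mu, forall x, g_ k x @[k --> \oo] --> g x} ->
  (forall k, (\int[mu]_x (g_ k x)%:E <= c)%E) ->
  (\int[mu]_x (g x)%:E <= c)%E.
Proof.
move=> mg_ mg g0 gg intc.
have mEg k : measurable_fun setT (fun x => (g_ k x)%:E) by exact/measurable_EFinP.
have minf : measurable_fun setT (fun x => limn_einf (fun k => (g_ k x)%:E)).
  apply: measurableT_comp => //; apply: measurable_fun_limn_esup => k.
  exact: measurableT_comp.
rewrite (ae_eq_integral (fun x => limn_einf (fun k => (g_ k x)%:E)))//; last 2 first.
- exact/measurable_EFinP.
- apply: filterS gg => x /= gx _; apply/esym.
  have {}gx : (g_ k x)%:E @[k --> \oo] --> (g x)%:E.
    by apply: cvg_EFin => //; exact: nearW.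
  by have [->] := cvg_limn_einf_sup gx.
apply: (le_trans (fatou mu measurableT mEg _)).
  by move=> k x _; rewrite lee_fin.
rewrite limn_einf_lim; apply: lime_le; first exact: is_cvg_einfs.
apply: nearW => n; apply: le_trans (intc n).
by apply: ereal_inf_lbound; exists n => /=.
Qed.

(** * Completeness of L^2 *)

Section L2_completeness.
Context d (T : measurableType d) (R : realType).
Variable mu : {measure set T -> \bar R}.
Implicit Types (f g : T -> R[i]).
Local Notation L2 := (L2 mu).
Local Notation dot := (L2dot mu).
Local Notation n2 := (n2 mu).

Lemma sum_inv_pow2_le n : \sum_(0 <= k < n) (2 ^+ k)^-1 <= 2 :> R.
Proof.
have -> : \sum_(0 <= k < n) (2 ^+ k)^-1 = 2 - 2 / 2 ^+ n :> R.
  elim: n => [|n IH]; first by rewrite big_geq// expr0 divr1 subrr.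
  rewrite big_nat_recr//= IH exprS invfM; field.
  by rewrite expf_neq0.
by rewrite lerBlDr lerDl divr_ge0// exprn_ge0.
Qed.

(** From 2^k (|r_k| - 2^-k)^2 >= 0 it follows that |r_k| <= 2^k r_k^2 + 2^-k, so the series
    converges absolutely. Pointwise convergence is thus obtained from sums of squares alone. *)
Lemma series_cvg_of_weighted_squares (r : nat -> R) (M : R) :
  (forall n, \sum_(0 <= k < n) 2 ^+ k * r k ^+ 2 <= M) -> cvgn (series r).
Proof.
move=> rM; apply: normed_cvg.
apply: nondecreasing_is_cvgn; first by apply: nondecreasing_series => k _ _; exact: normr_ge0.
exists (M + 2) => _ [n _ <-]; rewrite /series /=.
apply: le_trans (lerD (rM n) (sum_inv_pow2_le n)); rewrite -big_split/=; apply: ler_sum => k _.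
have c0 : 0 < 2 ^+ k :> R by rewrite exprn_gt0.
rewrite -(real_normK (num_real (r k))); set c := 2 ^+ k in c0 *; set a := `|r k|.
have : 0 <= c * (a - c^-1) ^+ 2 by rewrite mulr_ge0 ?sqr_ge0 ?ltW.
have -> : c * (a - c^-1) ^+ 2 = c * a ^+ 2 - 2 * a + c^-1.
  by field; rewrite gt_eqF.
have := normr_ge0 (r k); rewrite -/a.
have : 0 <= c * a ^+ 2 by rewrite mulr_ge0 ?sqr_ge0 ?ltW.
have : 0 <= c^-1 by rewrite invr_ge0 ltW.
lra.
Qed.

(** The sum [G] of the 2^k |t_{k+1} - t_k|^2 has integral at most the sum of 2^k 4^-k, so it is
    finite almost everywhere, and where it is finite the increments are summable. A measurable [E]
    is provided so that limits can be cut off by its indicator. *)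
Lemma fast_cauchy_ae_cvg (t : nat -> T -> R[i]) : (forall k, L2 (t k)) ->
  (forall k, n2 (fun x => t k.+1 x - t k x) <= (4 ^+ k)^-1) ->
  exists2 E : set T, measurable E /\ mu (~` E) = 0 & forall x, E x ->
    cvgn (fun k => complex.Re (t k x)) /\ cvgn (fun k => complex.Im (t k x)).
Proof.
move=> Lt tf; pose dt k x := t k.+1 x - t k x.
have Ld k : L2 (dt k) by exact: L2B.
pose G x := (\sum_(0 <= k <oo) (2 ^+ k * nsq (dt k x))%:E)%E.
have mGk k : measurable_fun setT (fun x => (2 ^+ k * nsq (dt k x))%:E).
  apply/measurable_EFinP; apply: measurable_funM => //.
  exact/measurable_nsq/L2_cmeas.
have Gk0 k x : (0 <= (2 ^+ k * nsq (dt k x))%:E)%E.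
  by rewrite lee_fin mulr_ge0 ?nsq_ge0 ?exprn_ge0.
have mG : measurable_fun setT G.
  by apply: ge0_emeasurable_sum => // k x _ _; exact: Gk0.
have Goo : (\int[mu]_x G x < +oo)%E.
  rewrite /G integral_nneseries//.
  apply: (@le_lt_trans _ _ (\sum_(0 <= k <oo) ((2 ^+ k)^-1)%:E)%E).
    apply: lee_nneseries => k _.
      by move=> _; apply: integral_ge0.
    under eq_integral do rewrite EFinM.
    rewrite ge0_integralZl//; last 2 first.
    - by apply/measurable_nsqE/L2_cmeas.
    - by move=> x _; rewrite lee_fin nsq_ge0.
    rewrite -[X in (_ * X)%E]/(N2 mu (dt k)) -n2E// -EFinM lee_fin.
    apply: le_trans (ler_wpM2l _ (tf k)) _; first by rewrite exprn_ge0.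
    rewrite (_ : 4 = 2 * 2); last by rewrite -natrM.
    by rewrite exprMn invfM mulrA divff ?mul1r// expf_neq0.
  apply: le_lt_trans (ltry 2); apply: lime_le; first exact: is_cvg_nneseries.
  by apply: nearW => n; rewrite sumEFin lee_fin sum_inv_pow2_le.
exists [set x | (G x < +oo)%E]; first split.
- by rewrite -[X in measurable X]setTI; exact: emeasurable_fun_infty_o.
- have /integrable_ae : mu.-integrable setT G.
    apply/integrableP; split=> //; under eq_integral do rewrite gee0_abs ?nneseries_ge0//.
    exact: Goo.
  move=> /(_ measurableT) ae_fin.
  apply/(negligibleP mu).
    by apply: measurableC; rewrite -[X in measurable X]setTI; exact: emeasurable_fun_infty_o.
  apply: negligibleS ae_fin => x /= h1 h2; apply: h1.
  by have /= := h2 I; rewrite ge0_fin_numE// nneseries_ge0.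
move=> x /= Gx.
have bound n : \sum_(0 <= k < n) 2 ^+ k * nsq (dt k x) <= fine (G x).
  rewrite -lee_fin fineK ?ge0_fin_numE ?nneseries_ge0// -sumEFin.
  exact: nneseries_lim_ge.
have tele (u : nat -> R) : cvgn (series (fun k => u k.+1 - u k)) -> cvgn u.
  have -> : series (fun k => u k.+1 - u k) = (fun n => u n - u 0%N).
    by apply/funext => n; rewrite /series /= telescope_sumr.
  move=> h; have -> : u = (fun n => (u n - u 0%N) + u 0%N).
    by apply/funext => n; rewrite subrK.
  by apply: is_cvgD => //; exact: is_cvg_cst.
split; apply: tele; apply: (@series_cvg_of_weighted_squares _ (fine (G x))) => n;
  apply: le_trans (bound n); apply: ler_sum => k _; rewrite ler_pM2l ?exprn_gt0//;
  rewrite /dt /nsq !raddfB/= ?lerDl ?lerDr sqr_ge0//.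
Qed.

Lemma L2_complete (s : nat -> T -> R[i]) : (forall n, L2 (s n)) ->
  (forall e, 0 < e -> exists N, forall m n, (N <= m)%N -> (N <= n)%N ->
    n2 (fun x => s m x - s n x) <= e) ->
  exists2 f, L2 f & n2 (fun x => f x - s n x) @[n --> \oo] --> (0 : R).
Proof.
move=> Ls cs.
have /choice[N HN] : forall k : nat, exists N, forall m n, (N <= m)%N -> (N <= n)%N ->
    n2 (fun x => s m x - s n x) <= (4 ^+ k)^-1.
  by move=> k; apply: cs; rewrite invr_gt0 exprn_gt0.
(* Summing the [N j] makes [p] nondecreasing and at least [N k]; the extra [k] makes it tend to
   infinity. *)
pose p k := (\sum_(j < k.+1) N j + k)%N.
have pN k : (N k <= p k)%N by rewrite /p big_ord_recr/= -addnA -addnCA leq_addr.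
have pS k : (p k <= p k.+1)%N.
  by rewrite /p [in X in (_ <= X)%N]big_ord_recr /= -addnA leq_add2l addnS ltnW// ltnS leq_addl.
have pk k : (k <= p k)%N by rewrite leq_addl.
pose t k := s (p k).
have [k|k|E [mE E0] tE] := @fast_cauchy_ae_cvg t; first exact: Ls.
  by apply: HN => //; exact: leq_trans (pN k) (pS k).
(* The indicator of [E] makes the sequences converge at every point, hence to measurable limits. *)
pose fr x := limn (fun k => complex.Re (t k x) * \1_E x).
pose fi x := limn (fun k => complex.Im (t k x) * \1_E x).
have cfr x : complex.Re (t k x) * \1_E x @[k --> \oo] --> fr x.
  have [xE|xE] := pselect (E x); rewrite /fr indicE.
    by rewrite mem_set// ; apply: is_cvgMl; have [] := tE _ xE.
  rewrite memNset//; under eq_fun do rewrite mulr0.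
  by apply: is_cvg_cst.
have cfi x : complex.Im (t k x) * \1_E x @[k --> \oo] --> fi x.
  have [xE|xE] := pselect (E x); rewrite /fi indicE.
    by rewrite mem_set// ; apply: is_cvgMl; have [] := tE _ xE.
  rewrite memNset//; under eq_fun do rewrite mulr0.
  by apply: is_cvg_cst.
have mf : cmeas (fun x => fr x +i* fi x).
  split => /=.
    apply: (@measurable_fun_cvg _ _ _ setT (fun k x => complex.Re (t k x) * \1_E x)) => // k.
    by apply: measurable_funM; [have [] := L2_cmeas (Ls (p k))|exact: measurable_indic].
  apply: (@measurable_fun_cvg _ _ _ setT (fun k x => complex.Im (t k x) * \1_E x)) => // k.
  by apply: measurable_funM; [have [] := L2_cmeas (Ls (p k))|exact: measurable_indic].
have key e : 0 < e -> exists N, forall n, (N <= n)%N ->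
    (N2 mu (fun x => (fr x +i* fi x) - s n x)%R <= e%:E)%E.
  move=> e0; have [M HM] := cs e e0; exists M => n Mn.
  (* The shift by [M] keeps every index [p (k + M)] above [M], where the Cauchy bound holds. *)
  apply: (@fatou_le _ _ _ _ (fun k x => nsq (t (k + M)%N x - s n x))).
  - by move=> k; apply/measurable_nsq/L2_cmeas/L2B; exact: Ls.
  - by apply/measurable_nsq/cmeasD => //; apply/cmeasN/L2_cmeas.
  - by move=> k x; exact: nsq_ge0.
  - exists (~` E); split => //; first exact: measurableC.
    move=> x /=; apply: contra_not => /= xE.
    have E1 (r : R) : r * \1_E x = r by rewrite indicE mem_set// mulr1.
    have cr : complex.Re (t k x) @[k --> \oo] --> fr x.
      by have := cfr x; under eq_fun do rewrite E1.
    have {}cr : complex.Re (t (k + M)%N x) @[k --> \oo] --> fr x.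
      by move: cr; rewrite -(cvg_shiftn M).
    have ci : complex.Im (t k x) @[k --> \oo] --> fi x.
      by have := cfi x; under eq_fun do rewrite E1.
    have {}ci : complex.Im (t (k + M)%N x) @[k --> \oo] --> fi x.
      by move: ci; rewrite -(cvg_shiftn M).
    rewrite /nsq !raddfB/=; under eq_fun do rewrite /nsq !raddfB/=.
    apply: cvgD; apply: (@cvg_comp _ _ _ _ (fun r : R => r ^+ 2)); try exact: exprn_continuous.
      by apply: cvgB => //; exact: cvg_cst.
    by apply: cvgB => //; exact: cvg_cst.
  - move=> k; rewrite -[X in (X <= _)%E]/(N2 mu _) -n2E; last by apply: L2B; exact: Ls.
    by rewrite lee_fin HM// (leq_trans _ (pk _))// leq_addl.
have Lf : L2 (fun x => fr x +i* fi x).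
  have [M HM] := key 1 ltr01.
  have Ld1 : L2 (fun x => (fr x +i* fi x) - s M x).
    apply/L2P; split; first by apply: cmeasD => //; apply/cmeasN/L2_cmeas.
    exact: le_lt_trans (HM _ (leqnn _)) (ltry _).
  by have := L2D Ld1 (Ls M); under eq_fun do rewrite subrK.
exists (fun x => fr x +i* fi x) => //.
apply/cvgrPdist_le => /= e e0; have [M HM] := key e e0; exists M => // n /= Mn.
rewrite sub0r normrN ger0_norm ?n2_ge0// -lee_fin n2E; last exact: L2B.
exact: HM.
Qed.

End L2_completeness.

(** * Orthonormal series and Parseval's identity *)

Section orthonormal_series.
Context d (T : measurableType d) (R : realType).
Variable mu : {measure set T -> \bar R}.
Implicit Types (f g : T -> R[i]) (u : nat -> T -> R[i]).
Local Notation L2 := (L2 mu).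
Local Notation dot := (L2dot mu).
Local Notation n2 := (n2 mu).

Lemma n2_sum_orthogonal u m n : (forall k, L2 (u k)) ->
  (forall j k, j != k -> dot (u j) (u k) = 0) ->
  n2 (fun x => \sum_(m <= k < n) u k x) = \sum_(m <= k < n) n2 (u k).
Proof.
move=> Lu ou; apply: complexI; rewrite -dot_n2; last exact: L2_sum.
rewrite dot_suml//; last exact: L2_sum.
rewrite (rmorph_sum (real_complex R)).
rewrite big_nat_cond [RHS]big_nat_cond; apply: eq_bigr => j; rewrite andbT => jmn.
rewrite dot_conj//; last exact: L2_sum.
rewrite dot_suml// (bigD1_seq j) ?mem_index_iota ?iota_uniq//= big1.
  by rewrite addr0 dot_n2// conjc_real.
by move=> k kj; exact: ou.
Qed.

(** The device by which scalar identities are proved below: their squared defect is bounded by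
    errors tending to 0. *)
Lemma nsq_le_cvg0 (a : R[i]) (r : nat -> R) N :
  (forall n, (N <= n)%N -> nsq a <= r n) -> r n @[n --> \oo] --> (0 : R) -> a = 0.
Proof.
move=> ar r0; apply: nsq_eq0; apply/eqP; rewrite eq_le nsq_ge0 andbT.
rewrite -(cvg_lim _ r0)//; apply: limr_ge; first by apply/cvg_ex; exists 0.
by exists N => // n /= Nn; exact: ar.
Qed.

(** The Riesz-Fischer theorem: by Pythagoras, the squared norm of a block of the series is a block
    of a convergent real series, and L^2 is complete. *)
Lemma orthogonal_series_cvg u (M : R) : (forall k, L2 (u k)) ->
  (forall j k, j != k -> dot (u j) (u k) = 0) ->
  (forall n, \sum_(0 <= k < n) n2 (u k) <= M) ->
  exists2 f, L2 f &
    n2 (fun x => f x - \sum_(0 <= k < n) u k x) @[n --> \oo] --> (0 : R).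
Proof.
move=> Lu ou uM; apply: L2_complete => [n|e e0]; first exact: L2_sum.
have /cauchy_cvgP/cauchy_seriesP cr : cvgn (series (fun k => n2 (u k))).
  apply: nondecreasing_is_cvgn.
    by apply: nondecreasing_series => k _ _; exact: n2_ge0.
  by exists M => _ [n _ <-]; exact: uM.
have [[A B] /= [[N _ NA] [N' _ NB]] AB] := cr e e0.
exists (maxn N N') => m n; rewrite !geq_max => /andP[mN mN'] /andP[nN nN'].
have main p q : (p <= q)%N -> (N <= p)%N -> (N' <= q)%N ->
    n2 (fun x => \sum_(0 <= k < q) u k x - \sum_(0 <= k < p) u k x) <= e.
  move=> pq Np Nq.
  under eq_fun do rewrite (big_cat_nat (n := p))//= addrAC subrr add0r.
  rewrite n2_sum_orthogonal//; apply: le_trans (ler_norm _) _; apply: ltW.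
  by apply: (AB (p, q)); split; [exact: NA|exact: NB].
have [mn|nm] := leqP m n; last exact: main (ltnW nm) _ _.
have -> : n2 (fun x => \sum_(0 <= k < m) u k x - \sum_(0 <= k < n) u k x) =
  n2 (fun x => \sum_(0 <= k < n) u k x - \sum_(0 <= k < m) u k x).
  by congr fine; apply: eq_integral => x _; rewrite -nsqN opprB.
exact: main.
Qed.

Variable e : nat -> T -> R[i].
Hypothesis Le : forall k, L2 (e k).
Hypothesis oe : forall m n, dot (e m) (e n) = (m == n)%:R.

Lemma orthonormal_dot0 j k : j != k -> dot (e j) (e k) = 0.
Proof. by rewrite oe => /negbTE ->. Qed.

Lemma n2_orthonormal k : n2 (e k) = 1.
Proof. by apply: complexI; rewrite -dot_n2// oe eqxx rmorph1. Qed.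

Definition fourier_sum f n : T -> R[i] :=
  fun x => \sum_(0 <= k < n) dot f (e k) * e k x.

Lemma L2_fourier_sum f n : L2 (fourier_sum f n).
Proof. by apply: (@L2_sum _ _ _ _ (fun k x => dot f (e k) * e k x)) => k; exact: L2Z. Qed.

Lemma dot_fourier_sum f n h : L2 h ->
  dot (fourier_sum f n) h = \sum_(0 <= k < n) dot f (e k) * dot (e k) h.
Proof.
move=> Lh; rewrite /fourier_sum.
rewrite (@dot_suml _ _ _ _ (fun k x => dot f (e k) * e k x))//; last by move=> k; exact: L2Z.
by apply: eq_bigr => k _; rewrite dotZl.
Qed.

Lemma dot_fourier_sum_basis f n k : (k < n)%N ->
  dot (fourier_sum f n) (e k) = dot f (e k).
Proof.
move=> kn; rewrite dot_fourier_sum// (bigD1_seq k) ?mem_index_iota ?iota_uniq//=.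
rewrite oe eqxx mulr1 big1 ?addr0// => j jk.
by rewrite orthonormal_dot0// mulr0.
Qed.

Lemma n2_fourier_sum f n : n2 (fourier_sum f n) = \sum_(0 <= k < n) nsq (dot f (e k)).
Proof.
rewrite /fourier_sum (@n2_sum_orthogonal (fun k x => dot f (e k) * e k x)).
- by apply: eq_bigr => k _; rewrite n2Z// n2_orthonormal mulr1.
- by move=> k; exact: L2Z.
- by move=> j k jk; rewrite dotZl ?dotZr ?orthonormal_dot0 ?mulr0//; exact: L2Z.
Qed.

(** The cross term contributes the sum of coefficients -2 times and the partial sum contributes it
    once. Bessel's inequality and Parseval's identity both follow from this equality. *)
Lemma n2_sub_fourier_sum f n : L2 f ->
  n2 (fun x => f x - fourier_sum f n x) = n2 f - \sum_(0 <= k < n) nsq (dot f (e k)).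
Proof.
move=> Lf; have Ls := L2_fourier_sum f n.
under [in LHS]eq_fun do rewrite addrC -mulN1r.
rewrite n2_lin// n2_fourier_sum dot_fourier_sum//.
have -> : -1 * (\sum_(0 <= k < n) dot f (e k) * dot (e k) f) =
    (- \sum_(0 <= k < n) nsq (dot f (e k)))%:C.
  rewrite mulN1r rmorphN rmorph_sum; congr (- _); apply: eq_bigr => k _.
  by rewrite (dot_conj Lf (Le k)); exact: mul_conjc.
have -> : nsq (-1 : R[i]) = 1 by rewrite nsqN /nsq /= expr1n expr0n addr0.
by rewrite /=; ring.
Qed.

Lemma bessel f n : L2 f -> \sum_(0 <= k < n) nsq (dot f (e k)) <= n2 f.
Proof. by move=> Lf; rewrite -subr_ge0 -n2_sub_fourier_sum// n2_ge0. Qed.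

Hypothesis te : forall f, L2 f -> (forall n, dot f (e n) = 0) -> f = (fun=> 0) %[ae mu].

(** Bessel's inequality gives the series some limit p in L^2. Then f - p is orthogonal to the whole
    basis, so it vanishes almost everywhere by totality. *)
Lemma fourier_sum_cvg f : L2 f ->
  n2 (fun x => f x - fourier_sum f n x) @[n --> \oo] --> (0 : R).
Proof.
move=> Lf; pose u k x := dot f (e k) * e k x.
have Lu k : L2 (u k) by exact: L2Z.
have [|n|p Lp pc] := @orthogonal_series_cvg u (n2 f) Lu.
- by move=> j k jk; rewrite dotZl ?dotZr ?orthonormal_dot0 ?mulr0.
- apply: le_trans (bessel n Lf); rewrite le_eqVlt; apply/orP; left; apply/eqP.
  by apply: eq_bigr => k _; rewrite n2Z// n2_orthonormal mulr1.
have fp : (fun x => f x - p x) = (fun=> 0) %[ae mu].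
  apply: te => [|k]; first exact: L2B.
  rewrite dotBl//.
  (* For n > k the partial sum has the same k-th coefficient as f, so <f - p, e_k> is bounded by the
     distance from p to the partial sum. *)
  apply: (@nsq_le_cvg0 _ (fun n => n2 (fun x => p x - fourier_sum f n x)) k.+1) => // n kn.
  have Ls := L2_fourier_sum f n.
  rewrite -(dot_fourier_sum_basis f kn) -dotBl//.
  apply: le_trans (cauchy_schwarz (L2B Ls Lp) (Le k)) _.
  rewrite n2_orthonormal mulr1 le_eqVlt; apply/orP; left; apply/eqP.
  by congr fine; apply: eq_integral => x _; rewrite -nsqN opprB.
suff -> : (fun n => n2 (fun x => f x - fourier_sum f n x)) =
  (fun n => n2 (fun x => p x - fourier_sum f n x)) by exact: pc.
apply/funext => n; congr fine; have Ls := L2_cmeas (L2_fourier_sum f n).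
apply: ae_eq_integral => //.
- exact/measurable_nsqE/(cmeasD (L2_cmeas Lf))/cmeasN.
- exact/measurable_nsqE/(cmeasD (L2_cmeas Lp))/cmeasN.
- apply: filterS fp => x /= h _; congr (nsq _)%:E; congr (_ - _).
  by apply/eqP; rewrite -subr_eq0 h.
Qed.

Lemma parseval f : L2 f ->
  (\sum_(0 <= k <oo) (nsq (dot f (e k)))%:E)%E = N2 mu f.
Proof.
move=> Lf; rewrite -n2E//; apply/cvg_lim => //.
under eq_fun do rewrite sumEFin.
apply: cvg_EFin; first exact: nearW.
have -> : (fine \o (fun n => (\sum_(0 <= k < n) nsq (dot f (e k)))%:E)) =
  (fun n => n2 f - n2 (fun x => f x - fourier_sum f n x)).
  by apply/funext => n /=; rewrite n2_sub_fourier_sum// opprB addrC subrK.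
rewrite -[X in _ --> X]subr0; apply: cvgB; first exact: cvg_cst.
exact: fourier_sum_cvg.
Qed.

End orthonormal_series.

(** * Plancherel's formula on the real line *)

Section lebesgue_measure_motions.
Context {R : realType}.
Local Notation mu := (@lebesgue_measure R).

(** Lebesgue measure is determined by its values on half-open intervals, so checking these
    identifies it with its pushforward by [p]. *)
Lemma ge0_integral_measure_preserving (p : measurableTypeR R -> measurableTypeR R) (f : R -> \bar R) :
  measurable_fun setT p ->
  (forall a b : R, a < b -> mu (p @^-1` `]a, b]) = (b - a)%:E) ->
  measurable_fun setT f -> (forall x, (0 <= f x)%E) ->
  (\int[mu]_x f (p x) = \int[mu]_x f x)%E.
Proof.
move=> mp pI mf f0.
pose q : {measure set (measurableTypeR R) -> \bar R} :=
  measure_function_pushforward__canonical__measure_function_Measure mu mp.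
have E : forall A, measurable A -> mu A = q A.
  apply: lebesgue_measure_unique => _ [[a b] _ <-] /=.
  rewrite /pushforward lebesgue_measure_itv/= lte_fin.
  have [ab|ba] := ltP a b; first by rewrite pI.
  by rewrite set_itv_ge ?preimage_set0 ?measure0// bnd_simp -leNgt.
rewrite [RHS](eq_measure_integral q); last by move=> A mA _; exact: E.
by rewrite ge0_integral_pushforward// preimage_setT.
Qed.

Lemma ge0_integral_translation (a : R) (f : R -> \bar R) :
  measurable_fun setT f -> (forall x, (0 <= f x)%E) ->
  (\int[mu]_x f (x + a)%R = \int[mu]_x f x)%E.
Proof.
move=> mf f0; apply: (@ge0_integral_measure_preserving (fun x => x + a)) => //.
  exact: measurable_funD.
move=> b c bc; rewrite (_ : _ @^-1` _ = `]b - a, c - a]%classic).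
  by rewrite lebesgue_measure_itv/= lte_fin ltrD2r bc -EFinB; congr EFin; ring.
by apply/seteqP; split=> x /=; rewrite !in_itv/= ltrBlDr lerBrDr.
Qed.

Lemma ge0_integral_reflection (f : R -> \bar R) :
  measurable_fun setT f -> (forall x, (0 <= f x)%E) ->
  (\int[mu]_x f (- x)%R = \int[mu]_x f x)%E.
Proof.
move=> mf f0; apply: (@ge0_integral_measure_preserving -%R) => //.
move=> b c bc; rewrite (_ : _ @^-1` _ = `[- c, - b[%classic).
  by rewrite lebesgue_measure_itv/= lte_fin ltrN2 bc -EFinB; congr EFin; ring.
by apply/seteqP; split=> x /=; rewrite !in_itv/= ltrNr lerNl andbC.
Qed.

(** Reflection exchanges the two half-lines up to the origin, which is a null set. *)
Lemma ge0_integral_even (f : R -> R) : measurable_fun setT f ->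
  (forall x, 0 <= f x) -> (forall x, f (- x) = f x) ->
  (\int[mu]_x (f x)%:E = 2%:E * \int[mu]_(x in `[0%R, +oo[) (f x)%:E)%E.
Proof.
move=> mf f0 fN; have mEf : measurable_fun setT (EFin \o f) by exact/measurable_EFinP.
rewrite -(setUv `[0, +oo[%classic) ge0_integral_setU//=; last 4 first.
- exact: measurableC.
- by rewrite setUv.
- by move=> x _; rewrite lee_fin.
- exact/disj_setPCl.
have -> : (\int[mu]_(x in ~` `[0%R, +oo[) (f x)%:E = \int[mu]_(x in `[0%R, +oo[) (f x)%:E)%E.
  rewrite -[RHS]integral_itv_obnd_cbnd; last exact: measurable_funTS.
  rewrite integral_mkcond [RHS]integral_mkcond.
  rewrite -[RHS]ge0_integral_reflection; last 2 first.
  - by apply/(measurable_restrictT _ _).1 => //; exact: measurable_funTS.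
  - by move=> x; apply: erestrict_ge0 => y _; rewrite lee_fin.
  apply: eq_integral => x _; rewrite !patchE /= fN.
  suff -> : (x \in ~` `[0, +oo[) = (- x \in `]0, +oo[%classic) by [].
  by rewrite in_setC !mem_setE !in_itv /= !andbT oppr_gt0 ltNge.
by rewrite mule_natl mule2n.
Qed.

End lebesgue_measure_motions.

(** * The integral of (1 - cos(xu)) / u^2 *)

Section sinc_integral.
Context {R : realType}.
Local Notation mu := (@lebesgue_measure R).
Implicit Types (x u v : R).

Lemma is_derive_continuous (f F : R -> R) :
  (forall x, is_derive x 1 F (f x)) -> continuous F.
Proof.
by move=> dF x; apply/differentiable_continuous/derivable1_diffP; exact: ex_derive.
Qed.

Lemma ge0_integral_FTC0y (f F : R -> R) (l : R) : (forall x, 0 <= x -> 0 <= f x) ->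
  continuous f -> (forall x, is_derive x 1 F (f x)) -> F x @[x --> +oo] --> l ->
  (\int[mu]_(x in `[0%R, +oo[) (f x)%:E = (l - F 0)%:E)%E.
Proof.
move=> f0 cf dF Fl; rewrite (ge0_continuous_FTC2y f0 _ Fl) ?EFinB//.
- exact: continuous_subspaceT.
- apply: cvg_at_right_filter; apply/differentiable_continuous/derivable1_diffP.
  exact: ex_derive.
- by move=> x _; rewrite derive1E; exact: derive_val.
Qed.

Lemma is_derive_expRMl (k x : R) :
  is_derive x 1 (fun t => expR (k * t)) (k * expR (k * x)).
Proof.
have h : is_derive x 1 (fun t : R => k * t) k.
  by apply: is_derive_eq; rewrite scaler1.
by have := @is_derive1_comp _ expR _ _ _ _ (is_derive_expR (k * x)) h; rewrite mulrC.
Qed.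

Lemma is_derive_cosMl (k x : R) :
  is_derive x 1 (fun t => cos (k * t)) (- (k * sin (k * x))).
Proof.
have h : is_derive x 1 (fun t : R => k * t) k.
  by apply: is_derive_eq; rewrite scaler1.
by have := @is_derive1_comp _ cos _ _ _ _ (is_derive_cos (k * x)) h; rewrite mulrC mulrN.
Qed.

Lemma is_derive_sinMl (k x : R) :
  is_derive x 1 (fun t => sin (k * t)) (k * cos (k * x)).
Proof.
have h : is_derive x 1 (fun t : R => k * t) k.
  by apply: is_derive_eq; rewrite scaler1.
by have := @is_derive1_comp _ sin _ _ _ _ (is_derive_sin (k * x)) h; rewrite mulrC.
Qed.

Lemma cvgy_bounded_expR (g : R -> R) (M k : R) : 0 < k ->
  (forall x, 0 <= x -> `|g x| <= M) -> g x * expR (- k * x) @[x --> +oo] --> (0 : R).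
Proof.
move=> k0 gM.
have E : expR (- k * x) @[x --> +oo] --> (0 : R).
  rewrite (_ : (fun x => expR (- k * x)) =
               (fun z => expR (- z)) \o (fun z => k * z)); last first.
    by apply: eq_fun => x; rewrite mulNr.
  apply: (@cvg_comp _ _ _ _ _ _ (pinfty_nbhs R)); last exact: cvgr_expR.
  exact: gt0_cvgMry.
have M0 : 0 <= M by exact: le_trans (gM 0 (lexx _)).
apply: (@squeeze_cvgr _ _ _ _ (fun x => - M * expR (- k * x)) (fun x => M * expR (- k * x))).
- near=> x; have x0 : 0 <= x by near: x; exact: nbhs_pinfty_ge.
  rewrite mulNr -ler_norml normrM (ger0_norm (expR_ge0 _)).
  by rewrite ler_wpM2r ?expR_ge0// gM.
- by rewrite -(mulr0 (- M)); apply: cvgM => //; exact: cvg_cst.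
- by rewrite -(mulr0 M); apply: cvgM => //; exact: cvg_cst.
Unshelve. all: by end_near. Qed.

Lemma integral_mul_expRN u : 0 < u ->
  (\int[mu]_(v in `[0%R, +oo[) (v * expR (- u * v))%:E = (u ^- 2)%:E)%E.
Proof.
move=> u0; pose F v := - (v / u + u ^- 2) * expR (- u * v).
have dF v : is_derive v 1 F (v * expR (- u * v)).
  have h := is_derive_expRMl (- u) v.
  have h2 : is_derive v 1 (fun v => - (v / u + u ^- 2)) (- u^-1).
    by apply: is_derive_eq; rewrite /GRing.scale /= mulr1 mulr0 add0r addr0.
  apply: (@is_derive_eq _ _ _ _ _ _ _ _ (is_deriveM h2 h)).
  by rewrite /GRing.scale /=; field; rewrite gt_eqF.
have Fl : F v @[v --> +oo] --> (0 : R).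
  have u2 : 0 < u / 2 by rewrite divr_gt0.
  (* Half of the exponential is spent on the polynomial factor: v/u + u^-2 is at most (3/u^2)(1 +
     uv/2), hence at most (3/u^2) e^(uv/2). *)
  rewrite (_ : F = fun v => - ((v / u + u ^- 2) * expR (- (u / 2) * v)) * expR (- (u / 2) * v)).
    apply: (@cvgy_bounded_expR _ (3 / u ^+ 2)) => // v v0.
    rewrite normrN ger0_norm; last first.
      by rewrite mulr_ge0 ?expR_ge0// addr_ge0 ?invr_ge0 ?sqr_ge0// divr_ge0// ltW.
    rewrite mulNr expRN ler_pdivrMr ?expR_gt0//.
    apply: (@le_trans _ _ (3 / u ^+ 2 * (1 + u / 2 * v))).
      have -> : 3 / u ^+ 2 * (1 + u / 2 * v) = v / u + u ^- 2 + (2 / u ^+ 2 + v / u / 2).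
        by field; rewrite gt_eqF.
      by rewrite lerDl addr_ge0 ?divr_ge0 ?sqr_ge0// ltW.
    by rewrite ler_wpM2l ?divr_ge0 ?sqr_ge0// expR_ge1Dx.
  apply/funext => v; rewrite mulNr -mulrA -expRD /F mulNr; congr (- (_ * expR _)).
  by field.
rewrite (ge0_integral_FTC0y _ _ dF Fl).
- by rewrite /F mulr0 expR0 mul0r; congr EFin; ring.
- by move=> v v0; rewrite mulr_ge0 ?expR_ge0.
- move=> v; apply: cvgM; first exact: cvg_id.
  exact: (is_derive_continuous (is_derive_expRMl (- u))).
Qed.

(** The Laplace transform of 1 - cos(xu), that is 1/v - v/(v^2 + x^2), computed from an explicit
    antiderivative. *)
Lemma integral_1Bcos_expRN x v : 0 < v ->
  (\int[mu]_(u in `[0%R, +oo[) ((1 - cos (x * u)) * expR (- v * u))%:E =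
   (x ^+ 2 / (v * (v ^+ 2 + x ^+ 2)))%:E)%E.
Proof.
move=> v0; have D0 : 0 < v ^+ 2 + x ^+ 2 by rewrite ltr_pwDl ?exprn_gt0 ?sqr_ge0.
pose G u := - v^-1 - (x * sin (x * u) - v * cos (x * u)) / (v ^+ 2 + x ^+ 2).
pose F u := G u * expR (- v * u).
have dF u : is_derive u 1 F ((1 - cos (x * u)) * expR (- v * u)).
  have h := is_derive_expRMl (- v) u.
  have hc := is_derive_cosMl x u; have hs := is_derive_sinMl x u.
  have h2 : is_derive u 1 G
      (- ((x * (x * cos (x * u)) - v * (- (x * sin (x * u)))) / (v ^+ 2 + x ^+ 2))).
    by rewrite /G; apply: is_derive_eq; rewrite /GRing.scale /=; ring.
  apply: (@is_derive_eq _ _ _ _ _ _ _ _ (is_deriveM h2 h)).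
  by rewrite /GRing.scale /= /G; field; rewrite !gt_eqF.
have Fl : F u @[u --> +oo] --> (0 : R).
  apply: (@cvgy_bounded_expR _ (v^-1 + (`|x| + `|v|) / (v ^+ 2 + x ^+ 2))) => // u u0.
  rewrite /G (le_trans (ler_normB _ _))// normrN (gtr0_norm (_ : 0 < v^-1)) ?invr_gt0//.
  rewrite lerD2l normrM [X in _ * X]gtr0_norm ?invr_gt0// ler_pM2r ?invr_gt0//.
  rewrite (le_trans (ler_normB _ _))// !normrM lerD// ler_piMr// ?sin_max ?cos_max//.
rewrite (ge0_integral_FTC0y _ _ dF Fl).
- rewrite /F /G !mulr0 expR0 sin0 cos0; congr EFin; field.
  by rewrite !gt_eqF.
- by move=> u u0; rewrite mulr_ge0 ?expR_ge0// subr_ge0 cos_le1.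
- move=> u; apply: cvgM; last first.
    exact: (is_derive_continuous (is_derive_expRMl (- v))).
  apply: cvgB; first exact: cvg_cst.
  exact: (is_derive_continuous (is_derive_cosMl x)).
Qed.

Lemma integral_oneDsqr_scaled x : 0 < x ->
  (\int[mu]_(v in `[0%R, +oo[) (x ^+ 2 / (v ^+ 2 + x ^+ 2))%:E = (x * (pi / 2))%:E)%E.
Proof.
move=> x0; have D0 v : 0 < v ^+ 2 + x ^+ 2 by rewrite ltr_wpDl ?exprn_gt0 ?sqr_ge0.
pose F v := x * atan (x^-1 * v).
have dF v : is_derive v 1 F (x ^+ 2 / (v ^+ 2 + x ^+ 2)).
  have h : is_derive v 1 (fun t : R => x^-1 * t) x^-1.
    by apply: is_derive_eq; rewrite scaler1.
  have h2 := @is_derive1_comp _ atan _ _ _ _ (is_derive1_atan (x^-1 * v)) h.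
  have h3 := @is_deriveZ _ _ _ _ x _ _ _ h2.
  apply: (@is_derive_eq _ _ _ _ _ _ _ _ h3).
  rewrite /GRing.scale /=; field; rewrite !gt_eqF// ltr_pwDl ?exprn_gt0 ?sqr_ge0//.
have Fl : F v @[v --> +oo] --> x * (pi / 2).
  apply: cvgM; first exact: cvg_cst.
  apply: (@cvg_comp _ _ _ (fun v => x^-1 * v) atan _ (pinfty_nbhs R)); last exact: cvgy_atan.
  by apply: gt0_cvgMry; rewrite ?invr_gt0.
rewrite (ge0_integral_FTC0y _ _ dF Fl).
- by rewrite /F mulr0 atan0 mulr0 subr0.
- by move=> v v0; rewrite divr_ge0 ?sqr_ge0// ltW.
- move=> v; apply: cvgM; first exact: cvg_cst.
  apply: cvgV; first by rewrite gt_eqF.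
  apply: cvgD; last exact: cvg_cst.
  exact: exprn_continuous.
Qed.

(** For u nonzero this is 2 (sin(xu/2) / u)^2, an unnormalised Fejer kernel. By the convention on
    division it is 0 at u = 0. *)
Definition versinc x u := (1 - cos (x * u)) / u ^+ 2.

Lemma versinc_ge0 x u : 0 <= versinc x u.
Proof. by rewrite divr_ge0 ?sqr_ge0// subr_ge0 cos_le1. Qed.

End sinc_integral.

Lemma integralZl_EFin d (T : measurableType d) (R : realType)
    (mu : {measure set T -> \bar R}) (c : R) (f : T -> R) :
  mu.-integrable setT (EFin \o f) ->
  (\int[mu]_x (c * f x)%:E = (c * \int[mu]_x f x)%:E)%E.
Proof.
move=> fi; under eq_integral do rewrite EFinM.
rewrite (integralZl measurableT fi) EFinM; congr (_ * _)%E.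
by rewrite fineK//; exact: (integrable_fin_num measurableT fi).
Qed.

Section sigma_finite_product.
Context d1 d2 (T1 : measurableType d1) (T2 : measurableType d2) (R : realType).
Variables (m1 : {sigma_finite_measure set T1 -> \bar R})
  (m2 : {sigma_finite_measure set T2 -> \bar R}).

(** A name for the product measure that carries a sigma-finite structure, so that products can be
    iterated. *)
Definition sfprod : set (T1 * T2) -> \bar R := (m1 \x m2)%E.

HB.instance Definition _ := Measure.on sfprod.

HB.instance Definition _ := Measure_isSigmaFinite.Build _ _ _ sfprod
  (product_measure_sigma_finite m1 m2).

Lemma integral_mul_prod (f : T1 -> R) (g : T2 -> R) :
  m1.-integrable setT (EFin \o f) -> m2.-integrable setT (EFin \o g) ->
  sfprod.-integrable setT (fun p => (f p.1 * g p.2)%:E) /\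
  \int[sfprod]_p (f p.1 * g p.2) = (\int[m1]_x f x) * (\int[m2]_y g y).
Proof.
move=> fi gi.
have mf : measurable_fun setT f by have /measurable_int/measurable_EFinP := fi.
have mg : measurable_fun setT g by have /measurable_int/measurable_EFinP := gi.
have mfg : measurable_fun setT (fun p : T1 * T2 => (f p.1 * g p.2)%:E).
  by apply/measurable_EFinP/measurable_funM; exact: measurableT_comp.
have ifg : (m1 \x m2)%E.-integrable setT (fun p => (f p.1 * g p.2)%:E).
  apply/(integrable12ltyP m1 m2 mfg) => /=.
  under eq_integral do under eq_integral do rewrite normrM EFinM.
  have E x : (\int[m2]_y (`|f x|%:E * `|g y|%:E) = `|f x|%:E * \int[m2]_y `|g y|%:E)%E.
    rewrite ge0_integralZl//; apply/measurable_EFinP; exact: measurableT_comp.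
  under eq_integral do rewrite E.
  have goo : (\int[m2]_y `|g y|%:E < +oo)%E by have /integrableP[] := gi.
  have g0 : (0 <= \int[m2]_y `|g y|%:E)%E by exact: integral_ge0.
  under eq_integral do rewrite muleC.
  rewrite ge0_integralZl//; last by apply/measurable_EFinP; exact: measurableT_comp.
  have /integrableP[_ foo] := fi.
  by rewrite lte_mul_pinfty// ge0_fin_numE.
split => //.
rewrite /Rintegral -(integral12_prod_meas1 ifg) /fubini_F/=.
under eq_integral do rewrite (integralZl_EFin _ gi) mulrC.
by rewrite (integralZl_EFin _ fi) mulrC.
Qed.

End sigma_finite_product.

Section gram.
Context d1 d2 (T1 : measurableType d1) (T2 : measurableType d2) (R : realType).
Variables (nu : {sigma_finite_measure set T1 -> \bar R})
  (m : {sigma_finite_measure set T2 -> \bar R}).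
Variables (phi : T1 -> R) (H : T1 * T2 -> R) (M : R) (a : T2 -> R).
Hypotheses (mphi : measurable_fun setT phi) (phi0 : forall w, 0 <= phi w).
Hypotheses (mH : measurable_fun setT H) (H1 : forall p, `|H p| <= 1).
(** Bounding the integral of phi |H|, rather than that of phi, covers both a Fejer weight with a
    cosine or sine and the constant weight 1 with a moving window. *)
Hypothesis HM : forall s, (\int[nu]_w (phi w * `|H (w, s)|)%:E <= M%:E)%E.
Hypothesis ai : m.-integrable setT (EFin \o a).

Let ma : measurable_fun setT a.
Proof. by have /measurable_int/measurable_EFinP := ai. Qed.

Let mHl w : measurable_fun setT (fun s => H (w, s)).
Proof. by apply: measurableT_comp => //; exact: pair1_measurable. Qed.

Let mHr s : measurable_fun setT (fun w => H (w, s)).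
Proof. by apply: measurableT_comp => //; exact: pair2_measurable. Qed.

Lemma integrable_bounded_mul w : m.-integrable setT (fun s => (a s * H (w, s))%:E).
Proof.
apply: (@le_integrable _ _ _ m setT _ _ (EFin \o a)) => //.
  by apply/measurable_EFinP; exact: measurable_funM.
by move=> s _ /=; rewrite lee_fin normrM ler_piMr.
Qed.

(* Fubini turns the weighted square of an integral transform into a quadratic
   form in [a], whose kernel can be computed separately. *)
Lemma gram_quadratic_form :
  (sfprod m m).-integrable setT (fun p =>
    (a p.1 * a p.2 * \int[nu]_w (phi w * (H (w, p.1) * H (w, p.2))))%:E) /\
  (\int[nu]_w (phi w * (\int[m]_s (a s * H (w, s))) ^+ 2)%:E =
   \int[sfprod m m]_p
     (a p.1 * a p.2 * \int[nu]_w (phi w * (H (w, p.1) * H (w, p.2))))%:E)%E.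
Proof.
pose E (q : T1 * (T2 * T2)) : R :=
  a q.2.1 * a q.2.2 * (phi q.1 * (H (q.1, q.2.1) * H (q.1, q.2.2))).
have mE : measurable_fun setT (EFin \o E).
  apply/measurable_EFinP; apply: measurable_funM; apply: measurable_funM.
  - by apply: measurableT_comp => //; exact: measurableT_comp.
  - by apply: measurableT_comp => //; exact: measurableT_comp.
  - exact: measurableT_comp.
  - apply: measurable_funM; apply: measurableT_comp => //;
      apply: measurable_fun_pair => //; exact: measurableT_comp.
have M0 : 0 <= M.
  have := HM point; rewrite -lee_fin; apply: le_trans; apply: integral_ge0 => w _.
  by rewrite lee_fin mulr_ge0.
have bnd (p : T2 * T2) : (\int[nu]_w (phi w * (`|H (w, p.1)| * `|H (w, p.2)|))%:E <= M%:E)%E.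
  apply: le_trans (HM p.1); apply: ge0_le_integral => //.
  - by move=> w _; rewrite lee_fin !mulr_ge0.
  - apply/measurable_EFinP/measurable_funM => //.
    by apply: measurable_funM; exact: measurableT_comp.
  - apply/measurable_EFinP/measurable_funM => //; exact: measurableT_comp.
  - by move=> w _; rewrite lee_fin ler_wpM2l// ler_piMr.
have ki (p : T2 * T2) : nu.-integrable setT (fun w => (phi w * (H (w, p.1) * H (w, p.2)))%:E).
  apply/integrableP; split.
    by apply/measurable_EFinP/measurable_funM => //; exact: measurable_funM.
  apply: le_lt_trans (ltry M); apply: le_trans (bnd p).
  rewrite le_eqVlt; apply/orP; left; apply/eqP; apply: eq_integral => w _ /=.
  by rewrite !normrM (ger0_norm (phi0 w)).
have absai : m.-integrable setT (EFin \o (fun s => `|a s|)) by exact: integrable_norm.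
have [aai _] := integral_mul_prod absai absai.
(* Integrating in w first bounds |E| by M |a(s)| |a(t)|, which is integrable on the product. *)
have iE : (nu \x sfprod m m)%E.-integrable setT (EFin \o E).
  apply/(integrable21ltyP nu (sfprod m m) mE).
  have /integrableP[_ aaoo] := aai.
  apply: (@le_lt_trans _ _ (M%:E * \int[sfprod m m]_p `|(`|a p.1| * `|a p.2|)%:E|))%E; last first.
    by rewrite lte_mul_pinfty.
  rewrite -ge0_integralZl//; last by apply: measurableT_comp => //; have /measurable_int := aai.
  apply: ge0_le_integral => //.
  - by move=> p _; exact: integral_ge0.
  - apply: (measurable_fun_fubini_tonelli_F
      (fun q : (T2 * T2) * T1 => `|(EFin \o E) (q.2, q.1)|%E)) => //.
    apply: measurableT_comp => //; apply: measurableT_comp => //.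
    exact: measurable_fun_pair.
  - apply: measurable_funeM; apply: measurableT_comp => //.
    by have /measurable_int := aai.
  - move=> p _ /=.
    under eq_integral do rewrite /E /= !normrM (ger0_norm (phi0 _)) EFinM.
    rewrite ge0_integralZl//.
    + rewrite [X in (_ <= _ * X%:E)%E]ger0_norm ?mulr_ge0// muleC; apply: lee_wpmul2r.
        by rewrite lee_fin mulr_ge0.
      exact: bnd.
    + apply/measurable_EFinP/measurable_funM => //.
      by apply: measurable_funM; exact: measurableT_comp.
    + by move=> w _; rewrite lee_fin !mulr_ge0.
have E2 p : (\int[nu]_w (EFin \o E) (w, p) = (a p.1 * a p.2 *
    \int[nu]_w (phi w * (H (w, p.1) * H (w, p.2))))%:E)%E.
  exact: (integralZl_EFin (a p.1 * a p.2) (ki p)).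
have E1 w : (\int[sfprod m m]_p (EFin \o E) (w, p) =
    (phi w * (\int[m]_s (a s * H (w, s))) ^+ 2)%:E)%E.
  have hw := integrable_bounded_mul w; have [hhi hhE] := integral_mul_prod hw hw.
  rewrite expr2 -hhE -(integralZl_EFin _ hhi); apply: eq_integral => p _.
  by rewrite /E /=; congr EFin; ring.
split.
  apply: (le_integrable measurableT _ _ (integrable_scale M aai)).
    have := measurable_fubini_G iE; rewrite /fubini_G.
    by under eq_fun do rewrite E2.
  move=> p _ /=; rewrite lee_fin !normrM !normr_id (ger0_norm M0) mulrC.
  rewrite ler_wpM2r ?mulr_ge0// -lee_fin EFin_normr_Rintegral//; last exact: ki p.
  apply: le_trans (le_abse_integral _ _ _) _ => //.
    by have /measurable_int := ki p.
  apply: le_trans (bnd p).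
  rewrite le_eqVlt; apply/orP; left; apply/eqP; apply: eq_integral => w _ /=.
  by rewrite !normrM (ger0_norm (phi0 w)).
have := Fubini iE.
under eq_integral do rewrite E1.
by under [in RHS]eq_integral do rewrite E2.
Qed.

End gram.

Section versinc.
Context {R : realType}.
Local Notation mu := (@lebesgue_measure R).
Implicit Types (x u v : R).

Lemma measurable_versinc x : measurable_fun setT (versinc x).
Proof.
rewrite -(setvU [set 0 : R]); apply/measurable_funU.
- by apply: measurableC.
- by [].
split; last exact: measurable_fun_set1.
apply: open_continuous_measurable_fun.
  rewrite (_ : ~` _ = [set y : R | y != 0]); first exact: open_neq.
  by apply/seteqP; split=> y /= /eqP.
move=> u; rewrite inE /= => /eqP u0; apply: cvgM.
  apply: cvgB; first exact: cvg_cst.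
  exact: (is_derive_continuous (is_derive_cosMl x)).
by apply: cvgV; [rewrite expf_neq0|exact: exprn_continuous].
Qed.

Lemma integral_indic_mul (D : set R) (f : R -> R) :
  (\int[mu]_(x in D) (f x)%:E = \int[mu]_x (f x * \1_D x)%:E)%E.
Proof.
rewrite integral_mkcond; apply: eq_integral => x _; rewrite patchE indicE.
by case: ifPn => _; rewrite ?mulr1 ?mulr0.
Qed.

(** For u > 0, 1/u^2 is the integral of v e^(-uv) over v > 0. After exchanging the integrals by
    Tonelli's theorem, the one in u yields x^2 / (v^2 + x^2), whose integral is an arctangent. *)
Lemma integral_half_versinc x : 0 < x ->
  (\int[mu]_(u in `[0%R, +oo[) (versinc x u)%:E = (x * (pi / 2))%:E)%E.
Proof.
move=> x0.
(* The origin can stay in [A], because 1 - cos vanishes there, but not in [B]: the Laplace transform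
   in u requires v > 0. *)
pose A : set R := `[0, +oo[%classic; pose B : set R := `]0, +oo[%classic.
pose F (p : R * R) : R := (1 - cos (x * p.1)) * (p.2 * expR (- (p.1 * p.2))) * \1_A p.1 * \1_B p.2.
have m1A : measurable_fun setT (\1_A : R -> R) by apply: measurable_indic; exact: measurable_itv.
have m1B : measurable_fun setT (\1_B : R -> R) by apply: measurable_indic; exact: measurable_itv.
have mF : measurable_fun setT (EFin \o F).
  apply/measurable_EFinP; apply: measurable_funM; last first.
    exact: (measurableT_comp m1B measurable_snd).
  apply: measurable_funM; last first.
    exact: (measurableT_comp m1A measurable_fst).
  apply: measurable_funM; last first.
    apply: measurable_funM => //; apply: measurableT_comp => //.
    by apply: measurable_funN; exact: measurable_funM.
  apply: measurable_funB => //.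
  apply: (@measurableT_comp _ _ _ _ _ _ (fun u => cos (x * u)) _ fst) => //.
  apply: continuous_measurable_fun; exact: (is_derive_continuous (is_derive_cosMl x)).
have F0 p : (0 <= (EFin \o F) p)%E.
  rewrite /= lee_fin /F !indicE; have [|] := boolP (p.2 \in B); last by rewrite mulr0.
  rewrite mem_setE in_itv /= andbT => p20.
  by rewrite mulr1 !mulr_ge0 ?ler0n ?expR_ge0 ?(ltW p20)// subr_ge0 cos_le1.
have FB u : (\int[mu]_v (EFin \o F) (u, v) = (versinc x u * \1_A u)%:E)%E.
  rewrite /F /= -(integral_indic_mul B (fun v => (1 - cos (x * u)) * (v * expR (- (u * v))) * \1_A u)).
  rewrite integral_itv_obnd_cbnd; last first.
    apply/measurable_EFinP/measurable_funTS/measurable_funM => //.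
    apply: measurable_funM => //; apply: measurable_funM => //.
    by apply: measurableT_comp => //; apply: measurable_funN; exact: measurable_funM.
  rewrite indicE; have [|] := boolP (u \in A); last first.
    by move=> _; under eq_integral do rewrite mulr0; rewrite integral0 mulr0.
  rewrite mem_setE in_itv /= andbT le_eqVlt => /predU1P[<-|u0].
    under eq_integral do rewrite mulr0 cos0 subrr !mul0r.
    by rewrite integral0 /versinc mulr0 cos0 subrr !mul0r.
  under eq_integral do rewrite mulr1 EFinM -mulNr.
  rewrite ge0_integralZl//.
  - by rewrite integral_mul_expRN// -EFinM mulr1.
  - apply/measurable_EFinP/measurable_funTS/measurable_funM => //.
    by apply: measurableT_comp => //; exact: measurable_funM.
  - by move=> v; rewrite /= in_itv/= andbT => v0; rewrite lee_fin mulr_ge0 ?expR_ge0.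
have FA v : (\int[mu]_u (EFin \o F) (u, v) = (x ^+ 2 / (v ^+ 2 + x ^+ 2) * \1_B v)%:E)%E.
  rewrite /F /= indicE; have [|] := boolP (v \in B); last first.
    by move=> _; under eq_integral do rewrite mulr0; rewrite integral0 mulr0.
  rewrite mem_setE in_itv /= andbT => v0.
  under eq_integral do rewrite mulr1.
  rewrite -(integral_indic_mul A (fun u => (1 - cos (x * u)) * (v * expR (- (u * v))))).
  have E u : ((1 - cos (x * u)) * (v * expR (- (u * v))))%:E =
      (v%:E * ((1 - cos (x * u)) * expR (- v * u))%:E)%E.
    by rewrite -EFinM; congr EFin; rewrite mulrCA (mulrC u) mulNr.
  under eq_integral do rewrite E.
  rewrite ge0_integralZl//.
  - rewrite integral_1Bcos_expRN// -EFinM mulr1; congr EFin; field.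
    by rewrite !gt_eqF// ltr_pwDl ?exprn_gt0 ?sqr_ge0.
  - exact: measurable_itv.
  - apply/measurable_EFinP/measurable_funTS/measurable_funM => //.
      apply: measurable_funB => //.
      apply: continuous_measurable_fun; exact: (is_derive_continuous (is_derive_cosMl x)).
    by apply: measurableT_comp => //; exact: measurable_funM.
  - by rewrite lee_fin ltW.
have := @fubini_tonelli _ _ _ _ _ mu mu (EFin \o F) mF F0.
under eq_integral do rewrite FB.
under [in RHS]eq_integral do rewrite FA.
rewrite -!integral_indic_mul => ->.
rewrite integral_itv_obnd_cbnd ?integral_oneDsqr_scaled//.
apply/measurable_EFinP/measurable_funTS; apply: continuous_measurable_fun => v.
apply: cvgM; first exact: cvg_cst.
apply: cvgV; first by rewrite gt_eqF// ltr_wpDl ?exprn_gt0 ?sqr_ge0.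
by apply: cvgD; [exact: exprn_continuous|exact: cvg_cst].
Qed.

Lemma integral_versinc x : (\int[mu]_u (versinc x u)%:E = (pi * `|x|)%:E)%E.
Proof.
have vx : versinc x = versinc `|x|.
  apply/funext => u; rewrite /versinc; have [x0|x0] := leP 0 x; first by rewrite ger0_norm.
  by rewrite ltr0_norm// mulNr cosN.
rewrite vx ge0_integral_even; last 3 first.
- exact: measurable_versinc.
- by move=> u; exact: versinc_ge0.
- by move=> u; rewrite /versinc mulrN cosN sqrrN.
have := normr_ge0 x; rewrite le_eqVlt => /predU1P[<-|x0].
  rewrite integral0_eq ?mule0 ?mulr0// => u _.
  by rewrite /versinc mul0r cos0 subrr mul0r.
rewrite integral_half_versinc// -EFinM; congr EFin.
by field.
Qed.

Lemma integrable_versinc x : mu.-integrable setT (EFin \o versinc x).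
Proof.
apply/integrableP; split; first by apply/measurable_EFinP; exact: measurable_versinc.
under eq_integral do rewrite gee0_abs ?lee_fin ?versinc_ge0//.
by rewrite integral_versinc ltry.
Qed.

(** The product-to-sum formula, with the constants distributed so that each of the three terms is
    integrable by itself. *)
Lemma versinc_cos A B u : versinc A u * cos (B * u) =
  2^-1 * versinc (A + B) u + 2^-1 * versinc (A - B) u - versinc B u.
Proof.
rewrite /versinc (mulrDl A B u) (mulrBl u A B) cosD cosB.
by set w := (u ^+ 2)^-1; field.
Qed.

Lemma Rintegral_versinc x : \int[mu]_u (versinc x u) = pi * `|x|.
Proof. by rewrite /Rintegral integral_versinc. Qed.

Lemma Rintegral_versinc_cos A B : \int[mu]_u (versinc A u * cos (B * u)) =
  pi * (2^-1 * `|A + B| + 2^-1 * `|A - B| - `|B|).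
Proof.
under eq_Rintegral do rewrite versinc_cos.
have i1 := integrable_scale 2^-1 (integrable_versinc (A + B)).
have i2 := integrable_scale 2^-1 (integrable_versinc (A - B)).
have i3 := integrable_versinc B.
rewrite RintegralB//; last first.
  exact: (integrableD measurableT i1 i2).
rewrite RintegralD// !RintegralZl ?Rintegral_versinc//; try exact: integrable_versinc.
ring.
Qed.

End versinc.

Section parametric_measurability.
Context d1 d2 (T1 : measurableType d1) (T2 : measurableType d2) (R : realType).
Variable m : {sigma_finite_measure set T2 -> \bar R}.

(** Tonelli's theorem is applied to the positive and negative parts separately, so parameters with a
    non-integrable section cause no trouble. *)
Lemma measurable_Rintegral (f : T1 * T2 -> R) : measurable_fun setT f ->
  measurable_fun setT (fun x => \int[m]_y f (x, y)).
Proof.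
move=> mf; rewrite /Rintegral; apply: measurableT_comp => //.
under eq_fun do rewrite integralE.
apply: emeasurable_funB.
- have h : measurable_fun setT (fubini_F m (EFin \o f)^\+%E).
    by apply: measurable_fun_fubini_tonelli_F => //; apply: measurable_funepos;
      exact/measurable_EFinP.
  rewrite (_ : (fun x => _) = fubini_F m (EFin \o f)^\+%E)//.
  by apply/funext => x; apply: eq_integral => y _; rewrite !funeposE.
- have h : measurable_fun setT (fubini_F m (EFin \o f)^\-%E).
    by apply: measurable_fun_fubini_tonelli_F => //; apply: measurable_funeneg;
      exact/measurable_EFinP.
  rewrite (_ : (fun x => _) = fubini_F m (EFin \o f)^\-%E)//.
  by apply/funext => x; apply: eq_integral => y _; rewrite !funenegE.
Qed.

Lemma cmeas_Cintegral (f : T1 * T2 -> R[i]) : cmeas f ->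
  cmeas (fun x => Cintegral m (fun y => f (x, y))).
Proof.
by move=> [f1 f2]; split => /=;
  [exact: (measurable_Rintegral f1)|exact: (measurable_Rintegral f2)].
Qed.

End parametric_measurability.

(** * Fejer weights and moving averages *)

Section fejer.
Context {R : realType}.
Local Notation mu := (@lebesgue_measure R).
Variables (a : R -> R) (ai : mu.-integrable setT (EFin \o a)).
Implicit Types (r s t u w delta : R).

Definition cosine_transform w := \int[mu]_s (a s * cos (2 * pi * (w * s))).
Definition sine_transform w := \int[mu]_s (a s * sin (2 * pi * (w * s))).
Definition power_spectrum w := cosine_transform w ^+ 2 + sine_transform w ^+ 2.

Definition box delta (p : R * R) : R := (`|p.1 - p.2| < delta)%R%:R.
(** The tent of height 2 delta supported on [-2 delta, 2 delta], in the form in which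
    [Rintegral_versinc_cos] produces it. *)
Definition triangle delta r := 2^-1 * `|2 * delta + r| + 2^-1 * `|2 * delta - r| - `|r|.
(** The scale 4 pi delta and the divisor 2 pi^2 are those for which integration against cos(2 pi r
    w) gives exactly [triangle delta r]. *)
Definition fejer_weight delta w := versinc (4 * pi * delta) w / (2 * pi ^+ 2).

Lemma power_spectrum_ge0 w : 0 <= power_spectrum w.
Proof. by rewrite addr_ge0 ?sqr_ge0. Qed.

Lemma measurable_cosMl (p : R * R -> R) : measurable_fun setT p ->
  measurable_fun setT (fun q => cos (p q)).
Proof. exact: (measurableT_comp (continuous_measurable_fun (@continuous_cos R))). Qed.

Lemma measurable_sinMl (p : R * R -> R) : measurable_fun setT p ->
  measurable_fun setT (fun q => sin (p q)).
Proof. exact: (measurableT_comp (continuous_measurable_fun (@continuous_sin R))). Qed.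

Let mphase : measurable_fun setT (fun p : R * R => 2 * pi * (p.1 * p.2)).
Proof. by apply: measurable_funM => //; exact: measurable_funM. Qed.

Let ma : measurable_fun setT a.
Proof. by have /measurable_int/measurable_EFinP := ai. Qed.

Lemma measurable_power_spectrum : measurable_fun setT power_spectrum.
Proof.
have ma2 : measurable_fun setT (fun p : R * R => a p.2).
  exact: (measurableT_comp ma measurable_snd).
have mc : measurable_fun setT cosine_transform.
  have := @measurable_Rintegral _ _ _ _ _ mu (fun p : R * R => a p.2 * cos (2 * pi * (p.1 * p.2))).
  by apply; apply: measurable_funM => //; exact: measurable_cosMl.
have ms : measurable_fun setT sine_transform.
  have := @measurable_Rintegral _ _ _ _ _ mu (fun p : R * R => a p.2 * sin (2 * pi * (p.1 * p.2))).
  by apply; apply: measurable_funM => //; exact: measurable_sinMl.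
by apply: measurable_funD; exact: measurable_funX.
Qed.

Lemma fejer_weight_ge0 delta w : 0 <= fejer_weight delta w.
Proof. by rewrite divr_ge0 ?versinc_ge0// mulr_ge0// sqr_ge0. Qed.

Lemma measurable_fejer_weight delta : measurable_fun setT (fejer_weight delta).
Proof. by apply: measurable_funM => //; exact: measurable_versinc. Qed.

Lemma integrable_fejer_weight delta : mu.-integrable setT (EFin \o fejer_weight delta).
Proof.
have := integrable_scale (2 * pi ^+ 2)^-1 (integrable_versinc (4 * pi * delta)).
by rewrite /fejer_weight; under eq_fun do rewrite mulrC.
Qed.

Lemma Rintegral_fejer_weight_cos delta r :
  \int[mu]_w (fejer_weight delta w * cos (2 * pi * r * w)) = triangle delta r.
Proof.
have pi0 : 0 < pi :> R by exact: pi_gt0.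
have E w : fejer_weight delta w * cos (2 * pi * r * w) =
    (2 * pi ^+ 2)^-1 * (versinc (4 * pi * delta) w * cos (2 * pi * r * w)).
  by rewrite /fejer_weight; ring.
under eq_Rintegral do rewrite E.
rewrite RintegralZl//; last first.
  apply: (le_integrable measurableT _ _ (integrable_versinc (4 * pi * delta))).
    apply/measurable_EFinP/measurable_funM; first exact: measurable_versinc.
    apply: continuous_measurable_fun.
    exact: (is_derive_continuous (is_derive_cosMl (2 * pi * r))).
  move=> w _ /=; rewrite lee_fin normrM ler_piMr//.
  exact: cos_max.
rewrite Rintegral_versinc_cos /triangle.
have -> : 4 * pi * delta + 2 * pi * r = 2 * pi * (2 * delta + r) by ring.
have -> : 4 * pi * delta - 2 * pi * r = 2 * pi * (2 * delta - r) by ring.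
have p2 : 0 <= 2 * pi :> R by rewrite mulr_ge0// ltW.
rewrite !(normrM (2 * pi)) (ger0_norm p2).
move: pi0; clear; move: (@pi R) => q q0; field.
by rewrite gt_eqF.
Qed.

(** By the formula for cos(x - y), the quadratic forms of the cosine and of the sine add up to a
    kernel that depends only on s - t, namely the cosine transform of the weight. *)
Lemma integral_fejer_weight_power delta : 0 < delta ->
  (\int[mu]_w (fejer_weight delta w * power_spectrum w)%:E =
   \int[sfprod mu mu]_p (a p.1 * a p.2 * triangle delta (p.1 - p.2))%:E)%E.
Proof.
move=> d0; have iF := integrable_fejer_weight delta.
have mF := measurable_fejer_weight delta.
pose Hc (p : R * R) := cos (2 * pi * (p.1 * p.2)).
pose Hs (p : R * R) := sin (2 * pi * (p.1 * p.2)).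
have mHc : measurable_fun setT Hc by exact: measurable_cosMl.
have mHs : measurable_fun setT Hs by exact: measurable_sinMl.
pose M := fine (\int[mu]_w (fejer_weight delta w)%:E)%E.
have ME : (\int[mu]_w (fejer_weight delta w)%:E = M%:E)%E.
  by rewrite fineK//; exact: (integrable_fin_num measurableT iF).
have HM (H : R * R -> R) : measurable_fun setT H -> (forall p, `|H p| <= 1) ->
    forall s, (\int[mu]_w (fejer_weight delta w * `|H (w, s)|)%:E <= M%:E)%E.
  move=> mH H1 s; rewrite -ME; apply: ge0_le_integral => //.
  - by move=> w _; rewrite lee_fin mulr_ge0 ?fejer_weight_ge0.
  - apply/measurable_EFinP/measurable_funM => //; apply: measurableT_comp => //.
    by apply: (measurableT_comp mH); exact: pair2_measurable.
  - exact/measurable_EFinP.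
  - by move=> w _; rewrite lee_fin ler_piMr ?fejer_weight_ge0.
have Hc1 p : `|Hc p| <= 1 by exact: cos_max.
have Hs1 p : `|Hs p| <= 1 by exact: sin_max.
have [ic Ec] := @gram_quadratic_form _ _ _ _ _ mu mu _ _ M _ mF
  (fejer_weight_ge0 delta) mHc Hc1 (HM Hc mHc Hc1) ai.
have [is_ Es] := @gram_quadratic_form _ _ _ _ _ mu mu _ _ M _ mF
  (fejer_weight_ge0 delta) mHs Hs1 (HM Hs mHs Hs1) ai.
under eq_integral do rewrite /power_spectrum mulrDr EFinD.
rewrite ge0_integralD//; last 4 first.
- by move=> w _; rewrite lee_fin mulr_ge0 ?fejer_weight_ge0 ?sqr_ge0.
- apply/measurable_EFinP/measurable_funM => //; apply: measurable_funX.
  apply: (@measurable_Rintegral _ _ _ _ _ mu (fun p => a p.2 * Hc p)).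
  by apply: measurable_funM => //; exact: (measurableT_comp ma measurable_snd).
- by move=> w _; rewrite lee_fin mulr_ge0 ?fejer_weight_ge0 ?sqr_ge0.
- apply/measurable_EFinP/measurable_funM => //; apply: measurable_funX.
  apply: (@measurable_Rintegral _ _ _ _ _ mu (fun p => a p.2 * Hs p)).
  by apply: measurable_funM => //; exact: (measurableT_comp ma measurable_snd).
rewrite [X in (X + _)%E]Ec [X in (_ + X)%E]Es -integralD//.
apply: eq_integral => -[s t] _; rewrite -EFinD -mulrDr /=; congr (_ * _)%:E.
rewrite -Rintegral_fejer_weight_cos.
have bi (H : R * R -> R) : measurable_fun setT H -> (forall p, `|H p| <= 1) ->
    mu.-integrable setT (EFin \o (fun w => fejer_weight delta w * (H (w, s) * H (w, t)))).
  move=> mH H1; apply: (le_integrable measurableT _ _ iF).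
    apply/measurable_EFinP/measurable_funM => //; apply: measurable_funM;
    by apply: (measurableT_comp mH); exact: pair2_measurable.
  move=> w _ /=; rewrite lee_fin normrM ler_piMr// normrM.
  by rewrite -[1]mulr1 ler_pM.
rewrite -RintegralD//; [|exact: bi|exact: bi].
apply: eq_Rintegral => w _; rewrite -mulrDr; congr (_ * _).
have -> : 2 * pi * (s - t) * w = 2 * pi * (w * s) - 2 * pi * (w * t) by ring.
by rewrite cosB.
Qed.

Lemma measurable_box delta : measurable_fun setT (box delta).
Proof.
rewrite /box (_ : (fun p => _) = (fun p : R * R => if `|p.1 - p.2| < delta then 1 else 0)).
  apply: measurable_fun_ifT => //.
  apply: measurable_fun_ltr => //; apply: measurableT_comp => //.
  exact: measurable_funB.
by apply/funext => p; case: ifP.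
Qed.

Lemma box_indic delta u s : box delta (u, s) = \1_(ball u delta) s.
Proof. by rewrite indicE /box /= mem_setE. Qed.

Lemma boxC delta u s : box delta (u, s) = box delta (s, u).
Proof. by rewrite /box /= distrC. Qed.

Lemma integral_box delta u : 0 <= delta ->
  (\int[mu]_s (box delta (u, s))%:E = (2 * delta)%:E)%E.
Proof.
move=> d0; under eq_integral do rewrite box_indic.
rewrite integral_indic//; last exact: measurable_ball.
rewrite setIT; apply: etrans (lebesgue_measure_ball u d0) _.
by rewrite mulr_natl.
Qed.

Lemma triangleE delta r : 0 < delta -> triangle delta r =
  if `|r| < 2 * delta then 2 * delta - `|r| else 0.
Proof.
move=> d0; rewrite /triangle; have [r0|r0] := leP 0 r.
  rewrite (ger0_norm r0); have [h1|h1] := leP 0 (2 * delta + r);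
  have [h2|h2] := leP 0 (2 * delta - r); rewrite ?(ger0_norm h1) ?(ltr0_norm h1)
    ?(ger0_norm h2) ?(ltr0_norm h2); case: ltP => h; lra.
rewrite (ltr0_norm r0); have [h1|h1] := leP 0 (2 * delta + r);
have [h2|h2] := leP 0 (2 * delta - r); rewrite ?(ger0_norm h1) ?(ltr0_norm h1)
  ?(ger0_norm h2) ?(ltr0_norm h2); case: ltP => h; lra.
Qed.

(** Windows of radius delta around s and t overlap in the interval from max(s, t) - delta to min(s,
    t) + delta. The factor 1 is the constant weight to which [gram_quadratic_form] is applied. *)
Lemma Rintegral_box_box delta s t : 0 < delta ->
  \int[mu]_w (1 * (box delta (w, s) * box delta (w, t))) = triangle delta (s - t).
Proof.
move=> d0; rewrite /Rintegral.
have E w : 1 * (box delta (w, s) * box delta (w, t)) =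
    \1_(`](Num.max s t - delta), (Num.min s t + delta)[%classic : set R) w.
  rewrite mul1r /box /= -natrM mulnb indicE mem_setE in_itv /=.
  congr (_%:R); congr nat_of_bool.
  rewrite !ltr_norml; have [st|ts] := leP s t;
  by apply/idP/idP => [/andP[/andP[? ?] /andP[? ?]]|/andP[? ?]];
    repeat (apply/andP; split); lra.
under eq_integral do rewrite E.
rewrite integral_indic// setIT triangleE//.
transitivity (fine (if (Num.max s t - delta < Num.min s t + delta)%R
  then ((Num.min s t + delta) - (Num.max s t - delta))%:E else 0%E)).
  by congr fine; apply: etrans (lebesgue_measure_itv _) _; rewrite /= lte_fin -EFinB.
have [st|ts] := leP s t.
  rewrite ler0_norm ?subr_le0//.
  by case: ltP => h; case: ltP => h' //=; lra.
rewrite gtr0_norm ?subr_gt0//.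
by case: ltP => h; case: ltP => h' //=; lra.
Qed.

(** The windows have the same Gram kernel as the Fejer weight, which ties the moving averages to the
    power spectrum. *)
Lemma integral_box_average delta : 0 < delta ->
  (\int[mu]_u ((\int[mu]_s (a s * box delta (u, s))) ^+ 2)%:E =
   \int[sfprod mu mu]_p (a p.1 * a p.2 * triangle delta (p.1 - p.2))%:E)%E.
Proof.
move=> d0.
have b1 p : `|box delta p| <= 1.
  by rewrite /box ger0_norm ?ler0n//; case: (_ < _).
have HM s : (\int[mu]_u (1 * `|box delta (u, s)|)%:E <= (2 * delta)%:E)%E.
  rewrite -(integral_box s (ltW d0)) le_eqVlt; apply/orP; left; apply/eqP.
  by apply: eq_integral => u _; rewrite mul1r boxC ger0_norm// ler0n.
have [_] := @gram_quadratic_form _ _ _ _ _ mu mu (fun=> 1) _ _ _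
  (measurable_cst _) (fun=> ler01) (measurable_box delta) b1 HM ai.
under eq_integral do rewrite mul1r.
move=> ->; apply: eq_integral => -[s t] _ /=.
by rewrite Rintegral_box_box.
Qed.

End fejer.

Section sinc_bounds.
Context {R : realType}.
Implicit Types (x y z w delta : R).

Lemma normr_sin_le y : `|sin y| <= `|y|.
Proof.
wlog y0 : y / 0 <= y => [h|].
  have [/h//|y0] := leP 0 y.
  by rewrite -normrN -sinN -(normrN y); apply: h; rewrite oppr_ge0 ltW.
have [c _] := @MVT_segment _ sin cos 0 y y0 (fun x _ => is_derive_sin x)
  (continuous_subspaceT (@continuous_sin R)).
by rewrite sin0 !subr0 => ->; rewrite normrM ler_piMl// cos_max.
Qed.

(** This is 1 - cos(2y) = 2 sin(y)^2. The factor (2 delta)^-2 is the one that turns squared window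
    integrals into squared averages. *)
Lemma fejer_weight_sinc delta w : 0 < delta -> w != 0 ->
  (2 * delta) ^- 2 * fejer_weight delta w =
  (sin (2 * pi * delta * w) / (2 * pi * delta * w)) ^+ 2.
Proof.
move=> d0 w0; rewrite /fejer_weight /versinc.
have -> : 4 * pi * delta * w = (2 * pi * delta * w) *+ 2 by rewrite mulr2n; ring.
set y := 2 * pi * delta * w; rewrite cos_mulr2n cos2sin2.
move: (sin y) => s; rewrite {}/y; move: (@pi_gt0 R); move: (@pi R) => q q0; field.
by rewrite w0 !gt_eqF.
Qed.

Lemma fejer_weight_le1 delta w : 0 < delta ->
  (2 * delta) ^- 2 * fejer_weight delta w <= 1.
Proof.
move=> d0; have [->|w0] := eqVneq w 0.
  by rewrite /fejer_weight /versinc mulr0 cos0 subrr !mul0r mulr0.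
have y0 : 2 * pi * delta * w != 0 by rewrite !mulf_neq0// gt_eqF// pi_gt0.
rewrite fejer_weight_sinc// -(real_normK (num_real (_ / _))) exprn_ile1//.
by rewrite normrM normfV ler_pdivrMr ?normr_gt0// mul1r normr_sin_le.
Qed.

(** The limit is the derivative of the sine at 0. The point w = 0 is excluded because the weight is
    0 there by the convention on division. *)
Lemma fejer_weight_cvg w : w != 0 ->
  (2 * n.+1%:R^-1) ^- 2 * fejer_weight n.+1%:R^-1 w @[n --> \oo] --> (1 : R).
Proof.
move=> w0.
have sinc1 : sin y / y @[y --> (0 : R)^'] --> (1 : R).
  have := @ex_derive _ _ _ _ _ _ _ (is_derive_sin (0 : R)).
  move=> /cvg_ex[l hl].
  have E : l = 1.
    rewrite -(cvg_lim _ hl)//; have := @derive_val _ _ _ _ _ _ _ (is_derive_sin (0 : R)).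
    by rewrite cos0.
  move: hl; rewrite E; apply: cvg_trans; apply: near_eq_cvg.
  by apply: nearW => y /=; rewrite sin0 subr0 addr0 /GRing.scale /= mulr1 mulrC.
have h : sin (2 * pi * n.+1%:R^-1 * w) / (2 * pi * n.+1%:R^-1 * w) @[n --> \oo] --> (1 : R).
  move/cvgr_dnbhsP : sinc1 => /(_ (fun n => 2 * pi * n.+1%:R^-1 * w)); apply; split.
    by move=> n; rewrite !mulf_neq0 ?invr_eq0// gt_eqF// pi_gt0.
  rewrite -[X in _ --> X](mul0r w) -(mulr0 (2 * pi)).
  apply: cvgM; last exact: cvg_cst.
  apply: cvgM; first exact: cvg_cst.
  exact: cvg_harmonic.
have -> : (fun n => (2 * n.+1%:R^-1) ^- 2 * fejer_weight n.+1%:R^-1 w) =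
    (fun n => (sin (2 * pi * n.+1%:R^-1 * w) / (2 * pi * n.+1%:R^-1 * w)) *
              (sin (2 * pi * n.+1%:R^-1 * w) / (2 * pi * n.+1%:R^-1 * w))).
  by apply/funext => n; rewrite fejer_weight_sinc ?invr_gt0// expr2.
have hh := cvgM h h; rewrite [1 * 1]mulr1 in hh.
exact: hh.
Qed.

End sinc_bounds.

(** * Plancherel's formula for real functions of one variable *)

Section real_plancherel.
Context {R : realType}.
Local Notation mu := (@lebesgue_measure R).
Variables (a : R -> R) (ai : mu.-integrable setT (EFin \o a)).
Implicit Types (r s t u w delta : R).

Let ma : measurable_fun setT a.
Proof. by have /measurable_int/measurable_EFinP := ai. Qed.

Let mb delta u : measurable_fun setT (fun s => box delta (u, s)).
Proof. by apply: (measurableT_comp (measurable_box delta)); exact: pair1_measurable. Qed.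

Let mbr delta s : measurable_fun setT (fun u => box delta (u, s)).
Proof. by apply: (measurableT_comp (measurable_box delta)); exact: pair2_measurable. Qed.

Lemma box01 delta (p : R * R) : box delta p = 0 \/ box delta p = 1.
Proof. by rewrite /box; case: (_ < _); [right|left]. Qed.

Lemma box_ge0 delta (p : R * R) : 0 <= box delta p.
Proof. exact: ler0n. Qed.

(** The Cauchy-Schwarz inequality against the window, which equals its own square and has squared
    norm 2 delta. *)
Lemma square_integral_box_le delta u : 0 < delta ->
  (\int[mu]_s (a s ^+ 2)%:E < +oo)%E ->
  (((\int[mu]_s (a s * box delta (u, s))) ^+ 2)%:E <=
   (2 * delta)%:E * \int[mu]_s (a s ^+ 2 * box delta (u, s))%:E)%E.
Proof.
move=> d0 aoo.
pose f s : R[i] := (a s * box delta (u, s))%:C.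
pose g s : R[i] := (box delta (u, s))%:C.
have Ef s : nsq (f s) = a s ^+ 2 * box delta (u, s).
  rewrite /nsq /= expr0n addr0 exprMn; congr (_ * _).
  by have [->|->] := box01 delta (u, s); rewrite ?expr0n ?expr1n.
have Eg s : nsq (g s) = box delta (u, s).
  rewrite /nsq /= expr0n addr0.
  by have [->|->] := box01 delta (u, s); rewrite ?expr0n ?expr1n.
have mf : cmeas f.
  by split; [exact: (measurable_funM ma (mb delta u))|exact: measurable_cst].
have Lf : L2 mu f.
  apply/L2P; split; first exact: mf.
  apply: le_lt_trans aoo; apply: ge0_le_integral => //.
  - by move=> s _; rewrite lee_fin nsq_ge0.
  - exact: (measurable_nsqE mf).
  - by apply/measurable_EFinP; exact: measurable_funX.
  - move=> s _; rewrite Ef lee_fin ler_piMr ?sqr_ge0//.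
    by have [->|->] := box01 delta (u, s).
have Lg : L2 mu g.
  apply/L2P; split; first by split; [exact: (mb delta u)|exact: measurable_cst].
  rewrite /N2; under eq_integral do rewrite Eg.
  by rewrite integral_box ?ltW// ltry.
have ng : n2 mu g = 2 * delta.
  by rewrite /n2 /N2; under eq_integral do rewrite Eg; rewrite integral_box ?ltW.
have := cauchy_schwarz Lf Lg; rewrite ng mulrC -lee_fin EFinM n2E// /N2.
under eq_integral do rewrite Ef.
apply: le_trans; rewrite lee_fin /nsq ler_wpDr ?sqr_ge0// le_eqVlt; apply/orP; left.
apply/eqP; congr (_ ^+ 2); apply: eq_Rintegral => s _ /=.
rewrite oppr0 mul0r subr0 -mulrA; congr (_ * _).
by have [->|->] := box01 delta (u, s); rewrite ?mulr0 ?mulr1.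
Qed.

(** One factor 2 delta comes from the Cauchy-Schwarz inequality in each window, the other from
    Tonelli's theorem: the windows containing a given point have centres in an interval of length 2
    delta. *)
Lemma integral_box_average_le delta : 0 < delta ->
  (\int[mu]_u ((\int[mu]_s (a s * box delta (u, s))) ^+ 2)%:E <=
   ((2 * delta) ^+ 2)%:E * \int[mu]_s (a s ^+ 2)%:E)%E.
Proof.
move=> d0; have d20 : 0 < 2 * delta by rewrite mulr_gt0.
have ma2 : measurable_fun setT (fun s => (a s ^+ 2)%:E).
  by apply/measurable_EFinP; exact: measurable_funX.
have [aoo|] := ltP (\int[mu]_s (a s ^+ 2)%:E)%E +oo%E; last first.
  by rewrite leye_eq => /eqP ->; rewrite mulry gtr0_sg ?exprn_gt0// mul1e leey.
have mab : measurable_fun setT (fun p : R * R => (a p.2 ^+ 2 * box delta p)%:E).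
  apply/measurable_EFinP/measurable_funM; last exact: measurable_box.
  by apply: measurable_funX; exact: (measurableT_comp ma measurable_snd).
have ab0 (p : R * R) : (0 <= (a p.2 ^+ 2 * box delta p)%:E)%E.
  by rewrite lee_fin mulr_ge0 ?sqr_ge0 ?box_ge0.
have mFab : measurable_fun [set: measurableTypeR R]
    (fun u => \int[mu]_s (a s ^+ 2 * box delta (u, s))%:E)%E.
  by have := @measurable_fun_fubini_tonelli_F _ _ (measurableTypeR R) (measurableTypeR R)
    R mu _ mab ab0.
apply: (@le_trans _ _ (\int[mu]_u ((2 * delta)%:E * \int[mu]_s (a s ^+ 2 * box delta (u, s))%:E))%E).
  apply: ge0_le_integral => //.
  - by move=> u _; rewrite lee_fin sqr_ge0.
  - apply/measurable_EFinP/measurable_funX.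
    apply: (@measurable_Rintegral _ _ _ _ _ mu (fun p => a p.2 * box delta p)).
    apply: measurable_funM; last exact: measurable_box.
    exact: (measurableT_comp ma measurable_snd).
  - apply: measurable_funeM.
    exact: mFab.
  - by move=> u _; exact: square_integral_box_le.
rewrite ge0_integralZl//; last 2 first.
- by move=> u _; apply: integral_ge0 => s _; exact: (ab0 (u, s)).
- by rewrite lee_fin ltW.
have := @fubini_tonelli _ _ _ _ _ mu mu _ mab ab0 => /= ->.
have E s : (\int[mu]_u (a s ^+ 2 * box delta (u, s))%:E = (2 * delta)%:E * (a s ^+ 2)%:E)%E.
  under eq_integral do rewrite EFinM.
  rewrite ge0_integralZl//; last 3 first.
  - by apply/measurable_EFinP; exact: mbr.
  - by move=> u _; rewrite lee_fin box_ge0.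
  - by rewrite lee_fin sqr_ge0.
  under eq_integral do rewrite boxC.
  by rewrite integral_box ?ltW// muleC.
under eq_integral do rewrite E.
rewrite ge0_integralZl//; last 2 first.
- by move=> s _; rewrite lee_fin sqr_ge0.
- by rewrite lee_fin ltW.
by rewrite muleA -EFinM -expr2.
Qed.

(** Lebesgue's differentiation theorem along the balls of radius 1/(n+1), which shrink nicely to
    their centre. *)
Lemma box_average_cvg : {ae mu, forall u,
  ((2 * n.+1%:R^-1)^-1 * \int[mu]_s (a s * box n.+1%:R^-1 (u, s))) ^+ 2
    @[n --> \oo] --> a u ^+ 2}.
Proof.
have locf : locally_integrable setT a by apply: open_integrable_locally => //; exact: openT.
have nice u : nicely_shrinking u (fun n => ball u (n.+1%:R^-1 : R)).
  split; first by move=> n; exact: measurable_ball.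
  have p0 n : 0 < n.+1%:R^-1 :> R by rewrite invr_gt0.
  exists (1, fun n => PosNum (p0 n)); split => //=.
  - exact: cvg_harmonic.
  - by move=> n.
  - by move=> n; rewrite mul1e.
have [N [mN N0 sN]] := lebesgue_differentiation locf; exists N; split => // u /=.
move=> hu; apply: sN => /= {}hu'; apply: hu => {}/=; move: hu' => hu.
have /fine_cvg := nice_lebesgue_differentiation nice locf hu.
move=> h; apply: (@cvg_comp _ _ _ _ (fun r : R => r ^+ 2)); last exact: exprn_continuous.
apply: cvg_trans h; apply: near_eq_cvg; apply: nearW => n /=.
have d0 : 0 <= n.+1%:R^-1 :> R by rewrite invr_ge0.
rewrite integral_indic_mul.
have -> : (lebesgue_measure (ball u n.+1%:R^-1) = (2 * n.+1%:R^-1 : R)%:E)%E.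
  by apply: etrans (lebesgue_measure_ball u d0) _; rewrite mulr_natl.
have E : (\int[mu]_x (a x * \1_(ball u n.+1%:R^-1) x)%:E =
  (\int[mu]_s (a s * box n.+1%:R^-1 (u, s)))%:E)%E.
  rewrite /Rintegral fineK.
    by apply: eq_integral => s _; rewrite box_indic.
  apply: (integrable_fin_num measurableT).
  apply: (le_integrable measurableT _ _ ai).
    by apply/measurable_EFinP; exact: (measurable_funM ma (mb _ u)).
  move=> s _ /=; rewrite lee_fin normrM ler_piMr//.
  by have [->|->] := box01 n.+1%:R^-1 (u, s); rewrite ?normr0 ?normr1.
by rewrite E inver mulf_eq0 pnatr_eq0 invr_eq0 pnatr_eq0.
Qed.

Lemma plancherel_real :
  (\int[mu]_w (power_spectrum a w)%:E = \int[mu]_s (a s ^+ 2)%:E)%E.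
Proof.
pose dl n : R := n.+1%:R^-1.
have d0 n : 0 < dl n by rewrite invr_gt0.
have c0 n : 0 <= (2 * dl n) ^- 2 by rewrite invr_ge0 exprn_ge0// mulr_ge0// ltW.
have mF n := measurable_fejer_weight (dl n).
have mP := measurable_power_spectrum ai.
have mJ n : measurable_fun setT (fun u => \int[mu]_s (a s * box (dl n) (u, s))).
  apply: (@measurable_Rintegral _ _ _ _ _ mu (fun p => a p.2 * box (dl n) p)).
  apply: measurable_funM; last exact: measurable_box.
  exact: (measurableT_comp ma measurable_snd).
(* Both sides are (2 delta)^-2 times the same quadratic form in [a]. *)
have IJ n : (\int[mu]_u (((2 * dl n)^-1 * \int[mu]_s (a s * box (dl n) (u, s))) ^+ 2)%:E =
    \int[mu]_w ((2 * dl n) ^- 2 * fejer_weight (dl n) w * power_spectrum a w)%:E)%E.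
  under eq_integral do rewrite exprMn exprVn EFinM.
  rewrite ge0_integralZl//; last 3 first.
  - by apply/measurable_EFinP; apply: measurable_funX; exact: mJ.
  - by move=> u _; rewrite lee_fin sqr_ge0.
  - by rewrite lee_fin.
  rewrite integral_box_average// -integral_fejer_weight_power//.
  under [in RHS]eq_integral do rewrite -mulrA EFinM.
  rewrite [RHS]ge0_integralZl//.
  - by apply/measurable_EFinP; apply: measurable_funM => //; exact: mF.
  - by move=> w _; rewrite lee_fin mulr_ge0 ?fejer_weight_ge0 ?power_spectrum_ge0.
  - by rewrite lee_fin.
apply/eqP; rewrite eq_le; apply/andP; split.
  apply: (@fatou_le _ (measurableTypeR R) R mu
    (fun n w => (2 * dl n) ^- 2 * fejer_weight (dl n) w * power_spectrum a w)).
  - by move=> n; apply: measurable_funM => //; apply: measurable_funM => //; exact: mF.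
  - exact: mP.
  - by move=> n w; rewrite mulr_ge0 ?power_spectrum_ge0// mulr_ge0 ?fejer_weight_ge0 ?c0.
  (* The normalised weights tend to 1 except at w = 0, where all of them are 0. *)
  - exists [set 0]; split => //; first exact: lebesgue_measure_set1.
    move=> w /=; apply: contra_notP => /eqP w0.
    rewrite -[X in _ --> X]mul1r; apply: cvgM; last exact: cvg_cst.
    exact: fejer_weight_cvg.
  - move=> n; rewrite -IJ; under eq_integral do rewrite exprMn exprVn EFinM.
    rewrite ge0_integralZl//; last 3 first.
    - by apply/measurable_EFinP; apply: measurable_funX; exact: mJ.
    - by move=> u _; rewrite lee_fin sqr_ge0.
    - by rewrite lee_fin.
    apply: le_trans (lee_wpmul2l _ (integral_box_average_le (d0 n))) _; first by rewrite lee_fin.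
    rewrite muleA -EFinM mulVf ?mul1e//.
    by rewrite expf_neq0// mulf_neq0// gt_eqF.
apply: (@fatou_le _ (measurableTypeR R) R mu
  (fun n u => ((2 * dl n)^-1 * \int[mu]_s (a s * box (dl n) (u, s))) ^+ 2)).
- by move=> n; apply: measurable_funX; apply: measurable_funM => //; exact: mJ.
- exact: measurable_funX.
- by move=> n u; exact: sqr_ge0.
- exact: box_average_cvg.
- move=> n; rewrite IJ; apply: ge0_le_integral => //.
  + by move=> w _; rewrite lee_fin mulr_ge0 ?power_spectrum_ge0// mulr_ge0 ?fejer_weight_ge0 ?c0.
  + by apply/measurable_EFinP; apply: measurable_funM => //; apply: measurable_funM => //; exact: mF.
  + exact/measurable_EFinP.
  + by move=> w _; rewrite lee_fin ler_piMl ?power_spectrum_ge0 ?fejer_weight_le1.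
Qed.

End real_plancherel.

(** * Plancherel's formula for products and on R^d *)

Section product_integrals.
Context d1 d2 (T1 : measurableType d1) (T2 : measurableType d2) (R : realType).
Variables (m1 : {sigma_finite_measure set T1 -> \bar R})
  (m2 : {sigma_finite_measure set T2 -> \bar R}).

(** Fubini's theorem for real-valued section integrals: [fine] can alter the extended-valued ones
    only where a section is not integrable, which is a null set. *)
Lemma Rintegral_sfprod (f : T1 * T2 -> R) :
  (sfprod m1 m2).-integrable setT (EFin \o f) ->
  [/\ {ae m1, forall x, m2.-integrable setT (fun y => (f (x, y))%:E)},
      m1.-integrable setT (fun x => (\int[m2]_y f (x, y))%:E) &
      \int[sfprod m1 m2]_p f p = \int[m1]_x \int[m2]_y f (x, y)].
Proof.
move=> fi; have fi' : (m1 \x m2)%E.-integrable setT (EFin \o f) := fi.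
have mf : measurable_fun setT f by have /measurable_int/measurable_EFinP := fi.
have aei := ae_integrable1 fi'.
have mF := measurable_fubini_F fi'.
have mR : measurable_fun setT (fun x => (\int[m2]_y f (x, y))%:E).
  by apply/measurable_EFinP; exact: measurable_Rintegral.
have aeE : ae_eq m1 setT (fubini_F m2 (EFin \o f)) (fun x => (\int[m2]_y f (x, y))%:E).
  apply: filterS aei => x fx _; rewrite /fubini_F /Rintegral fineK//.
  exact: (integrable_fin_num measurableT fx).
split => //.
  have /integrableP[_ Foo] := integrable_fubini_F fi'.
  apply/integrableP; split => //; move: Foo; congr (_ < _)%E.
  apply: ae_eq_integral => //; try exact: measurableT_comp.
  by apply: filterS aeE => x /= h /h ->.
rewrite {1}/Rintegral -(integral12_prod_meas1 fi').
by rewrite {1}/Rintegral; congr fine; exact: ae_eq_integral.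
Qed.

Lemma Cintegral_sfprod (f : T1 * T2 -> R[i]) : Cintble (sfprod m1 m2) f ->
  [/\ {ae m1, forall x, Cintble m2 (fun y => f (x, y))},
      Cintble m1 (fun x => Cintegral m2 (fun y => f (x, y))) &
      Cintegral (sfprod m1 m2) f = Cintegral m1 (fun x => Cintegral m2 (fun y => f (x, y)))].
Proof.
move=> [f1 f2]; have [a1 b1 c1] := Rintegral_sfprod f1.
have [a2 b2 c2] := Rintegral_sfprod f2.
split => //; last by apply/eqP; rewrite eq_complex /= c1 c2 !eqxx.
by apply: filterS2 a1 a2.
Qed.

Lemma N2_sfprod (f : T1 * T2 -> R[i]) : cmeas f ->
  N2 (sfprod m1 m2) f = (\int[m1]_x N2 m2 (fun y => f (x, y)))%E.
Proof.
move=> mf; apply: fubini_tonelli1; first exact: measurable_nsqE.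
by move=> p; rewrite lee_fin nsq_ge0.
Qed.

End product_integrals.

Section cmeas_sections.
Context d1 d2 (T1 : measurableType d1) (T2 : measurableType d2) (R : realType).

Lemma cmeas_pair1 (f : T1 * T2 -> R[i]) x : cmeas f -> cmeas (fun y => f (x, y)).
Proof. by move=> mf; exact: (cmeas_comp (pair1_measurable x) mf). Qed.

Lemma cmeas_pair2 (f : T1 * T2 -> R[i]) y : cmeas f -> cmeas (fun x => f (x, y)).
Proof. by move=> mf; exact: (cmeas_comp (pair2_measurable y) mf). Qed.

End cmeas_sections.

Lemma Cintble_expi d (T : measurableType d) (R : realType)
    (mu : {measure set T -> \bar R}) (p : T -> R) (h : T -> R[i]) :
  measurable_fun setT p -> Cintble mu h -> Cintble mu (fun x => expi (p x) * h x).
Proof.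
move=> mp /CintbleP[mh hoo].
apply: (@Cintble_le _ _ _ _ _ (fun x => 2 * cabs (h x))).
- by apply: cmeasM => //; exact: cmeas_expi.
- apply: integrable_scale; apply/integrableP; split; first exact: measurable_cabsE.
  by under eq_integral do rewrite gee0_abs ?lee_fin ?cabs_ge0//.
- move=> x; apply: le_trans (cabsM_le _ _) _.
  by rewrite ler_wpM2r ?cabs_ge0 ?cabs_expi.
Qed.

(* Only [L^1] functions are considered and both sides may be infinite, so that
   no density argument is needed; Tonelli's theorem suffices for products. *)
Definition fourier_pair d1 d2 (X : measurableType d1) (Y : measurableType d2)
    (R : realType) (mX : {measure set X -> \bar R}) (mY : {measure set Y -> \bar R})
    (phi : X * Y -> R) :=
  measurable_fun setT phi /\ forall h, Cintble mX h ->
    N2 mY (fun y => Cintegral mX (fun x => expi (phi (x, y)) * h x)) = N2 mX h.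

(** The hypothesis is applied to the conjugate of [h]; conjugating the transform reverses the phase
    and keeps the modulus. *)
Lemma fourier_pair_opp d1 d2 (X : measurableType d1) (Y : measurableType d2)
    (R : realType) (mX : {measure set X -> \bar R}) (mY : {measure set Y -> \bar R})
    (phi : X * Y -> R) :
  fourier_pair mX mY phi -> fourier_pair mX mY (fun p => - phi p).
Proof.
move=> [mphi H]; split => [|h hi]; first exact: measurable_funN.
have := H _ (Cintble_conj hi).
have -> : N2 mX (fun x => conjc (h x)) = N2 mX h.
  by apply: eq_integral => x _; rewrite nsq_conj.
move=> <-; apply: eq_integral => y _; congr EFin.
rewrite -nsq_conj -Cintegral_conj.
  by congr nsq; apply: eq_Cintegral => x; rewrite conjcM conj_expi opprK.
apply: Cintble_expi => //; apply: measurable_funN.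
by apply: (measurableT_comp mphi); exact: pair2_measurable.
Qed.

(** The second variable is transformed first, giving [h1], and then the first one. The first formula
    is used at fixed y2 and the second at fixed x1, with Tonelli's theorem exchanging x1 and y2 in
    between. *)
Lemma fourier_pair_prod d1 d2 d3 d4 (X1 : measurableType d1) (Y1 : measurableType d2)
    (X2 : measurableType d3) (Y2 : measurableType d4) (R : realType)
    (mX1 : {sigma_finite_measure set X1 -> \bar R})
    (mY1 : {sigma_finite_measure set Y1 -> \bar R})
    (mX2 : {sigma_finite_measure set X2 -> \bar R})
    (mY2 : {sigma_finite_measure set Y2 -> \bar R})
    (phi1 : X1 * Y1 -> R) (phi2 : X2 * Y2 -> R) :
  fourier_pair mX1 mY1 phi1 -> fourier_pair mX2 mY2 phi2 ->
  fourier_pair (sfprod mX1 mX2) (sfprod mY1 mY2)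
    (fun p => phi1 (p.1.1, p.2.1) + phi2 (p.1.2, p.2.2)).
Proof.
move=> [mphi1 H1] [mphi2 H2].
have mphi : measurable_fun setT (fun p : (X1 * X2) * (Y1 * Y2) =>
    phi1 (p.1.1, p.2.1) + phi2 (p.1.2, p.2.2)).
  apply: measurable_funD.
    apply: (measurableT_comp mphi1); apply: measurable_fun_pair; exact: measurableT_comp.
  apply: (measurableT_comp mphi2); apply: measurable_fun_pair; exact: measurableT_comp.
split => // h hi; have mh := Cintble_cmeas hi.
pose h1 x1 y2 := Cintegral mX2 (fun x2 => expi (phi2 (x2, y2)) * h (x1, x2)).
have mker2 : cmeas (fun p : (X1 * Y2) * X2 => expi (phi2 (p.2, p.1.2)) * h (p.1.1, p.2)).
  apply: cmeasM.
    apply: (@cmeas_expi _ _ _ (fun p : (X1 * Y2) * X2 => phi2 (p.2, p.1.2))).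
    by apply: (measurableT_comp mphi2); apply: measurable_fun_pair => //; exact: measurableT_comp.
  have mp : measurable_fun setT (fun p : (X1 * Y2) * X2 => (p.1.1, p.2)).
    by apply: measurable_fun_pair => //; exact: measurableT_comp.
  exact: (cmeas_comp mp mh).
have mh1 : cmeas (fun p : X1 * Y2 => h1 p.1 p.2).
  exact: (@cmeas_Cintegral _ _ _ _ _ mX2 (fun p => expi (phi2 (p.2, p.1.2)) * h (p.1.1, p.2))).
have e2i y2 : Cintble (sfprod mX1 mX2) (fun p => expi (phi2 (p.2, y2)) * h p).
  apply: (@Cintble_expi _ _ _ _ (fun p => phi2 (p.2, y2))) => //.
  by apply: (measurableT_comp mphi2); exact: measurable_fun_pair.
(* This holds for every y2: a unimodular factor preserves integrability on the product, and Fubini's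
   theorem then makes the section integral integrable in x1. *)
have h1i y2 : Cintble mX1 (h1 ^~ y2).
  by have [_ hh _] := Cintegral_sfprod (e2i y2).
have FE y : Cintegral (sfprod mX1 mX2)
    (fun x => expi (phi1 (x.1, y.1) + phi2 (x.2, y.2)) * h x) =
    Cintegral mX1 (fun x1 => expi (phi1 (x1, y.1)) * h1 x1 y.2).
  have Fi : Cintble (sfprod mX1 mX2)
      (fun x => expi (phi1 (x.1, y.1) + phi2 (x.2, y.2)) * h x).
    apply: (@Cintble_expi _ _ _ _ (fun x => phi1 (x.1, y.1) + phi2 (x.2, y.2))) => //.
    exact: (measurableT_comp mphi (pair2_measurable y)).
  have [_ FiI ->] := Cintegral_sfprod Fi.
  have [aei _ _] := Cintegral_sfprod (e2i y.2).
  apply: ae_eq_Cintegral.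
  - exact: Cintble_cmeas FiI.
  - apply: cmeasM; last exact: (cmeas_pair2 (f := fun p => h1 p.1 p.2)).
    apply: cmeas_expi; apply: (measurableT_comp mphi1); exact: pair2_measurable.
  - apply: filterS aei => x1 hx1 _ /=; rewrite /h1 -CintegralZ//.
    by apply: eq_Cintegral => x2; rewrite expiD mulrA.
have mFh : cmeas (fun y : Y1 * Y2 => Cintegral mX1 (fun x1 => expi (phi1 (x1, y.1)) * h1 x1 y.2)).
  apply: (@cmeas_Cintegral _ _ _ _ _ mX1
    (fun p : (Y1 * Y2) * X1 => expi (phi1 (p.2, p.1.1)) * h1 p.2 p.1.2)).
  apply: cmeasM.
    apply: (@cmeas_expi _ _ _ (fun p : (Y1 * Y2) * X1 => phi1 (p.2, p.1.1))).
    by apply: (measurableT_comp mphi1); apply: measurable_fun_pair => //; exact: measurableT_comp.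
  have mp : measurable_fun setT (fun p : (Y1 * Y2) * X1 => (p.2, p.1.2)).
    by apply: measurable_fun_pair => //; exact: measurableT_comp.
  exact: (cmeas_comp mp mh1).
transitivity (\int[mY2]_y2 \int[mX1]_x1 (nsq (h1 x1 y2))%:E)%E.
  rewrite /N2; under eq_integral do rewrite FE.
  rewrite [LHS](@fubini_tonelli2 _ _ _ _ _ mY1 mY2
    (fun y => (nsq (Cintegral mX1 (fun x1 => expi (phi1 (x1, y.1)) * h1 x1 y.2)))%:E)).
  - by apply: eq_integral => y2 _; exact: (H1 _ (h1i y2)).
  - exact: measurable_nsqE.
  - by move=> y; rewrite lee_fin nsq_ge0.
rewrite N2_sfprod//.
have := @fubini_tonelli _ _ _ _ _ mX1 mY2 (fun p => (nsq (h1 p.1 p.2))%:E)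
  (measurable_nsqE mh1) (fun p => nsq_ge0 _) => /= <-.
have [aei _ _] := Cintegral_sfprod hi.
apply: ae_eq_integral => //.
- apply: (@measurable_fun_fubini_tonelli_F _ _ _ _ _ mY2 (fun p => (nsq (h1 p.1 p.2))%:E)).
    exact: measurable_nsqE.
  by move=> p; rewrite lee_fin nsq_ge0.
- apply: (@measurable_fun_fubini_tonelli_F _ _ _ _ _ mX2 (fun p => (nsq (h p))%:E)).
    exact: measurable_nsqE.
  by move=> p; rewrite lee_fin nsq_ge0.
- by apply: filterS aei => x1 hx1 _; exact: (H2 _ hx1).
Qed.

(** The real formula is applied to the real and imaginary parts of [h]. The cross terms in |F(w)|^2
    are odd in w, so they cancel when |F(-w)|^2 is added, and reflection shows that both have the
    same integral. *)
Lemma fourier_pair_line (R : realType) :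
  fourier_pair (@lebesgue_measure R) (@lebesgue_measure R) (fun p => 2 * pi * (p.1 * p.2)).
Proof.
pose mu := @lebesgue_measure R.
have mphi : measurable_fun setT (fun p : R * R => 2 * pi * (p.1 * p.2)).
  by apply: measurable_funM => //; exact: measurable_funM.
split => // h [h1i h2i].
pose a s := complex.Re (h s); pose b s := complex.Im (h s).
have ai : mu.-integrable setT (EFin \o a) := h1i.
have bi : mu.-integrable setT (EFin \o b) := h2i.
pose F (w : R) := Cintegral mu (fun s => expi (2 * pi * (s * w)) * h s).
have mF : cmeas F.
  apply: (@cmeas_Cintegral _ _ _ _ _ mu (fun p : R * R => expi (2 * pi * (p.2 * p.1)) * h p.2)).
  apply: cmeasM.
    apply: (@cmeas_expi _ _ _ (fun p : R * R => 2 * pi * (p.2 * p.1))).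
    by apply: measurable_funM => //; exact: measurable_funM.
  apply: (cmeas_comp measurable_snd); exact: (Cintble_cmeas (conj h1i h2i)).
have mc (p : R -> R) (w : R) : mu.-integrable setT (EFin \o p) ->
    mu.-integrable setT (EFin \o (fun s => p s * cos (2 * pi * (w * s)))) /\
    mu.-integrable setT (EFin \o (fun s => p s * sin (2 * pi * (w * s)))).
  move=> pi_; have mp : measurable_fun setT p by have /measurable_int/measurable_EFinP := pi_.
  have mph : measurable_fun setT (fun s : R => 2 * pi * (w * s)).
    by apply: measurable_funM => //; exact: measurable_funM.
  split; apply: (le_integrable measurableT _ _ pi_).
  - apply/measurable_EFinP; apply: measurable_funM => //.
    exact: (measurableT_comp (continuous_measurable_fun (@continuous_cos R)) mph).
  - by move=> s _ /=; rewrite lee_fin normrM ler_piMr// cos_max.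
  - apply/measurable_EFinP; apply: measurable_funM => //.
    exact: (measurableT_comp (continuous_measurable_fun (@continuous_sin R)) mph).
  - by move=> s _ /=; rewrite lee_fin normrM ler_piMr// sin_max.
have FE w : F w = (cosine_transform a w - sine_transform b w) +i*
    (cosine_transform b w + sine_transform a w).
  have [ac as_] := mc a w ai; have [bc bs] := mc b w bi.
  apply/eqP; rewrite eq_complex /=; apply/andP; split; apply/eqP.
    rewrite -RintegralB//; apply: eq_Rintegral => s _.
    by rewrite ReM /= (mulrC s w) /a /b; ring.
  rewrite -RintegralD//; apply: eq_Rintegral => s _.
  by rewrite ImM /= (mulrC s w) /a /b; ring.
have cN (p : R -> R) w : cosine_transform p (- w) = cosine_transform p w.
  by apply: eq_Rintegral => s _; rewrite mulNr mulrN cosN.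
have sN (p : R -> R) w : mu.-integrable setT (EFin \o p) ->
    sine_transform p (- w) = - sine_transform p w.
  move=> pi_; rewrite -RintegralN; last by have [] := mc p w pi_.
  by apply: eq_Rintegral => s _; rewrite mulNr mulrN sinN mulrN.
have E w : nsq (F w) + nsq (F (- w)) = 2 * (power_spectrum a w + power_spectrum b w).
  rewrite !FE !cN !sN// /nsq /power_spectrum /=; ring.
have mPa := measurable_power_spectrum ai; have mPb := measurable_power_spectrum bi.
have dbl : (2%:E * N2 mu F = 2%:E * N2 mu h)%E.
  rewrite {1}mule_natl mule2n.
  have {2}-> : N2 mu F = (\int[mu]_w (nsq (F (- w)))%:E)%E.
    rewrite (@ge0_integral_reflection _ (fun w => (nsq (F w))%:E))//.
      exact: measurable_nsqE.
    by move=> w; rewrite lee_fin nsq_ge0.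
  have mFN : cmeas (fun w : measurableTypeR R => F (- w)).
    exact: (@cmeas_comp _ _ (measurableTypeR R) (measurableTypeR R) R F -%R
      (@measurable_funN _ (measurableTypeR R) R setT id (@measurable_id _ _ _)) mF).
  rewrite -ge0_integralD//; last 4 first.
  - by move=> w _; rewrite lee_fin nsq_ge0.
  - exact: measurable_nsqE.
  - by move=> w _; rewrite lee_fin nsq_ge0.
  - exact: measurable_nsqE.
  transitivity (\int[mu]_w (2%:E * ((power_spectrum a w)%:E + (power_spectrum b w)%:E)))%E.
    by apply: eq_integral => w _; rewrite -EFinD E EFinM.
  rewrite ge0_integralZl//; last 2 first.
  - by apply: emeasurable_funD; exact/measurable_EFinP.
  - by move=> w _; rewrite -EFinD lee_fin addr_ge0 ?power_spectrum_ge0.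
  congr (_ * _)%E; rewrite ge0_integralD//; last 4 first.
  - by move=> w _; rewrite lee_fin power_spectrum_ge0.
  - exact/measurable_EFinP.
  - by move=> w _; rewrite lee_fin power_spectrum_ge0.
  - exact/measurable_EFinP.
  rewrite [X in (X + _)%E](plancherel_real ai) [X in (_ + X)%E](plancherel_real bi).
  rewrite -ge0_integralD//.
  - by move=> s _; rewrite lee_fin sqr_ge0.
  - by apply/measurable_EFinP/measurable_funX; have /measurable_int/measurable_EFinP := ai.
  - by move=> s _; rewrite lee_fin sqr_ge0.
  - by apply/measurable_EFinP/measurable_funX; have /measurable_int/measurable_EFinP := bi.
have halve (x : \bar R) : (2^-1%:E * (2%:E * x) = x)%E.
  by rewrite muleA -EFinM mulVf// mul1e.
by rewrite -[LHS]halve -[RHS]halve; congr (_ * _)%E.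
Qed.

(** Phrased through integrals of nonnegative functions, so that Tonelli's theorem yields stability
    under products. *)
Definition preserves d1 d2 (X : measurableType d1) (Y : measurableType d2)
    (R : realType) (m1 : {measure set X -> \bar R}) (m2 : {measure set Y -> \bar R})
    (p : X -> Y) :=
  measurable_fun setT p /\ forall f : Y -> \bar R, measurable_fun setT f ->
    (forall y, (0 <= f y)%E) -> (\int[m1]_x f (p x) = \int[m2]_y f y)%E.

Section transport.
Context d1 d2 (X : measurableType d1) (Y : measurableType d2) (R : realType).
Variables (m1 : {measure set X -> \bar R}) (m2 : {measure set Y -> \bar R}) (p : X -> Y).
Hypothesis mp : preserves m1 m2 p.

Lemma preserves_Rintegral (f : Y -> R) : measurable_fun setT f ->
  \int[m1]_x f (p x) = \int[m2]_y f y.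
Proof.
have [pm pI] := mp; move=> mf; rewrite /Rintegral; congr fine.
have mE : measurable_fun setT (EFin \o f) by exact/measurable_EFinP.
rewrite integralE [RHS]integralE; congr (_ - _)%E.
  rewrite -(pI _ (measurable_funepos mE)) => [|y]; last exact: funepos_ge0.
  by apply: eq_integral => x _; rewrite !funeposE.
rewrite -(pI _ (measurable_funeneg mE)) => [|y]; last exact: funeneg_ge0.
by apply: eq_integral => x _; rewrite !funenegE.
Qed.

Lemma preserves_Cintegral (f : Y -> R[i]) : cmeas f ->
  Cintegral m1 (fun x => f (p x)) = Cintegral m2 f.
Proof.
move=> [m1f m2f]; rewrite /Cintegral (preserves_Rintegral m1f).
by rewrite (preserves_Rintegral m2f).
Qed.

Lemma preserves_Cintble (f : Y -> R[i]) : Cintble m2 f -> Cintble m1 (fun x => f (p x)).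
Proof.
have [pm pI] := mp; move=> /CintbleP[mf foo]; apply/CintbleP; split; first exact: cmeas_comp.
rewrite (pI (fun y => (cabs (f y))%:E))//; first exact: measurable_cabsE.
by move=> y; rewrite lee_fin cabs_ge0.
Qed.

Lemma preserves_N2 (f : Y -> R[i]) : cmeas f -> N2 m1 (fun x => f (p x)) = N2 m2 f.
Proof.
have [pm pI] := mp; move=> mf; rewrite /N2 (pI (fun y => (nsq (f y))%:E))//.
  exact: measurable_nsqE.
by move=> y; rewrite lee_fin nsq_ge0.
Qed.

End transport.

Lemma preserves_prod d1 d2 d3 d4 (X1 : measurableType d1) (Y1 : measurableType d2)
    (X2 : measurableType d3) (Y2 : measurableType d4) (R : realType)
    (m1 : {sigma_finite_measure set X1 -> \bar R})
    (n1 : {sigma_finite_measure set Y1 -> \bar R})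
    (m2 : {sigma_finite_measure set X2 -> \bar R})
    (n2 : {sigma_finite_measure set Y2 -> \bar R})
    (p : X1 -> Y1) (q : X2 -> Y2) : preserves m1 n1 p -> preserves m2 n2 q ->
  preserves (sfprod m1 m2) (sfprod n1 n2) (fun x => (p x.1, q x.2)).
Proof.
move=> [pm pI] [qm qI].
have mpq : measurable_fun setT (fun x : X1 * X2 => (p x.1, q x.2)).
  by apply: measurable_fun_pair; exact: measurableT_comp.
split => // f mf f0.
rewrite [LHS](@fubini_tonelli1 _ _ _ _ _ _ _ (fun x : X1 * X2 => f (p x.1, q x.2)))//; last first.
  exact: (measurableT_comp mf mpq).
rewrite [RHS](@fubini_tonelli1 _ _ _ _ _ _ _ f)//.
rewrite -[RHS]pI; last 2 first.
- exact: measurable_fun_fubini_tonelli_F.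
- by move=> y; apply: integral_ge0.
apply: eq_integral => x1 _; rewrite /fubini_F /=.
by rewrite (qI (fun y => f (p x1, y)))//; exact: (measurableT_comp mf (pair1_measurable _)).
Qed.

(** The pull-back of [h] by [p] has the norm of [h], and its transform is the pull-back by [q] of
    the transform of [h]. This carries the formula from R x R^n to R^(n+1). *)
Lemma fourier_pair_transfer d1 d2 d3 d4 (X : measurableType d1) (X' : measurableType d2)
    (Y : measurableType d3) (Y' : measurableType d4) (R : realType)
    (mX : {sigma_finite_measure set X -> \bar R}) (mX' : {sigma_finite_measure set X' -> \bar R})
    (mY : {sigma_finite_measure set Y -> \bar R}) (mY' : {sigma_finite_measure set Y' -> \bar R})
    (p : X' -> X) (q : Y' -> Y) (phi : X * Y -> R) :
  measurable_fun setT phi -> preserves mX' mX p -> preserves mY' mY q ->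
  fourier_pair mX' mY' (fun x => phi (p x.1, q x.2)) -> fourier_pair mX mY phi.
Proof.
move=> mphi pX pY [_ H]; split => // h hi.
have mh := Cintble_cmeas hi.
rewrite -(preserves_N2 pX mh) -(H _ (preserves_Cintble pX hi)).
have mF : cmeas (fun y => Cintegral mX (fun x => expi (phi (x, y)) * h x)).
  apply: (@cmeas_Cintegral _ _ _ _ _ mX (fun y : Y * X => expi (phi (y.2, y.1)) * h y.2)).
  apply: cmeasM; last exact: (cmeas_comp measurable_snd mh).
  apply: (@cmeas_expi _ _ _ (fun y : Y * X => phi (y.2, y.1))).
  by apply: (measurableT_comp mphi); exact: measurable_fun_pair.
rewrite -(preserves_N2 pY mF); apply: eq_integral => y _; congr (nsq _)%:E.
rewrite -(preserves_Cintegral pX)//; apply: cmeasM => //; apply: cmeas_expi.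
exact: (measurableT_comp mphi (pair2_measurable _)).
Qed.

(** * Lebesgue measure and Plancherel's formula on R^d *)

Section lebesgue_vec_integral.
Variable R : realType.
Local Notation leb := (@lebesgue_measure R).

Definition vcons n (p : measurableTypeR R * vec R n) : vec R n.+1 := [tuple of p.1 :: p.2].

Lemma preserves_vcons n :
  preserves (sfprod leb (lebesgue_vec R n)) (lebesgue_vec R n.+1) (@vcons n).
Proof.
have mc : measurable_fun setT (@vcons n) by exact: measurable_cons.
split => // f mf f0.
by rewrite [RHS](@ge0_integral_pushforward _ _ _ _ _ _ mc (sfprod leb (lebesgue_vec R n)))//
  preimage_setT.
Qed.

Lemma integral_lebesgue_vec0 (f : vec R 0 -> \bar R) : measurable_fun setT f ->
  (\int[lebesgue_vec R 0]_t f t = f [tuple of [::]])%E.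
Proof.
move=> mf; rewrite (eq_measure_integral (\d_[tuple of [::]] : measure (vec R 0) R))//.
by rewrite integral_dirac// diracT mul1e.
Qed.

Definition vmap n (p : 'I_n -> measurableTypeR R -> measurableTypeR R) (t : vec R n) : vec R n :=
  [tuple p i (tnth t i) | i < n].

Lemma measurable_vmap n (p : 'I_n -> measurableTypeR R -> measurableTypeR R) :
  (forall i, measurable_fun setT (p i)) -> measurable_fun setT (vmap p).
Proof.
move=> mp; apply/measurable_fun_tnthP => i.
rewrite (_ : _ \o _ = fun t => p i (tnth t i)); last first.
  by apply/funext => t /=; rewrite tnth_mktuple.
exact: (measurableT_comp (mp i) (measurable_tnth i)).
Qed.

(** Translations and reflections of R^n act coordinate by coordinate, so this one induction, which
    splits off the first coordinate, handles them all. *)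
Lemma preserves_vmap n (p : 'I_n -> measurableTypeR R -> measurableTypeR R) :
  (forall i, preserves leb leb (p i)) ->
  preserves (lebesgue_vec R n) (lebesgue_vec R n) (vmap p).
Proof.
move=> pp; have mp i : measurable_fun setT (p i) by have [] := pp i.
split; first exact: measurable_vmap.
elim: n p pp mp => [|n IH] p pp mp f mf f0.
  by apply: eq_integral => t _; rewrite [vmap p t]tuple0 [t]tuple0.
have [mc cI] := preserves_vcons n.
pose p' (i : 'I_n) := p (lift ord0 i).
have tc (x : measurableTypeR R * vec R n) : vmap p (vcons x) =
    vcons (p ord0 x.1, vmap p' x.2).
  apply: eq_from_tnth => i; rewrite tnth_mktuple.
  have [j ->|->] := unliftP ord0 i; last by rewrite !tnth0.
  by rewrite /vcons !tnthS tnth_mktuple.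
have pv : preserves (lebesgue_vec R n) (lebesgue_vec R n) (vmap p').
  by split; [apply: measurable_vmap => i; exact: mp | apply: IH => i; [exact: pp | exact: mp]].
have [_ pI] := preserves_prod (pp ord0) pv.
rewrite -[LHS]cI//; last exact: (measurableT_comp mf (measurable_vmap mp)).
under eq_integral do rewrite tc.
rewrite (pI (fun x => f (vcons x)))//; first exact: cI.
exact: (measurableT_comp mf mc).
Qed.

Definition vsub n (t x : vec R n) : vec R n := [tuple tnth t i - tnth x i | i < n].

Definition vadd n (t x : vec R n) : vec R n := [tuple tnth t i + tnth x i | i < n].

Lemma vaddK n (t x : vec R n) : vadd (vsub t x) x = t.
Proof. by apply: eq_from_tnth => i; rewrite !tnth_mktuple subrK. Qed.

Lemma measurable_vsub n : measurable_fun setT (fun p : vec R n * vec R n => vsub p.1 p.2).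
Proof.
apply/measurable_fun_tnthP => i.
rewrite (_ : _ \o _ = fun p : vec R n * vec R n => tnth p.1 i - tnth p.2 i); last first.
  by apply/funext => t /=; rewrite tnth_mktuple.
apply: measurable_funB.
  exact: (measurableT_comp (measurable_tnth i) measurable_fst).
exact: (measurableT_comp (measurable_tnth i) measurable_snd).
Qed.

Lemma preserves_vadd n (x : vec R n) :
  preserves (lebesgue_vec R n) (lebesgue_vec R n) (fun t => vadd t x).
Proof.
apply: (preserves_vmap (p := fun i s => s + tnth x i)) => i; split.
  exact: measurable_funD.
by move=> g mg g0; exact: ge0_integral_translation.
Qed.

Lemma preserves_vsub n (x : vec R n) :
  preserves (lebesgue_vec R n) (lebesgue_vec R n) (fun t => vsub t x).
Proof.
apply: (preserves_vmap (p := fun i s => s - tnth x i)) => i; split.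
  exact: measurable_funB.
by move=> g mg g0; exact: ge0_integral_translation.
Qed.

(** In each coordinate, s -> c - s is a reflection followed by a translation. *)
Lemma preserves_vsubl n (t : vec R n) :
  preserves (lebesgue_vec R n) (lebesgue_vec R n) (vsub t).
Proof.
apply: (preserves_vmap (p := fun i s => tnth t i - s)) => i; split.
  exact: measurable_funB.
move=> g mg g0; rewrite -[RHS](ge0_integral_translation (tnth t i))//.
rewrite -[RHS]ge0_integral_reflection//; first by apply: eq_integral => s _; rewrite addrC.
apply: (@measurableT_comp _ _ _ (measurableTypeR R) (measurableTypeR R)) => //.
exact: measurable_funD.
Qed.

Lemma measurable_dotv n : measurable_fun setT (fun p : vec R n * vec R n => dotv p.1 p.2).
Proof.
apply: measurable_sum => i; apply: measurable_funM.
  exact: (measurableT_comp (measurable_tnth i) measurable_fst).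
exact: (measurableT_comp (measurable_tnth i) measurable_snd).
Qed.

(** In dimension 0 the measure is a point mass and the phase is 0. Each further coordinate adds one
    term to the inner product, hence one factor to the pair. *)
Lemma fourier_pair_vec n : fourier_pair (lebesgue_vec R n) (lebesgue_vec R n)
  (fun p => 2 * pi * dotv p.1 p.2).
Proof.
elim: n => [|n IH].
  have mphi : measurable_fun setT (fun p : vec R 0 * vec R 0 => 2 * pi * dotv p.1 p.2).
    by apply: measurable_funM => //; exact: measurable_dotv.
  split => // h hi; have mh := Cintble_cmeas hi.
  have E (t : vec R 0) : Cintegral (lebesgue_vec R 0)
      (fun x => expi (2 * pi * dotv x t) * h x) = h [tuple of [::]].
    have [m1h m2h] := mh.
    rewrite (_ : Cintegral _ _ = Cintegral (lebesgue_vec R 0) h); last first.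
      by apply: eq_Cintegral => x; rewrite /dotv big_ord0 mulr0 expi0 mul1r.
    rewrite /Cintegral /Rintegral !integral_lebesgue_vec0 /=; last 2 first.
    - exact/measurable_EFinP.
    - exact/measurable_EFinP.
    by case: (h _).
  rewrite /N2; apply: eq_integral => t _ /=; rewrite E; congr (nsq (h _))%:E.
  by rewrite [t]tuple0.
apply: fourier_pair_transfer (preserves_vcons n) (preserves_vcons n) _.
  by apply: measurable_funM => //; exact: measurable_dotv.
have := fourier_pair_prod (fourier_pair_line R) IH.
congr fourier_pair; apply/funext => p /=.
rewrite -mulrDr; congr (_ * _); rewrite /dotv big_ord_recl !tnth0; congr (_ + _).
by apply: eq_bigr => i _; rewrite !tnthS.
Qed.

End lebesgue_vec_integral.

(** * Kernels of Hilbert-Schmidt operators *)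

Section integral_kernels.
Context d (T : measurableType d) (R : realType).
Variable mu : {sigma_finite_measure set T -> \bar R}.
Local Notation nu := (sfprod mu mu).
Implicit Types (k : T * T -> R[i]) (f g : T -> R[i]).

(** Kernels are sectioned at a fixed second variable, whereas [Cintegral_sfprod] has the second
    variable inside. *)
Lemma preserves_swap : preserves nu nu (fun p => (p.2, p.1)).
Proof.
have ms : measurable_fun setT (fun p : T * T => (p.2, p.1)) by exact: measurable_fun_pair.
split => // f mf f0.
rewrite [RHS](@fubini_tonelli1 _ _ _ _ _ _ _ f)//.
by rewrite [LHS](@fubini_tonelli2 _ _ _ _ _ _ _ (fun p : T * T => f (p.2, p.1)))//;
  exact: (measurableT_comp mf ms).
Qed.

(** The kernel of the rank-one operator h -> <h, f> g. *)
Definition tensor g f (p : T * T) : R[i] := g p.1 * conjc (f p.2).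

Lemma cmeas_tensor g f : cmeas g -> cmeas f -> cmeas (tensor g f).
Proof.
move=> mg mf; apply: cmeasM; first exact: (cmeas_comp measurable_fst mg).
by apply: cmeas_conj; exact: (cmeas_comp measurable_snd mf).
Qed.

Lemma N2_tensor g f : cmeas g -> cmeas f -> (N2 mu f < +oo)%E ->
  N2 nu (tensor g f) = (N2 mu g * N2 mu f)%E.
Proof.
move=> mg mf foo; rewrite N2_sfprod; last exact: cmeas_tensor.
have fE : N2 mu f = (n2 mu f)%:E by rewrite /n2 fineK// ge0_fin_numE// N2_ge0.
have E x : N2 mu (fun y => tensor g f (x, y)) = (n2 mu f * nsq (g x))%:E.
  rewrite /tensor/= N2Z; last exact: cmeas_conj.
  rewrite (_ : N2 mu (fun y => conjc (f y)) = N2 mu f); last first.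
    by apply: eq_integral => y _; rewrite nsq_conj.
  by rewrite fE -EFinM mulrC.
under eq_integral do rewrite E EFinM.
rewrite ge0_integralZl//; first by rewrite fE muleC.
- exact: measurable_nsqE.
- by move=> x _; rewrite lee_fin nsq_ge0.
- by rewrite lee_fin n2_ge0.
Qed.

Lemma L2_tensor g f : L2 mu g -> L2 mu f -> L2 nu (tensor g f).
Proof.
move=> /L2P[mg goo] /L2P[mf foo]; apply/L2P; split; first exact: cmeas_tensor.
rewrite N2_tensor// lte_mul_pinfty ?N2_ge0//.
by rewrite ge0_fin_numE ?N2_ge0.
Qed.

Lemma dot_tensor a b g f : L2 mu a -> L2 mu b -> L2 mu g -> L2 mu f ->
  L2dot nu (tensor a b) (tensor g f) = L2dot mu a g * conjc (L2dot mu b f).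
Proof.
move=> La Lb Lg Lf.
have [_ _ E] := Cintegral_sfprod (L2_Cintble (L2_tensor La Lb) (L2_tensor Lg Lf)).
rewrite /L2dot E mulrC -CintegralZ; last exact: L2_Cintble.
apply: eq_Cintegral => x; rewrite mulrC -Cintegral_conj; last exact: L2_Cintble.
rewrite -CintegralZ; last by apply: Cintble_conj; exact: L2_Cintble.
by apply: eq_Cintegral => y; rewrite /tensor/= !conjcM; ring.
Qed.

Section kernel.
Variable k : T * T -> R[i].
Hypothesis Lk : L2 nu k.

Let mk : cmeas k. Proof. exact: L2_cmeas Lk. Qed.

Lemma N2_sections : N2 nu k = (\int[mu]_t N2 mu (fun s => k (s, t)))%E.
Proof.
apply: fubini_tonelli2; first exact: measurable_nsqE.
by move=> p; rewrite lee_fin nsq_ge0.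
Qed.

Lemma measurable_N2_sections : measurable_fun setT (fun t => N2 mu (fun s => k (s, t))).
Proof.
apply: (@measurable_fun_fubini_tonelli_G _ _ _ _ _ mu (fun p => (nsq (k p))%:E)).
  exact: measurable_nsqE.
by move=> p; rewrite lee_fin nsq_ge0.
Qed.

Lemma ae_L2_sections : {ae mu, forall t, L2 mu (fun s => k (s, t))}.
Proof.
have i : mu.-integrable setT (fun t => N2 mu (fun s => k (s, t))).
  apply/integrableP; split; first exact: measurable_N2_sections.
  under eq_integral do rewrite gee0_abs ?N2_ge0//.
  by rewrite -N2_sections; have [] := (L2P _ _).1 Lk.
apply: filterS (integrable_ae measurableT i) => t /(_ Logic.I) kt.
apply/L2P; split; first exact: cmeas_pair2.
by rewrite -ge0_fin_numE ?N2_ge0.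
Qed.

(** The adjoint of the integral operator with kernel [k]. For g in L^2 its value is meaningful at
    those t whose section is in L^2, that is at almost every t. *)
Definition kernel_adjoint g : T -> R[i] := fun t => L2dot mu g (fun s => k (s, t)).

Lemma cmeas_kernel_adjoint g : cmeas g -> cmeas (kernel_adjoint g).
Proof.
move=> mg; apply: (@cmeas_Cintegral _ _ _ _ _ mu (fun p : T * T => g p.2 * conjc (k (p.2, p.1)))).
apply: cmeasM; first exact: (cmeas_comp measurable_snd mg).
apply: cmeas_conj; apply: (@cmeas_comp _ _ _ _ _ k (fun p : T * T => (p.2, p.1))) => //.
exact: measurable_fun_pair.
Qed.

(** The Cauchy-Schwarz inequality in almost every section, integrated over t. *)
Lemma N2_kernel_adjoint_le g : L2 mu g ->
  (N2 mu (kernel_adjoint g) <= (n2 mu g)%:E * N2 nu k)%E.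
Proof.
move=> Lg; rewrite N2_sections -ge0_integralZl//; last 3 first.
- exact: measurable_N2_sections.
- by move=> t _; exact: N2_ge0.
- by rewrite lee_fin n2_ge0.
apply: ae_ge0_le_integral => //.
- by move=> t _; rewrite lee_fin nsq_ge0.
- by apply: measurable_nsqE; exact: cmeas_kernel_adjoint (L2_cmeas Lg).
- by move=> t _; rewrite mule_ge0 ?N2_ge0// lee_fin n2_ge0.
- by apply: measurable_funeM; exact: measurable_N2_sections.
- apply: filterS ae_L2_sections => t Lt _.
  by rewrite -(n2E Lt) -EFinM lee_fin; exact: cauchy_schwarz.
Qed.

Lemma L2_kernel_adjoint g : L2 mu g -> L2 mu (kernel_adjoint g).
Proof.
move=> Lg; apply/L2P; split; first exact: cmeas_kernel_adjoint (L2_cmeas Lg).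
apply: le_lt_trans (N2_kernel_adjoint_le Lg) _.
by rewrite -(n2E Lk) -EFinM ltry.
Qed.

Lemma n2_kernel_adjoint_le g : L2 mu g ->
  n2 mu (kernel_adjoint g) <= n2 mu g * n2 nu k.
Proof.
move=> Lg; rewrite -lee_fin n2E; last exact: L2_kernel_adjoint.
by rewrite EFinM (n2E Lk); exact: N2_kernel_adjoint_le.
Qed.

Lemma kernel_adjoint_lin (a : R[i]) f g : L2 mu f -> L2 mu g ->
  kernel_adjoint (fun t => a * f t + g t) =
  (fun t => a * kernel_adjoint f t + kernel_adjoint g t) %[ae mu].
Proof.
by move=> Lf Lg; apply: filterS ae_L2_sections => t Lt _; exact: dot_linl.
Qed.

Lemma kernel_adjoint_ae f g : L2 mu f -> L2 mu g -> f = g %[ae mu] ->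
  kernel_adjoint f = kernel_adjoint g %[ae mu].
Proof.
by move=> Lf Lg fg; apply: filterS ae_L2_sections => t Lt _; exact: ae_eq_dotl.
Qed.

Lemma dot_kernel_adjoint f g : L2 mu f -> L2 mu g ->
  L2dot mu f (kernel_adjoint g) = L2dot nu k (tensor g f).
Proof.
move=> Lf Lg; have mg := L2_cmeas Lg; have mf := L2_cmeas Lf.
have ki := L2_Cintble Lk (L2_tensor Lg Lf).
rewrite /(L2dot nu) -(preserves_Cintegral preserves_swap (Cintble_cmeas ki)).
have [_ hi ->] := Cintegral_sfprod (preserves_Cintble preserves_swap ki).
apply: ae_eq_Cintegral.
- apply: cmeasM => //; apply: cmeas_conj; exact: cmeas_kernel_adjoint.
- exact: Cintble_cmeas hi.
- apply: filterS ae_L2_sections => t Lt _.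
  have -> : conjc (kernel_adjoint g t) = L2dot mu (fun s => k (s, t)) g.
    by rewrite /kernel_adjoint (dot_conj Lt Lg) conjcK.
  rewrite /L2dot -CintegralZ; last exact: L2_Cintble.
  by apply: eq_Cintegral => s; rewrite /tensor/= conjcM conjcK; ring.
Qed.

(** At fixed t, Parseval's identity sums the terms to the squared norm of the section. The result
    does not involve the basis, and the independence of the trace from the basis rests on this. *)
Lemma series_N2_kernel_adjoint (e : nat -> T -> R[i]) : (forall n, L2 mu (e n)) ->
  (forall m n, L2dot mu (e m) (e n) = (m == n)%:R) ->
  (forall f, L2 mu f -> (forall n, L2dot mu f (e n) = 0) -> f = (fun=> 0) %[ae mu]) ->
  (\sum_(0 <= n <oo) N2 mu (kernel_adjoint (e n)))%E = N2 nu k.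
Proof.
move=> Le oe te; have mn n : measurable_fun setT (fun t => (nsq (kernel_adjoint (e n) t))%:E).
  by apply: measurable_nsqE; exact: cmeas_kernel_adjoint (L2_cmeas (Le n)).
have n0 n t : (0 <= (nsq (kernel_adjoint (e n) t))%:E)%E by rewrite lee_fin nsq_ge0.
rewrite /N2 -integral_nneseries// -/(N2 nu k) N2_sections.
apply: ae_eq_integral => //.
- by apply: ge0_emeasurable_sum => // n t _ _; exact: n0.
- exact: measurable_N2_sections.
- apply: filterS ae_L2_sections => t Lt _.
  rewrite -(parseval Le oe te Lt); apply: eq_eseriesr => n _.
  by rewrite /kernel_adjoint (dot_conj Lt (Le n)) nsq_conj.
Qed.

End kernel.

End integral_kernels.

Section complex_convergence.
Variable R : realType.

Lemma cvg_complex (u : nat -> R[i]) (l : R[i]) :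
  nsq (l - u n) @[n --> \oo] --> (0 : R) ->
  (u n : (R[i] : numFieldType)) @[n --> \oo] --> (l : (R[i] : numFieldType)).
Proof.
(* A positive element of [R[i]] has zero imaginary part, so real tolerances suffice. *)
move=> H; apply/cvgrPdist_lt => eps; rewrite ltcE /= => /andP[/eqP eI eR].
have {eI}-> : eps = (complex.Re eps)%:C by case: eps eI eR => a b /= -> _.
set e := complex.Re eps in eR *.
have e2 : 0 < e ^+ 2 by rewrite exprn_gt0.
have /cvgrPdist_lt/(_ _ e2) := H; apply: filterS => n.
rewrite sub0r normrN ger0_norm ?nsq_ge0// => nlt.
rewrite -ltr_sqr ?nnegrE ?normr_ge0//; last by rewrite lecR ltW.
by rewrite sqr_normc mul_conjc -rmorphXn ltcR.
Qed.

Lemma cvg_real_complex (r : nat -> R) (l : R) : r n @[n --> \oo] --> l ->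
  ((r n)%:C : (R[i] : numFieldType)) @[n --> \oo] --> (l%:C : (R[i] : numFieldType)).
Proof.
move=> H; apply: cvg_complex.
have -> : (fun n => nsq (l%:C - (r n)%:C)) = (fun n => (l - r n) * (l - r n)).
  by apply/funext => n; rewrite /nsq/= subr0 expr0n addr0 expr2.
rewrite -[X in _ --> X](mul0r (0 : R)).
by apply: cvgM; rewrite -(subrr l); apply: cvgB => //; exact: cvg_cst.
Qed.

Lemma cvg_polarization (K : numFieldType) (s t f g : nat -> K) (a b c e : K) i :
  s n @[n --> \oo] --> a -> t n @[n --> \oo] --> b ->
  f n @[n --> \oo] --> c -> g n @[n --> \oo] --> e ->
  ((s n - f n - g n) - i * (t n - f n - g n)) / 2 @[n --> \oo] -->
  ((a - c - e) - i * (b - c - e)) / 2.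
Proof.
move=> sa tb fc ge; apply: cvgM; last exact: cvg_cst.
apply: cvgB; first exact: cvgB (cvgB sa fc) ge.
by apply: cvgM; [exact: cvg_cst|exact: cvgB (cvgB tb fc) ge].
Qed.

End complex_convergence.

(** * Kernels, adjoints and traces of Hilbert-Schmidt operators *)

Section kernel_operators.
Context (R : realType) (d : nat).
Local Notation mu := (lebesgue_vec R d).
Local Notation nu := (sfprod (lebesgue_vec R d) (lebesgue_vec R d)).
Local Notation op := ((vec R d -> R[i]) -> (vec R d -> R[i])).
Implicit Types (A S T : op) (k : vec R d * vec R d -> R[i]) (f g : vec R d -> R[i]).

Lemma L2norm_sqrt f : L2 mu f -> L2norm mu f = (Num.sqrt (n2 mu f))%:E.
Proof.
move=> Lf; have [_ _ foo] := Lf; have := n2E Lf; rewrite -L2norm_sqr.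
have : (0 <= L2norm mu f)%E by exact: Lnorm_ge0.
case: (L2norm mu f) foo => // r _; rewrite lee_fin => r0 [->].
by rewrite -[r * r]expr2 sqrtr_sqr ger0_norm.
Qed.

Lemma bounded_operator_n2 A : bounded_operator A ->
  exists2 M : R, 0 <= M & forall f, L2 mu f -> n2 mu (A f) <= M * n2 mu f.
Proof.
move=> bA; have [M HM] := bop_bounded bA; exists (M ^+ 2); first exact: sqr_ge0.
move=> f Lf; have := HM f Lf; rewrite !L2norm_sqrt//; last exact: bop_L2.
rewrite -EFinM lee_fin => H.
rewrite -(sqr_sqrtr (n2_ge0 mu (A f))) -[X in _ * X](sqr_sqrtr (n2_ge0 mu f)) -exprMn.
by apply: lerXn2r => //; rewrite nnegrE ?sqrtr_ge0//; apply: le_trans H; exact: sqrtr_ge0.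
Qed.

Lemma bounded_operator_kernel_adjoint k : L2 nu k -> bounded_operator (kernel_adjoint mu k).
Proof.
move=> Lk; split.
- by move=> f; exact: L2_kernel_adjoint.
- by move=> f g; exact: kernel_adjoint_ae.
- by move=> a f g; exact: kernel_adjoint_lin.
- exists (Num.sqrt (n2 nu k)) => f Lf; rewrite !L2norm_sqrt//; last exact: L2_kernel_adjoint.
  rewrite -EFinM lee_fin -sqrtrM ?n2_ge0// ler_wsqrtr// mulrC.
  exact: n2_kernel_adjoint_le.
Qed.

(** A weak formulation, tested against rank-one kernels: the values of [A f] at points never
    enter. *)
Definition kernel_of A k := L2 nu k /\ forall f g, L2 mu f -> L2 mu g ->
  L2dot mu (A f) g = L2dot nu k (tensor g f).

(** The rank-one kernels built from A e_n and e_n are orthogonal with squared norms ||A e_n||^2, so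
    their series converges in L^2. Its n-th partial sum reproduces A on the n-th Fourier sum of f,
    and the boundedness of A allows the passage to the limit. *)
Lemma hilbert_schmidt_kernel A : hilbert_schmidt A -> exists k, kernel_of A k.
Proof.
move=> [bA [e [Le oe te] eoo]].
have LA f : L2 mu f -> L2 mu (A f) by exact: bop_L2.
pose u n := tensor (A (e n)) (e n).
have Lu n : L2 nu (u n) by apply: L2_tensor => //; exact: LA.
have nu_ n : n2 nu (u n) = n2 mu (A (e n)).
  apply: complexI; rewrite -!dot_n2//; last exact: LA.
  by rewrite dot_tensor// ?oe ?eqxx ?rmorph1 ?mulr1//; exact: LA.
have ou i j : i != j -> L2dot nu (u i) (u j) = 0.
  move=> ij; rewrite dot_tensor//; [|exact: LA|exact: LA].
  by rewrite oe (negbTE ij) rmorph0 mulr0.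
have bu n : \sum_(0 <= i < n) n2 nu (u i) <= fine (\sum_(0 <= n <oo) L2norm mu (A (e n)) ^+ 2)%E.
  have n0 i : (0 <= L2norm mu (A (e i)) ^+ 2)%E by rewrite L2norm_sqr N2_ge0.
  rewrite -lee_fin fineK; last by rewrite ge0_fin_numE// nneseries_ge0.
  apply: le_trans (nneseries_lim_ge n _); last by [].
  rewrite -sumEFin; apply: lee_sum => i _.
  by rewrite L2norm_sqr nu_ n2E//; exact: LA.
have [k Lk kc] := orthogonal_series_cvg Lu ou bu.
exists k; split => // f g Lf Lg.
have [M M0 HM] := bounded_operator_n2 bA.
pose kn n p := \sum_(0 <= i < n) u i p.
have Lkn n : L2 nu (kn n) by exact: L2_sum.
have Lg_f := L2_tensor Lg Lf.
have Afs n : A (fourier_sum mu e f n) =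
    (fun t => \sum_(0 <= i < n) L2dot mu f (e i) * A (e i) t) %[ae mu].
  elim: n => [|n IH].
    have z : L2 mu (fun=> 0) by exact: L20.
    (* Linearity with coefficient -1 at the zero function gives A 0 = - A 0 + A 0 = 0 almost
       everywhere. *)
    have := bop_linear bA (-1) z z.
    rewrite (_ : (fun=> -1 * 0 + 0) = fourier_sum mu e f 0); last first.
      by apply/funext => t; rewrite /fourier_sum big_geq// mulr0 addr0.
    apply: filterS => t /(_ Logic.I) -> _.
    by rewrite big_geq// mulN1r addNr.
  have := bop_linear bA (L2dot mu f (e n)) (Le n) (L2_fourier_sum Le f n).
  rewrite (_ : (fun t => L2dot mu f (e n) * e n t + fourier_sum mu e f n t) =
      fourier_sum mu e f n.+1); last first.
    by apply/funext => t; rewrite /fourier_sum big_nat_recr//= addrC.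
  apply: filterS2 IH => t H1 H2 _; rewrite (H2 Logic.I) (H1 Logic.I).
  by rewrite big_nat_recr//= addrC.
have E n : L2dot mu (A (fourier_sum mu e f n)) g = L2dot nu (kn n) (tensor g f).
  have Lfs := L2_fourier_sum Le f n.
  have Lt i : L2 mu (fun t => L2dot mu f (e i) * A (e i) t) by apply: L2Z; exact: LA.
  rewrite (ae_eq_dotl _ _ _ (Afs n))//; [|exact: LA|exact: L2_sum].
  rewrite (dot_suml _ _ Lt)// /kn (dot_suml _ _ Lu)//; apply: eq_bigr => i _.
  rewrite dotZl ?dot_tensor//; [|exact: LA|exact: LA].
  by rewrite (dot_conj Lf (Le i)) conjcK mulrC.
apply/eqP; rewrite -subr_eq0; apply/eqP.
(* The two summands are the errors of truncating f and of truncating the kernel; the outer factors 2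
   come from [nsqB_le]. *)
pose r n := 2 * (M * n2 mu (fun t => f t - fourier_sum mu e f n t) * n2 mu g) +
  2 * (n2 nu (fun p => k p - kn n p) * n2 nu (tensor g f)).
apply: (@nsq_le_cvg0 _ _ r 0%N).
  move=> n _; have Lfs := L2_fourier_sum Le f n.
  have Ld : L2 mu (fun t => f t - fourier_sum mu e f n t) by exact: L2B.
  have Lkd : L2 nu (fun p => k p - kn n p) by exact: L2B.
  have -> : L2dot mu (A f) g - L2dot nu k (tensor g f) =
      (L2dot mu (A f) g - L2dot mu (A (fourier_sum mu e f n)) g) -
      (L2dot nu k (tensor g f) - L2dot nu (kn n) (tensor g f)).
    by rewrite E; ring.
  apply: le_trans (nsqB_le _ _) _; apply: lerD; apply: ler_wpM2l => //; last first.
    by rewrite -dotBl//; exact: cauchy_schwarz.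
  have Ad : A (fun t => f t - fourier_sum mu e f n t) =
      (fun t => A f t - A (fourier_sum mu e f n) t) %[ae mu].
    have := bop_linear bA (-1) Lfs Lf.
    rewrite (_ : (fun t => -1 * fourier_sum mu e f n t + f t) =
        (fun t => f t - fourier_sum mu e f n t)); last first.
      by apply/funext => t; rewrite mulN1r addrC.
    by apply: filterS => t /(_ Logic.I) -> _; rewrite mulN1r addrC.
  rewrite -dotBl//; [|exact: LA|exact: LA].
  rewrite -(ae_eq_dotl _ _ _ Ad)//; [|exact: LA|by apply: L2B; exact: LA].
  apply: le_trans (cauchy_schwarz _ _) _ => //; first exact: LA.
  by apply: ler_wpM2r; [exact: n2_ge0|exact: HM].
rewrite -[X in _ --> X](_ : 2 * (M * 0 * n2 mu g) + 2 * (0 * n2 nu (tensor g f)) = 0); last by ring.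
apply: cvgD; apply: cvgM; try exact: cvg_cst; apply: cvgM; try exact: cvg_cst.
  by apply: cvgM; [exact: cvg_cst|exact: fourier_sum_cvg].
exact: kc.
Qed.

(** The witness [B] guarantees that the choice by [xget] has the defining property. The images of g
    under two such operators differ by a function orthogonal to itself. *)
Lemma adjoint_spec A B : bounded_operator B ->
  (forall f g, L2 mu f -> L2 mu g -> L2dot mu (A f) g = L2dot mu f (B g)) ->
  bounded_operator (adjoint A) /\
  forall g, L2 mu g -> adjoint A g = B g %[ae mu].
Proof.
move=> bB HB; have [bA HA] : [set B | bounded_operator B /\
    forall f g, L2 mu f -> L2 mu g -> L2dot mu (A f) g = L2dot mu f (B g)] (adjoint A).
  by apply: xgetPex; exists B.
split => // g Lg; have LBg := bop_L2 bB Lg; have LAg := bop_L2 bA Lg.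
have Ld := L2B LAg LBg; have := n2_eq0 Ld.
have : n2 mu (fun t => adjoint A g t - B g t) = 0.
  apply: complexI; rewrite -dot_n2// [in RHS]rmorph0 (dot_conj Ld Ld) dotBl//.
  by rewrite (dot_conj Ld LAg) (dot_conj Ld LBg) -HA// -HB// subrr rmorph0.
move=> n0 /(_ n0); apply: filterS => t H _; apply/eqP; rewrite -subr_eq0.
by rewrite (H Logic.I).
Qed.

Lemma adjoint_kernel A k : kernel_of A k ->
  bounded_operator (adjoint A) /\
  forall g, L2 mu g -> adjoint A g = kernel_adjoint mu k g %[ae mu].
Proof.
move=> [Lk Ak]; apply: adjoint_spec; first exact: bounded_operator_kernel_adjoint.
by move=> f g Lf Lg; rewrite Ak// dot_kernel_adjoint.
Qed.

Section trace.
Variables (e : nat -> vec R d -> R[i]) (be : orthonormal_basis e).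

Let Le n : L2 mu (e n). Proof. exact: onb_L2. Qed.

(** The partial sums of the trace of S T^*, as a form in the kernels [k] of S and [l] of T. *)
Definition trace_form N k l := \sum_(0 <= n < N)
  L2dot nu k (tensor (e n) (kernel_adjoint mu l (e n))).

Lemma dot_kernel_adjoints k l n : L2 nu k -> L2 nu l ->
  L2dot nu k (tensor (e n) (kernel_adjoint mu l (e n))) =
  L2dot mu (kernel_adjoint mu l (e n)) (kernel_adjoint mu k (e n)).
Proof. by move=> Lk Ll; rewrite dot_kernel_adjoint//; exact: L2_kernel_adjoint. Qed.

Lemma sesquilinear_trace_form N : sesquilinear (L2 nu) (trace_form N).
Proof.
have Lt k n : L2 nu k -> L2 nu (tensor (e n) (kernel_adjoint mu k (e n))).
  by move=> Lk; apply: L2_tensor => //; exact: L2_kernel_adjoint.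
have sw k l n : L2 nu k -> L2 nu l ->
    L2dot nu k (tensor (e n) (kernel_adjoint mu l (e n))) =
    conjc (L2dot nu l (tensor (e n) (kernel_adjoint mu k (e n)))).
  move=> Lk Ll; rewrite !dot_kernel_adjoints//.
  exact: (dot_conj (L2_kernel_adjoint Lk (Le n)) (L2_kernel_adjoint Ll (Le n))).
move=> a k l h Lk Ll Lh; have Lakl : L2 nu (fun p => a * k p + l p) by exact: L2_lin.
split; rewrite /trace_form mulr_sumr -big_split; apply: eq_bigr => n _ /=.
  by rewrite dot_linl//; exact: Lt.
rewrite (sw h)// dot_linl//; last exact: Lt.
by rewrite conjcD conjcM -!sw.
Qed.

Lemma trace_form_diag k : L2 nu k ->
  (trace_form N k k : (R[i] : numFieldType)) @[N --> \oo] -->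
    (L2dot nu k k : (R[i] : numFieldType)).
Proof.
move=> Lk; have LB n : L2 mu (kernel_adjoint mu k (e n)) by exact: L2_kernel_adjoint.
rewrite dot_n2//.
have -> : (fun N => trace_form N k k) =
    (fun N => (\sum_(0 <= n < N) n2 mu (kernel_adjoint mu k (e n)))%:C).
  apply/funext => N; rewrite rmorph_sum; apply: eq_bigr => n _.
  by rewrite dot_kernel_adjoints// dot_n2.
apply: cvg_real_complex.
have c := @is_cvg_nneseries R (fun n => N2 mu (kernel_adjoint mu k (e n))) xpredT 0
  (fun n _ _ => N2_ge0 mu (kernel_adjoint mu k (e n))).
rewrite (series_N2_kernel_adjoint Lk Le (onb_orthonormal be) (onb_total be)) in c.
rewrite -(n2E Lk) in c; have c' := @fine_cvg _ _ _ _ _ _ c.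
have -> : (fun N => \sum_(0 <= n < N) n2 mu (kernel_adjoint mu k (e n))) =
    fine \o (fun N => \sum_(0 <= n < N) N2 mu (kernel_adjoint mu k (e n)))%E.
  by apply/funext => N /=; under [in RHS]eq_bigr do rewrite -n2E//; rewrite sumEFin.
exact: c'.
Qed.

(** Polarisation expresses both the partial sums and the limit through diagonal values, to which
    [trace_form_diag] applies. *)
Lemma trace_form_cvg k l : L2 nu k -> L2 nu l ->
  (trace_form N k l : (R[i] : numFieldType)) @[N --> \oo] -->
    (L2dot nu k l : (R[i] : numFieldType)).
Proof.
move=> Lk Ll; pose P := L2 nu.
have Plin (a : R[i]) (f g : vec R d * vec R d -> R[i]) :
  P f -> P g -> P (fun x => a * f x + g x) by exact: L2_lin.
rewrite (polarization Plin (@sesquilinear_dot _ _ _ nu) Lk Ll).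
under eq_fun do rewrite (polarization Plin (@sesquilinear_trace_form _) Lk Ll).
have c h : P h -> (trace_form N h h : (R[i] : numFieldType)) @[N --> \oo] -->
    (L2dot nu h h : (R[i] : numFieldType)) by exact: trace_form_diag.
exact: (cvg_polarization (K := (R[i] : numFieldType)) (c _ (Plin 1 _ _ Lk Ll))
  (c _ (Plin 'i _ _ Lk Ll)) (c _ Lk) (c _ Ll)).
Qed.

End trace.

(** In every basis the trace series tends to the inner product of the kernels, so this number lies
    in the set from which [op_trace] chooses. One existing basis makes it the only element, by
    uniqueness of limits. *)
Lemma HSdot_kernel S T kS kT : (exists e : nat -> vec R d -> R[i], orthonormal_basis e) ->
  kernel_of S kS -> kernel_of T kT -> HSdot S T = L2dot nu kS kT.
Proof.
move=> [e0 be0] [LkS HS] kTT; have [LkT _] := kTT.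
have [baT aT] := adjoint_kernel kTT.
have cvgT e : orthonormal_basis e ->
    series (fun n => L2dot mu ((S \o adjoint T) (e n)) (e n) : (R[i] : numFieldType)) @ \oo
      --> (L2dot nu kS kT : (R[i] : numFieldType)).
  move=> be; have := trace_form_cvg be LkS LkT.
  rewrite (_ : (fun N => trace_form e N kS kT) =
    series (fun n => L2dot mu ((S \o adjoint T) (e n)) (e n)))//.
  apply/funext => N; apply: eq_bigr => n _ /=; have Le := onb_L2 be n.
  have LaT := bop_L2 baT Le; have LB := L2_kernel_adjoint LkT Le.
  rewrite HS// -!dot_kernel_adjoint//.
  exact/esym/(ae_eq_dotl LaT LB (L2_kernel_adjoint LkS Le))/(aT _ Le).
apply: xget_unique => [//|t Ht].
have h : hausdorff_space (R[i] : numFieldType) by exact: (@norm_hausdorff _ (R[i] : numFieldType)^o).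
exact: (cvg_unique h (Ht _ be0) (cvgT _ be0)).
Qed.

End kernel_operators.

(** * Time-frequency shifts and the norm of the Cohen class *)

Section time_frequency_shifts.
Context (R : realType) (d : nat).
Local Notation mu := (lebesgue_vec R d).
Local Notation nu := (sfprod (lebesgue_vec R d) (lebesgue_vec R d)).
Local Notation vec := (vec R d).
Local Notation op := ((vec -> R[i]) -> (vec -> R[i])).
Implicit Types (A : op) (f g : vec -> R[i]) (w z : vec * vec).

Lemma ae_eq0_n2 f : cmeas f -> f = (fun=> 0) %[ae mu] -> n2 mu f = 0.
Proof.
move=> mf f0; have -> : n2 mu f = fine (\int[mu]_x (cst 0 x))%E; last by rewrite integral0.
congr fine; apply: ae_eq_integral => //; first exact: measurable_nsqE.
by apply: filterS f0 => x /= H xT; rewrite H// nsq0.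
Qed.

Section weighted_composition.
Variables (c : vec -> R) (p : vec -> vec).
Hypotheses (mc : measurable_fun setT c) (pp : preserves mu mu p).

Let U f := fun t => expi (c t) * f (p t).

Lemma N2_weighted_composition f : cmeas f -> N2 mu (U f) = N2 mu f.
Proof.
move=> mf; rewrite -(preserves_N2 pp mf); apply: eq_integral => t _.
by rewrite nsqM nsq_expi mul1r.
Qed.

Lemma L2_weighted_composition f : L2 mu f -> L2 mu (U f).
Proof.
move=> /L2P[mf foo]; apply/L2P; split; last by rewrite N2_weighted_composition.
by apply: cmeasM; [exact: cmeas_expi|have [mp _] := pp; exact: (cmeas_comp mp mf)].
Qed.

Lemma bounded_weighted_composition : bounded_operator U.
Proof.
split.
- exact: L2_weighted_composition.
(* Equality almost everywhere is carried over through norms: [U] is isometric, so the image of a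
   difference of norm 0 has norm 0. *)
- move=> f g Lf Lg fg; have Ld := L2B Lf Lg.
  have UE : U (fun t => f t - g t) = (fun t => U f t - U g t).
    by apply/funext => t; rewrite /U mulrBr.
  have z : n2 mu (U (fun t => f t - g t)) = 0.
    rewrite /n2 N2_weighted_composition; last exact: L2_cmeas Ld.
    apply: ae_eq0_n2; first exact: L2_cmeas Ld.
    by apply: filterS fg => t H _; rewrite H// subrr.
  have := n2_eq0 (L2_weighted_composition Ld) z; rewrite UE.
  by apply: filterS => t H _; apply/eqP; rewrite -subr_eq0 H.
- move=> a f g _ _; by apply: aeW => t _; rewrite /U; ring.
- exists 1 => f Lf; rewrite mul1e !L2norm_sqrt//; last exact: L2_weighted_composition.
  by rewrite /n2 N2_weighted_composition//; exact: L2_cmeas Lf.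
Qed.

End weighted_composition.

(** The explicit pi(w)^*: the modulation is undone first and the translation second, so the phase is
    evaluated at t + w1. *)
Definition tfshift_adjoint w : op :=
  fun f t => expi (- (2 * pi * dotv w.2 (vadd t w.1))) * f (vadd t w.1).

Lemma measurable_phase (x : vec) (p : vec -> vec) : measurable_fun setT p ->
  measurable_fun setT (fun t => 2 * pi * dotv x (p t)).
Proof.
move=> mp; apply: measurable_funM => //.
exact: (measurableT_comp (measurableT_comp (@measurable_dotv R d) (pair1_measurable x)) mp).
Qed.

Lemma bounded_tfshift_adjoint w : bounded_operator (tfshift_adjoint w).
Proof.
apply: bounded_weighted_composition; last exact: preserves_vadd.
apply: measurable_funN; apply: measurable_phase.
by have [] := preserves_vadd w.1.
Qed.

Lemma dot_tfshift w f g : L2 mu f -> L2 mu g ->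
  L2dot mu (tfshift w f) g = L2dot mu f (tfshift_adjoint w g).
Proof.
move=> Lf Lg; have LU := bop_L2 (bounded_tfshift_adjoint w) Lg.
rewrite /L2dot -(preserves_Cintegral (preserves_vsub w.1) (Cintble_cmeas (L2_Cintble Lf LU))).
apply: eq_Cintegral => t; rewrite /tfshift_adjoint vaddK conjcM conj_expi opprK.
by rewrite /tfshift /translation; ring.
Qed.

Lemma adjoint_tfshift w : bounded_operator (adjoint (tfshift w)) /\
  forall g, L2 mu g -> adjoint (tfshift w) g = tfshift_adjoint w g %[ae mu].
Proof.
by apply: adjoint_spec; [exact: bounded_tfshift_adjoint|exact: dot_tfshift].
Qed.

Definition kernel_shift w z (k : vec * vec -> R[i]) (p : vec * vec) : R[i] :=
  expi (2 * pi * dotv z.2 p.1 - 2 * pi * dotv w.2 p.2) *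
  k (vsub p.1 z.1, vsub p.2 w.1).

Lemma preserves_vsub2 w z : preserves nu nu (fun p => (vsub p.1 z.1, vsub p.2 w.1)).
Proof. exact: (preserves_prod (preserves_vsub z.1) (preserves_vsub w.1)). Qed.

Lemma measurable_kernel_phase w z :
  measurable_fun setT (fun p : vec * vec => 2 * pi * dotv z.2 p.1 - 2 * pi * dotv w.2 p.2).
Proof.
apply: measurable_funB.
  exact: (measurableT_comp (measurable_phase z.2 (@measurable_id _ _ _)) measurable_fst).
exact: (measurableT_comp (measurable_phase w.2 (@measurable_id _ _ _)) measurable_snd).
Qed.

Lemma L2_kernel_shift w z k : L2 nu k -> L2 nu (kernel_shift w z k).
Proof.
move=> /L2P[mk koo]; have pp := preserves_vsub2 w z; apply/L2P; split.
  apply: cmeasM; first exact: cmeas_expi (measurable_kernel_phase w z).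
  by have [mp _] := pp; exact: (cmeas_comp mp mk).
rewrite (_ : N2 _ _ = N2 nu k)// -(preserves_N2 pp mk); apply: eq_integral => p _.
by rewrite nsqM nsq_expi mul1r.
Qed.

(** The chosen adjoint agrees with the explicit one only almost everywhere, and [bop_ae] for [A]
    allows the exchange. Translating both kernel variables then moves the shifts from the test
    functions to the kernel. *)
Lemma kernel_of_gammashift A k w z : bounded_operator A -> kernel_of A k ->
  kernel_of (gammashift w z A) (kernel_shift w z k).
Proof.
move=> bA [Lk Ak]; split=> [|f g Lf Lg]; first exact: L2_kernel_shift.
have [bV aV] := adjoint_tfshift w.
have LV := bop_L2 bV Lf; have LU := bop_L2 (bounded_tfshift_adjoint w) Lf.
have LUg := bop_L2 (bounded_tfshift_adjoint z) Lg.
rewrite /gammashift /= dot_tfshift//; last exact: bop_L2.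
rewrite (ae_eq_dotl (bop_L2 bA LV) (bop_L2 bA LU) LUg (bop_ae bA LV LU (aV _ Lf))) Ak//.
rewrite /L2dot -(preserves_Cintegral (preserves_vsub2 w z)
  (Cintble_cmeas (L2_Cintble Lk (L2_tensor LUg LU)))).
apply: eq_Cintegral => p; rewrite /tensor /kernel_shift /tfshift_adjoint /= !vaddK.
by rewrite !conjcM !conjcK conj_expi opprK expiD; ring.
Qed.

End time_frequency_shifts.

(** * The Cohen class as a transform of kernels *)

Section ambiguity.
Context (R : realType) (d : nat).
Local Notation mu := (lebesgue_vec R d).
Local Notation nu := (sfprod (lebesgue_vec R d) (lebesgue_vec R d)).
Local Notation phase := (vec R d * vec R d)%type.
Implicit Types (f g : phase -> R[i]) (wz : phase * phase).

(** The variables w, z are regrouped as a = (z1, w1) and b = (z2, w2), in the order of the two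
    kernel arguments. Translations are then outside and frequencies inside, ready for Plancherel's
    formula in b at fixed a. *)
Lemma ge0_integral_interchange (F : phase * phase -> \bar R) :
  measurable_fun setT F -> (forall p, (0 <= F p)%E) ->
  (\int[sfprod nu nu]_p F p =
   \int[nu]_a \int[nu]_b F ((a.2, b.2), (a.1, b.1)))%E.
Proof.
move=> mF F0.
pose G (p : (vec R d * vec R d) * (vec R d)) := (\int[mu]_c F (p.1, (p.2, c)))%E.
have mpi : measurable_fun setT (fun q : ((vec R d * vec R d) * (vec R d)) * vec R d =>
    (q.1.1, (q.1.2, q.2))).
  apply: measurable_fun_pair; first exact: measurableT_comp.
  by apply: measurable_fun_pair => //; exact: measurableT_comp.
have mG : measurable_fun setT G.
  apply: (@measurable_fun_fubini_tonelli_F _ _ _ _ _ mu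
    (fun q : ((vec R d * vec R d) * (vec R d)) * vec R d => F (q.1.1, (q.1.2, q.2)))) => //.
  exact: (measurableT_comp mF mpi).
have G0 p : (0 <= G p)%E by apply: integral_ge0.
have mFw (w : phase) : measurable_fun setT (fun z => F (w, z)).
  exact: (measurableT_comp mF (pair1_measurable w)).
have iz (w : phase) : (\int[nu]_z F (w, z) = \int[mu]_z1 G (w, z1))%E.
  exact: (@fubini_tonelli1 _ _ _ _ _ mu mu (fun z => F (w, z))).
rewrite [LHS](@fubini_tonelli1 _ _ _ _ _ nu nu F)//.
rewrite /fubini_F; under eq_integral do rewrite iz.
rewrite [LHS](@fubini_tonelli1 _ _ _ _ _ mu mu (fun w => \int[mu]_z1 G (w, z1))%E); first last.
- by move=> w; apply: integral_ge0.
- exact: (@measurable_fun_fubini_tonelli_F _ _ _ _ _ mu G).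
rewrite [RHS](@fubini_tonelli2 _ _ _ _ _ mu mu
  (fun a => \int[nu]_b F ((a.2, b.2), (a.1, b.1)))%E); first last.
- by move=> a; apply: integral_ge0.
- apply: (@measurable_fun_fubini_tonelli_F _ _ _ _ _ nu
    (fun q : phase * phase => F ((q.1.2, q.2.2), (q.1.1, q.2.1)))) => //.
  apply: (measurableT_comp mF); apply: measurable_fun_pair; apply: measurable_fun_pair;
    exact: measurableT_comp.
apply: eq_integral => w1 _; rewrite /fubini_F /fubini_G.
rewrite [LHS](@fubini_tonelli _ _ _ _ _ mu mu (fun q => G ((w1, q.1), q.2)))//=; first last.
  apply: (measurableT_comp mG); apply: measurable_fun_pair => //.
  exact: (measurableT_comp (pair1_measurable w1)).
apply: eq_integral => z1 _.
rewrite [RHS](@fubini_tonelli2 _ _ _ _ _ mu mu (fun b => F ((w1, b.2), (z1, b.1))))//.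
apply: (measurableT_comp mF); apply: measurable_fun_pair.
  exact: (measurableT_comp (pair1_measurable w1)).
exact: (measurableT_comp (pair1_measurable z1)).
Qed.

(** Q_R(S) for f the kernel of S and g that of the window R. *)
Definition ambiguity f g wz : R[i] := L2dot nu f (kernel_shift wz.1 wz.2 g).

Lemma cmeas_ambiguity f g : cmeas f -> cmeas g -> cmeas (ambiguity f g).
Proof.
move=> mf mg.
apply: (@cmeas_Cintegral _ _ _ _ _ nu (fun q : (phase * phase) * phase =>
  f q.2 * conjc (kernel_shift q.1.1 q.1.2 g q.2))).
apply: cmeasM; first exact: (cmeas_comp measurable_snd mf).
have m11 : measurable_fun setT (fun q : (phase * phase) * phase => q.1.1.1).
  by do 2!(apply: measurableT_comp => //); exact: measurableT_comp.
have m12 : measurable_fun setT (fun q : (phase * phase) * phase => q.1.1.2).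
  by do 2!(apply: measurableT_comp => //); exact: measurableT_comp.
have m21 : measurable_fun setT (fun q : (phase * phase) * phase => q.1.2.1).
  by do 2!(apply: measurableT_comp => //); exact: measurableT_comp.
have m22 : measurable_fun setT (fun q : (phase * phase) * phase => q.1.2.2).
  by do 2!(apply: measurableT_comp => //); exact: measurableT_comp.
have ms : measurable_fun setT (fun q : (phase * phase) * phase => q.2.1).
  exact: measurableT_comp.
have mt : measurable_fun setT (fun q : (phase * phase) * phase => q.2.2).
  exact: measurableT_comp.
apply: cmeas_conj; apply: cmeasM.
  apply: (@cmeas_expi _ _ _ (fun q : (phase * phase) * phase =>
    2 * pi * dotv q.1.2.2 q.2.1 - 2 * pi * dotv q.1.1.2 q.2.2)).
  apply: measurable_funB; apply: measurable_funM => //.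
    exact: (measurableT_comp (@measurable_dotv R d) (measurable_fun_pair m22 ms)).
  exact: (measurableT_comp (@measurable_dotv R d) (measurable_fun_pair m12 mt)).
apply: (@cmeas_comp _ _ _ _ _ g (fun q : (phase * phase) * phase =>
  (vsub q.2.1 q.1.2.1, vsub q.2.2 q.1.1.1))) => //.
apply: measurable_fun_pair.
  exact: (measurableT_comp (@measurable_vsub R d) (measurable_fun_pair ms m21)).
exact: (measurableT_comp (@measurable_vsub R d) (measurable_fun_pair mt m11)).
Qed.

Lemma dotvC n (x y : vec R n) : dotv x y = dotv y x.
Proof. by apply: eq_bigr => i _; rewrite mulrC. Qed.

Lemma N2_ambiguity f g : L2 nu f -> L2 nu g ->
  N2 (sfprod nu nu) (ambiguity f g) = (N2 nu f * N2 nu g)%E.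
Proof.
move=> Lf Lg; have mf := L2_cmeas Lf; have mg := L2_cmeas Lg.
have ma := cmeas_ambiguity mf mg.
rewrite [LHS]ge0_integral_interchange; first last.
- by move=> p; rewrite lee_fin nsq_ge0.
- exact: measurable_nsqE.
(* The conjugated shifted kernel has phase -2 pi z2.s + 2 pi w2.t, so the pair in the first variable
   takes the opposite sign. *)
have [_ FP] := fourier_pair_prod (fourier_pair_opp (fourier_pair_vec R d)) (fourier_pair_vec R d).
pose D (x y : phase) : phase := (vsub x.1 y.1, vsub x.2 y.2).
have pD y : preserves nu nu (D ^~ y).
  exact: (preserves_prod (preserves_vsub y.1) (preserves_vsub y.2)).
have pDl x : preserves nu nu (D x).
  exact: (preserves_prod (preserves_vsubl x.1) (preserves_vsubl x.2)).
have LgD y : L2 nu (fun x => g (D x y)).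
  apply/L2P; split; first by have [mp _] := pD y; exact: (cmeas_comp mp mg).
  by rewrite (preserves_N2 (pD y) mg); have [] := (L2P _ _).1 Lg.
transitivity (\int[nu]_y \int[nu]_x (nsq (f x) * nsq (g (D x y)))%:E)%E.
  apply: eq_integral => y _.
  transitivity (N2 nu (fun x => f x * conjc (g (D x y)))).
    (* The product of two L^2 functions is integrable, as a Fourier pair requires. *)
    rewrite -FP; last exact: L2_Cintble.
    apply: eq_integral => b _; congr (nsq _)%:E; apply: eq_Cintegral => x.
    rewrite /kernel_shift conjcM conj_expi /D /= mulrCA; congr (expi _ * _).
    by rewrite (dotvC b.1) (dotvC b.2) opprB addrC.
  by apply: eq_integral => x _; rewrite nsqM nsq_conj.
have mD : measurable_fun setT (fun p : phase * phase => D p.1 p.2).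
  have m11 : measurable_fun setT (fun p : phase * phase => p.1.1) by exact: measurableT_comp.
  have m12 : measurable_fun setT (fun p : phase * phase => p.1.2) by exact: measurableT_comp.
  have m21 : measurable_fun setT (fun p : phase * phase => p.2.1) by exact: measurableT_comp.
  have m22 : measurable_fun setT (fun p : phase * phase => p.2.2) by exact: measurableT_comp.
  apply: measurable_fun_pair.
    exact: (measurableT_comp (@measurable_vsub R d) (measurable_fun_pair m11 m21)).
  exact: (measurableT_comp (@measurable_vsub R d) (measurable_fun_pair m12 m22)).
have mgD : cmeas (fun p : phase * phase => g (D p.1 p.2)) by exact: (cmeas_comp mD mg).
have mf1 : cmeas (fun p : phase * phase => f p.1) by exact: (cmeas_comp measurable_fst mf).
have := @fubini_tonelli _ _ _ _ _ nu nu (fun p => (nsq (f p.1) * nsq (g (D p.1 p.2)))%:E).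
move=> /= <-; first last.
- by move=> p; rewrite lee_fin mulr_ge0 ?nsq_ge0.
- apply/measurable_EFinP; apply: measurable_funM; exact: measurable_nsq.
(* At fixed x the map y -> x - y preserves the measure, so the integral over y is the squared norm
   of g. *)
transitivity (\int[nu]_x ((n2 nu g)%:E * (nsq (f x))%:E))%E.
  apply: eq_integral => x _; under eq_integral do rewrite EFinM.
  rewrite ge0_integralZl//; first last.
  - by rewrite lee_fin nsq_ge0.
  - by move=> y _; rewrite lee_fin nsq_ge0.
  - by apply: measurable_nsqE; exact: (cmeas_pair1 x mgD).
  by rewrite [X in (_ * X)%E](preserves_N2 (pDl x) mg) muleC (n2E Lg).
rewrite ge0_integralZl//; first by rewrite (n2E Lg) muleC.
- exact: measurable_nsqE.
- by move=> x _; rewrite lee_fin nsq_ge0.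
- by rewrite lee_fin n2_ge0.
Qed.

Lemma L2_ambiguity f g : L2 nu f -> L2 nu g -> L2 (sfprod nu nu) (ambiguity f g).
Proof.
move=> Lf Lg; apply/L2P; split; first exact: cmeas_ambiguity (L2_cmeas Lf) (L2_cmeas Lg).
by rewrite N2_ambiguity// -!n2E// -EFinM ltry.
Qed.

Lemma ambiguity_linl (a : R[i]) f1 f2 g : L2 nu f1 -> L2 nu f2 -> L2 nu g ->
  ambiguity (fun p => a * f1 p + f2 p) g = (fun wz => a * ambiguity f1 g wz + ambiguity f2 g wz).
Proof.
move=> L1 L2_ Lg; apply/funext => wz; rewrite /ambiguity dot_linl//.
exact: L2_kernel_shift.
Qed.

Lemma ambiguity_linr (a : R[i]) f g1 g2 : L2 nu f -> L2 nu g1 -> L2 nu g2 ->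
  ambiguity f (fun p => a * g1 p + g2 p) =
  (fun wz => conjc a * ambiguity f g1 wz + ambiguity f g2 wz).
Proof.
move=> Lf L1 L2_; apply/funext => wz; rewrite /ambiguity -dot_linr//; first last.
- exact: L2_kernel_shift.
- exact: L2_kernel_shift.
by congr L2dot; apply/funext => p; rewrite /kernel_shift; ring.
Qed.

(** Polarisation in f1, f2 under a common window, followed by polarisation in the windows. *)
Lemma dot_ambiguity f1 f2 g1 g2 : L2 nu f1 -> L2 nu f2 -> L2 nu g1 -> L2 nu g2 ->
  L2dot (sfprod nu nu) (ambiguity f1 g1) (ambiguity f2 g2) =
  L2dot nu f1 f2 * conjc (L2dot nu g1 g2).
Proof.
move=> Lf1 Lf2 Lg1 Lg2.
have Plin (a : R[i]) (f g : phase -> R[i]) :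
  L2 nu f -> L2 nu g -> L2 nu (fun x => a * f x + g x) by exact: L2_lin.
have same g f f' : L2 nu g -> L2 nu f -> L2 nu f' ->
    L2dot (sfprod nu nu) (ambiguity f g) (ambiguity f' g) = L2dot nu f f' * L2dot nu g g.
  move=> Lg; move: f f'; apply: (sesquilinear_eq Plin).
  - move=> a f f' h Lf Lf' Lh; rewrite !ambiguity_linl//.
    have [Af Af' Ah] := And3 (L2_ambiguity Lf Lg) (L2_ambiguity Lf' Lg) (L2_ambiguity Lh Lg).
    by split; [exact: dot_linl|exact: dot_linr].
  - move=> a f f' h Lf Lf' Lh; rewrite dot_linl// dot_linr//.
    by split; ring.
  - move=> f Lf; rewrite !dot_n2//; last exact: L2_ambiguity.
    by rewrite -rmorphM /n2 N2_ambiguity// fineM// -n2E.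
rewrite -(dot_conj Lg1 Lg2).
(* [ambiguity] is conjugate-linear in its window, so the form is linear in [g2] and conjugate-linear
   in [g1]; hence the reversed order. *)
move: g2 g1 Lg2 Lg1; apply: (sesquilinear_eq Plin
  (F := fun g2 g1 => L2dot (sfprod nu nu) (ambiguity f1 g1) (ambiguity f2 g2))
  (G := fun g2 g1 => L2dot nu f1 f2 * L2dot nu g2 g1)).
- move=> a g g' h Lg Lg' Lh; rewrite !ambiguity_linr//.
  split; last exact: (dot_linl _ (L2_ambiguity Lf1 Lg) (L2_ambiguity Lf1 Lg') (L2_ambiguity Lf2 Lh)).
  rewrite -[X in _ = X * _ + _]conjcK.
  exact: (dot_linr _ (L2_ambiguity Lf2 Lg) (L2_ambiguity Lf2 Lg') (L2_ambiguity Lf1 Lh)).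
- move=> a g g' h Lg Lg' Lh; rewrite dot_linl// dot_linr//.
  by split; ring.
- by move=> g Lg; exact: same.
Qed.

End ambiguity.

(** Equality holds at every point, because [HSdot_kernel] evaluates each inner product exactly. The
    required basis comes from the Hilbert-Schmidt property of [S]. *)
Lemma polarised_cohen_kernel (R : realType) (d : nat)
    (S A : (vec R d -> R[i]) -> (vec R d -> R[i])) kS kA :
  hilbert_schmidt S -> kernel_of S kS -> kernel_of A kA ->
  polarised_cohen S A = ambiguity kA kS.
Proof.
move=> [bS [e be _]] kSS kAA; apply/funext => wz.
by apply: HSdot_kernel; [exists e|exact: kAA|exact: kernel_of_gammashift].
Qed.

Section eq_measure.
Context d (T : measurableType d) (R : realType) (m1 m2 : {measure set T -> \bar R}).
Hypothesis m12 : forall A, m1 A = m2 A.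

Lemma eq_measure_Cintegral (f : T -> R[i]) : Cintegral m1 f = Cintegral m2 f.
Proof.
by rewrite /Cintegral /Rintegral; congr (fine _ +i* fine _);
  apply: eq_measure_integral => A _ _; exact: m12.
Qed.

Lemma eq_measure_L2 (f : T -> R[i]) : L2 m1 f <-> L2 m2 f.
Proof.
have E : N2 m1 f = N2 m2 f by apply: eq_measure_integral => A _ _; exact: m12.
by rewrite !L2P E.
Qed.

End eq_measure.

(** [L2dot] has a value for any two functions; the two memberships in L^2 guarantee that here it is
    a convergent integral. *)
Theorem proposition3p5 (K : realType) (d : nat) (hd : (0 < d)%N)
    (R S T W : (vec K d -> K[i]) -> (vec K d -> K[i])) :
  hilbert_schmidt R -> hilbert_schmidt S ->
  hilbert_schmidt T -> hilbert_schmidt W ->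
  [/\ L2 (lebesgue_phase2 K d) (polarised_cohen R S),
      L2 (lebesgue_phase2 K d) (polarised_cohen T W) &
      L2dot (lebesgue_phase2 K d) (polarised_cohen R S) (polarised_cohen T W) =
        HSdot S W * conjc (HSdot R T)].
Proof.
move=> hR hS hT hW; have [_ [e be _]] := hR.
have be' : exists e : nat -> vec K d -> K[i], orthonormal_basis e by exists e.
have [kR kRR] := hilbert_schmidt_kernel hR; have [kS kSS] := hilbert_schmidt_kernel hS.
have [kT kTT] := hilbert_schmidt_kernel hT; have [kW kWW] := hilbert_schmidt_kernel hW.
have [[LR _] [LS _] [LT _] [LW _]] := And4 kRR kSS kTT kWW.
rewrite (polarised_cohen_kernel hR kRR kSS) (polarised_cohen_kernel hT kTT kWW).
rewrite (HSdot_kernel be' kSS kWW) (HSdot_kernel be' kRR kTT).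
(* The two measures are the same set function but carry separately built structures, so integrals
   are transported along this equality. *)
have mE A : lebesgue_phase2 K d A = sfprod (sfprod (lebesgue_vec K d) (lebesgue_vec K d))
    (sfprod (lebesgue_vec K d) (lebesgue_vec K d)) A by [].
split.
- by apply/(eq_measure_L2 mE); exact: L2_ambiguity.
- by apply/(eq_measure_L2 mE); exact: L2_ambiguity.
- by rewrite /(L2dot (lebesgue_phase2 K d)) (eq_measure_Cintegral mE); exact: dot_ambiguity.
Qed.
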